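(* Assume the setting in the context, and suppose that for some $\alpha>0$ and all $e\in U$, $$\int_\Omega |\log p(\omega,e)|^{d+\alpha}\,d\mathbb{P}(\omega)<\infty .$$ Then for every $\lambda\in\mathbb{R}^d$, for $\mathbb{P}$-almost every $\omega$, $$\lim_{n\to\infty}\frac1n\log E^{P_\omega}\left[\mathrm{e}^{\langle\lambda,X_n\rangle}\right]=\Lambda(\lambda).$$
   Context: Let $d\ge 1$ and $U=\{e\in\mathbb{Z}^d: |e|=1\}$, where $|x|=|x_1|+\dots+|x_d|$ is the $\ell_1$ norm. Let $(\Omega,\mathcal{F},\mathbb{P})$ be a probability space with $\mathcal{F}$ countably generated, and let $\{T_e\}_{e\in U}$ be commuting $\mathbb{P}$-measure-preserving transformations of $\Omega$ with $T_{-e}=T_e^{-1}$, forming an ergodic family (every event invariant under all $T_e$ has probability $0$ or $1$). For $x\in\mathbb{Z}^d$ write $T_x=T_{e_1}^{x_1}\cdots T_{e_d}^{x_d}$ ($e_i$ the $i$-th unit vector). Let $p:\Omega\times U\to[0,1]$ be measurable with $\sum_{e\in U}p(\omega,e)=1$ for all $\omega$. For fixed $\omega$, $P_\omega$ denotes the law of the nearest-neighbour random walk $(X_n)_{n\ge0}$ on $\mathbb{Z}^d$ with $X_0=0$ and $P_\omega(X_{n+1}=X_n+e\mid X_0,\dots,X_n)=p(T_{X_n}\omega,e)$, $e\in U$; $E^{P_\omega}$ is expectation under $P_\omega$, and $\mathbb{E}$ is expectation under $\mathbb{P}$. A function $F:\Omega\times U\to\mathbb{R}$ is in class $\mathcal{K}$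 if: (i) there is $\alpha>0$ with $\mathbb{E}[|F(\cdot,e)|^{d+\alpha}]<\infty$ for every $e\in U$; (ii) $\mathbb{E}[F(\cdot,e)]=0$ for every $e\in U$; (iii) ($\mathbb{P}$-a.s.) for every finite sequence $x_0,\dots,x_n\in\mathbb{Z}^d$ with $x_{i+1}-x_i\in U$ and $x_0=x_n$, $\sum_{i=0}^{n-1}F(T_{x_i}\omega,x_{i+1}-x_i)=0$. Define $$\Lambda(\lambda)=\inf_{F\in\mathcal{K}}\ \operatorname*{ess\,sup}_{\omega}\ \log\sum_{e\in U}p(\omega,e)\,\mathrm{e}^{\langle\lambda,e\rangle+F(\omega,e)},$$ the essential supremum taken with respect to $\mathbb{P}$. *)

(* Defs.v *)
From HB Require Import structures.
From mathcomp Require Import all_boot all_order all_algebra.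
From mathcomp Require Import all_classical all_reals all_analysis ess_sup_inf.
Set Implicit Arguments. Unset Strict Implicit. Unset Printing Implicit Defensive.
Import Order.TTheory GRing.Theory Num.Theory.
Local Open Scope classical_set_scope.
Local Open Scope ring_scope.

(* The set U = {e in Z^d : |e|_1 = 1} of unit steps is encoded by the finite type
   'I_d * bool : (i, false) stands for +e_i and (i, true) stands for -e_i. *)
Definition dir (d : nat) : finType := ('I_d * bool)%type.

Definition unitvec (d : nat) (i : 'I_d) : 'rV[int]_d := \row_j (i == j)%:R.

Definition vec_of (d : nat) (e : dir d) : 'rV[int]_d :=
  if e.2 then - unitvec e.1 else unitvec e.1.

Definition dir_opp (d : nat) (e : dir d) : dir d := (e.1, ~~ e.2).

(* T_{e_i}^z for z : int, using T_{-e_i} = T_{e_i}^{-1} *)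
Definition Tpow (Omega : Type) (d : nat) (T : dir d -> Omega -> Omega)
    (i : 'I_d) (z : int) : Omega -> Omega :=
  match z with
  | Posz n => iter n (T (i, false))
  | Negz n => iter n.+1 (T (i, true))
  end.

Definition Tx (Omega : Type) (d : nat) (T : dir d -> Omega -> Omega)
    (x : 'rV[int]_d) : Omega -> Omega :=
  foldr (fun i f => Tpow T i (x ord0 i) \o f) id (enum 'I_d).

Fixpoint path_sum (Omega : Type) (R : numDomainType) (d : nat)
    (T : dir d -> Omega -> Omega) (F : Omega -> dir d -> R)
    (w : Omega) (x : 'rV[int]_d) (s : seq (dir d)) : R :=
  match s with
  | [::] => 0
  | e :: s' => F (Tx T x w) e + path_sum T F w (x + vec_of e) s'
  end.

Definition path_end (d : nat) (x : 'rV[int]_d) (s : seq (dir d)) : 'rV[int]_d :=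
  x + \sum_(e <- s) vec_of e.

(* probability under P_w of following exactly the steps s from 0 (Markov property) *)
Fixpoint path_prob (Omega : Type) (R : numDomainType) (d : nat)
    (T : dir d -> Omega -> Omega) (p : Omega -> dir d -> R)
    (w : Omega) (x : 'rV[int]_d) (s : seq (dir d)) : R :=
  match s with
  | [::] => 1
  | e :: s' => p (Tx T x w) e * path_prob T p w (x + vec_of e) s'
  end.

Definition dotZ (R : realType) (d : nat) (lam : 'rV[R]_d) (x : 'rV[int]_d) : R :=
  \sum_i lam ord0 i * (x ord0 i)%:~R.

Definition quenched_mgf (Omega : Type) (R : realType) (d : nat)
    (T : dir d -> Omega -> Omega) (p : Omega -> dir d -> R)
    (w : Omega) (lam : 'rV[R]_d) (n : nat) : R :=
  \sum_(s : n.-tuple (dir d))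
     path_prob T p w 0 s * expR (dotZ lam (path_end 0 s)).

Definition classK (dsp : measure_display) (Omega : measurableType dsp) (R : realType)
    (P : probability Omega R) (d : nat) (T : dir d -> Omega -> Omega)
    (F : Omega -> dir d -> R) : Prop :=
  (forall e, measurable_fun setT (fun w => F w e)) /\
  (exists a : R, 0 < a /\
     forall e, (\int[P]_w ((`|F w e| `^ (d%:R + a))%:E) < +oo)%E) /\
  (forall e, (\int[P]_w (F w e)%:E = 0)%E) /\
  {ae P, forall w, forall (x0 : 'rV[int]_d) (s : seq (dir d)),
      \sum_(e <- s) vec_of e = 0 -> path_sum T F w x0 s = 0}.

Definition Lambda (dsp : measure_display) (Omega : measurableType dsp) (R : realType)
    (P : probability Omega R) (d : nat) (T : dir d -> Omega -> Omega)
    (p : Omega -> dir d -> R) (lam : 'rV[R]_d) : \bar R :=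
  ereal_inf [set ess_sup P (fun w =>
                 (ln (\sum_(e : dir d) p w e * expR (dotZ lam (vec_of e) + F w e)))%:E)
            | F in [set F | classK P T F]].

(* Main.v *)
Require Import Defs.
From HB Require Import structures.
From mathcomp Require Import all_boot all_order all_algebra.
From mathcomp Require Import all_classical all_reals all_analysis ess_sup_inf.
From mathcomp Require Import measurable_realfun.
From mathcomp Require Import zify ring lra.
Set Implicit Arguments. Unset Strict Implicit. Unset Printing Implicit Defensive.
Import Order.TTheory GRing.Theory Num.Theory.
Import numFieldNormedType.Exports.
Local Open Scope classical_set_scope.
Local Open Scope ring_scope.

(* Write g_n(w) for the quenched moment generating function of X_n at lam.

   Upper bound on Lambda: if G = sum_n exp(- c n) g_n is finite almost surely, then
   F(w, e) = ln G(T_e w) - ln G(w) is in the class K, because |F| is dominated by the logarithms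
   of the transition probabilities and an integrable coboundary has mean zero; moreover
   G = 1 + exp(- c) sum_e p e^<lam, e> G o T_e bounds the essential supremum for F by c.

   Lower bound on Lambda: let F be in K with essential supremum at most M < c, and suppose that
   g_n >= exp(c n) infinitely often with positive probability. A discrete Morrey estimate, which
   needs the moments of order > d, lets the walk correct its endpoint at small cost, so along a
   fixed direction z the point-to-point weights at times m k grow at rate at least (M + c) / 2
   infinitely often. They are supermultiplicative, hence grow at that rate for all large k almost
   surely (the easy half of Kingman's theorem). Since F sums to zero over loops, the same weights
   are at most exp(M m k - S_k), where S_k is a Birkhoff sum of a centered function; then S_k has
   a negative linear drift, which is absurd.

   Both rates therefore equal Lambda, and the supermultiplicative growth along a direction turns
   the upper limit of (ln g_n) / n into a limit. *)

(** * Path costs on dyadic cubes *)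

(** The transition probabilities are not bounded below, so moving an endpoint of the walk by one
    site has no uniform price. The substitute for uniform ellipticity is that [step_cost] has a
    moment of order above d: inside the cube of radius 2^i, joining two sites whose distance is a
    small enough fraction of 2^i costs at most eps 2^i.

    No rate function is constructed. At time n there are polynomially many endpoints; rounding a
    best one to z k, with m fixed and k of order n / m, leaves finitely many z, so one of them
    recurs. This z depends on the environment until a zero-one law makes the event of one
    deterministic z almost sure. The superadditive sequence along [Tx T z] then has a known upper
    rate, and only its lower rate must be matched.

    Finiteness of G is a good dichotomy because it passes to neighbours at a finite price, hence has
    probability zero or one: finiteness yields a corrector, while divergence forces frequent growth
    at every smaller rate. Since ln G itself is not known to be integrable, the mean of its
    increments is computed by truncation. *)

Section Reach.
Context (d : nat) (R : realType) (zeta : 'rV[int]_d -> R).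
Hypothesis zeta_ge0 : forall x, 0 <= zeta x.

(** Costs sit on vertices and both endpoints are counted. Reversing a path therefore preserves its
    cost, and concatenation only overcounts the junction. *)
Fixpoint path_cost (x : 'rV[int]_d) (s : seq (dir d)) : R :=
  zeta x + (if s is e :: s' then path_cost (x + vec_of e) s' else 0).

Definition reach (x y : 'rV[int]_d) (c : R) :=
  exists s : seq (dir d), y = path_end x s /\ path_cost x s <= c.

Lemma path_end_nil (x : 'rV[int]_d) : path_end x [::] = x.
Proof. by rewrite /path_end big_nil addr0. Qed.

Lemma path_end_cons (x : 'rV[int]_d) e s :
  path_end x (e :: s) = path_end (x + vec_of e) s.
Proof. by rewrite /path_end big_cons addrA. Qed.

Lemma path_end_cat (x : 'rV[int]_d) s t :
  path_end x (s ++ t) = path_end (path_end x s) t.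
Proof. by rewrite /path_end big_cat addrA. Qed.

Lemma vec_of_opp (e : dir d) : vec_of (dir_opp e) = - vec_of e.
Proof. by case: e => i [] //=; rewrite /vec_of /= opprK. Qed.

Lemma path_cost_ge0 x s : 0 <= path_cost x s.
Proof. by elim: s x => [|e s IH] x /=; rewrite addr_ge0. Qed.

Lemma path_cost_cat x s t :
  path_cost x (s ++ t) <= path_cost x s + path_cost (path_end x s) t.
Proof.
elim: s x => [|e s IH] x /=.
  by rewrite path_end_nil addr0 lerDr.
by rewrite path_end_cons -addrA lerD2l.
Qed.

Lemma reach_refl x : reach x x (zeta x).
Proof. by exists [::]; rewrite path_end_nil /= addr0. Qed.

Lemma reach_le x y c c' : c <= c' -> reach x y c -> reach x y c'.
Proof. by move=> h [s [-> hs]]; exists s; split=> //; exact: le_trans h. Qed.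

Lemma reach_trans x y z c c' : reach x y c -> reach y z c' -> reach x z (c + c').
Proof.
move=> [s [-> hs]] [t [-> ht]]; exists (s ++ t); split; first by rewrite path_end_cat.
by apply: le_trans (path_cost_cat _ _ _) _; exact: lerD.
Qed.

Lemma reach_step x y c e : reach x y c -> reach x (y + vec_of e) (c + zeta (y + vec_of e)).
Proof.
move=> [s [-> hs]]; exists (s ++ [:: e]); split.
  by rewrite path_end_cat /path_end big_seq1.
suff -> : path_cost x (s ++ [:: e]) = path_cost x s + zeta (path_end x s + vec_of e) by rewrite lerD2r.
elim: s x {hs} => [|a s IH] x /=; first by rewrite path_end_nil !addr0.
by rewrite IH path_end_cons addrA.
Qed.

Lemma reach_src x y c : reach x y c -> zeta x <= c.
Proof.
move=> [[|e s] [_ /=]]; first by rewrite addr0.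
by apply: le_trans; rewrite lerDl path_cost_ge0.
Qed.

Lemma reach_sym x y c : reach x y c -> reach y x c.
Proof.
move=> [s [-> hs]]; suff: reach (path_end x s) x (path_cost x s) by apply: reach_le.
elim: s x {hs} => [|e s IH] x /=.
  by rewrite path_end_nil addr0; exact: (reach_refl x).
rewrite path_end_cons [zeta x + _]addrC; have := reach_step (dir_opp e) (IH (x + vec_of e)).
by rewrite vec_of_opp addrK.
Qed.

End Reach.

(** * Averaging path costs over boxes *)

Section Grid.
Context (d H : nat) (R : realType) (zeta : 'rV[int]_d -> R).
Hypothesis zeta_ge0 : forall x, 0 <= zeta x.
Implicit Types (a : 'rV[int]_d) (g u : {ffun 'I_d -> 'I_H}) (i : 'I_d) (b : 'I_H).

Definition gridpt a g : 'rV[int]_d := \row_j (a ord0 j + (g j)%:Z).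

Definition upd g i b : {ffun 'I_d -> 'I_H} := [ffun j => if j == i then b else g j].

Definition box (B : 'I_d -> {set 'I_H}) : pred {ffun 'I_d -> 'I_H} :=
  [pred g : {ffun 'I_d -> 'I_H} | [forall j, g j \in B j]].

Lemma upd_id g i : upd g i (g i) = g.
Proof. by apply/ffunP => j; rewrite ffunE; case: eqP => // ->. Qed.

Lemma upd_upd g i b b' : upd (upd g i b) i b' = upd g i b'.
Proof. by apply/ffunP => j; rewrite !ffunE; case: eqP. Qed.

Lemma upd_at g i b : upd g i b i = b.
Proof. by rewrite ffunE eqxx. Qed.

Lemma card_box B : #|box B| = (\prod_i #|B i|)%N.
Proof.
transitivity #|family (fun i => mem (B i))|.
  by apply: eq_card => g; rewrite [LHS]inE; apply/forallP/familyP.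
by rewrite card_family foldrE big_map big_enum.
Qed.

Lemma reach_line_up a u i b1 b2 : (b1 <= b2)%N ->
  reach zeta (gridpt a (upd u i b1)) (gridpt a (upd u i b2))
    (\sum_(b : 'I_H | (b1 <= b <= b2)%N) zeta (gridpt a (upd u i b))).
Proof.
move=> b12; have [n nE] : exists n, (b2 = b1 + n :> nat)%N by exists (b2 - b1)%N; rewrite subnKC.
elim: n b2 nE {b12} => [|n IH] b2 nE.
  have -> : b2 = b1 by apply: val_inj; rewrite /= nE addn0.
  rewrite (eq_bigl (pred1 b1)); first by rewrite big_pred1_eq; exact: reach_refl.
  by move=> b /=; rewrite -eqn_leq -val_eqE /= eq_sym.
have b3H : (b1 + n < H)%N by rewrite (leq_trans _ (ltn_ord b2)) // nE addnS.
have := @IH (Ordinal b3H) erefl.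
move=> /(reach_step (i, false)); set y := (_ + vec_of _).
have -> : y = gridpt a (upd u i b2).
  apply/rowP => j; rewrite !mxE !ffunE; case: eqP => [->|/eqP/negPf ji]; last first.
    by rewrite eq_sym ji addr0.
  by rewrite eqxx nE /=; lia.
apply: reach_le; rewrite [leRHS](bigD1 b2) /=; last by rewrite leqnn nE leq_addr.
rewrite addrC; apply: lerD => //; rewrite [leRHS](eq_bigl (fun b : 'I_H => (b1 <= b <= b1 + n)%N)) //.
by move=> b /=; rewrite -val_eqE /=; lia.
Qed.

Lemma reach_line a u i b1 b2 (A : {set 'I_H}) :
  b1 \in A -> b2 \in A ->
  (forall b b1 b2, b1 \in A -> b2 \in A -> (b1 <= b <= b2)%N -> b \in A) ->
  reach zeta (gridpt a (upd u i b1)) (gridpt a (upd u i b2))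
    (\sum_(b in A) zeta (gridpt a (upd u i b))).
Proof.
move=> h1 h2 hA.
wlog b12 : b1 b2 h1 h2 / (b1 <= b2)%N.
  move=> W; case: (leqP b1 b2) => [|/ltnW] h; first exact: W.
  by apply: reach_sym => //; exact: W.
apply: reach_le (reach_line_up _ _ _ b12).
rewrite [leRHS](bigID (fun b : 'I_H => (b1 <= b <= b2)%N)) /=.
rewrite (eq_bigl (fun b : 'I_H => (b \in A) && (b1 <= b <= b2)%N)).
  by rewrite lerDl sumr_ge0.
move=> b; case hb: (b1 <= b <= b2)%N; last by rewrite andbF.
by rewrite (hA _ _ _ h1 h2 hb).
Qed.

(** Double counting: exchanging [b] with the coordinate [u i] is an involution on pairs, after which
    the second component is free in [B' i]. *)
Lemma sum_upd (B B' : 'I_d -> {set 'I_H}) i (c : {ffun 'I_d -> 'I_H} -> R) :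
  (forall j, j != i -> B j = B' j) ->
  \sum_(u in box B') \sum_(b in B i) c (upd u i b) = #|B' i|%:R * \sum_(u in box B) c u.
Proof.
move=> BB'; rewrite pair_big_dep /=.
pose h (p : {ffun 'I_d -> 'I_H} * 'I_H) := (upd p.1 i p.2, p.1 i).
have hK : involutive h by move=> [u b]; rewrite /h /= upd_upd upd_id upd_at.
rewrite (reindex_inj (inv_inj hK)) /=.
rewrite (eq_big (fun p => (p.1 \in box B) && (p.2 \in B' i)) (fun p => c p.1)); last 2 first.
- move=> [u b] /=; rewrite !inE; apply/andP/andP => -[/forallP h1 h2]; split.
  + apply/forallP => j; case: (eqVneq j i) => [->//|ji].
    by have := h1 j; rewrite ffunE (negPf ji) BB'.
  + by have := h1 i; rewrite upd_at.
  + apply/forallP => j; rewrite ffunE; case: (eqVneq j i) => [->//|ji].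
    by rewrite -BB'.
  + by have := h1 i.
- by move=> [u b] _; rewrite /= upd_upd upd_id.
rewrite -(pair_big (fun u => u \in box B) (fun b => b \in B' i) (fun u _ => c u)) /=.
by rewrite mulr_sumr; apply: eq_bigr => u _; rewrite sumr_const mulr_natl.
Qed.

Lemma exists_le_avg (I : finType) (A : {set I}) (c : I -> R) : (0 < #|A|)%N ->
  exists2 k, k \in A & c k <= #|A|%:R^-1 * \sum_(k in A) c k.
Proof.
move=> A0; apply: contrapT => h.
have {}h k : k \in A -> #|A|%:R^-1 * \sum_(k in A) c k < c k.
  by move=> kA; rewrite ltNge; apply/negP => hk; apply: h; exists k.
have : \sum_(k in A) (#|A|%:R^-1 * \sum_(k in A) c k) < \sum_(k in A) c k.
  apply: ltr_sum => //; case/card_gt0P: A0 => k kA.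
  by apply/hasP; exists k; rewrite ?mem_index_enum.
by rewrite sumr_const -[ltLHS]mulr_natl mulrA mulfV ?mul1r ?ltxx // pnatr_eq0 -lt0n.
Qed.

Definition avg (B : 'I_d -> {set 'I_H}) (c : {ffun 'I_d -> 'I_H} -> R) :=
  (\sum_(g in box B) c g) / #|box B|%:R.

(* Enlarging the box in one direction: the new cost of [u] is the average, over the old box, of the
   costs of the points on its line in direction [i], plus the cost of that whole line. *)
Lemma smooth a x (B B' : 'I_d -> {set 'I_H}) i c :
  (forall j, j != i -> B j = B' j) -> B i \subset B' i ->
  (forall j, 0 < #|B j|)%N ->
  (forall b b1 b2, b1 \in B' i -> b2 \in B' i -> (b1 <= b <= b2)%N -> b \in B' i) ->
  (forall u, u \in box B -> reach zeta x (gridpt a u) (c u)) ->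
  exists c', (forall u, u \in box B' -> reach zeta x (gridpt a u) (c' u)) /\
    avg B' c' = avg B c + #|B' i|%:R * avg B' (zeta \o gridpt a).
Proof.
move=> BB' sBB' B0 conv hc.
have B'0 j : (0 < #|B' j|)%N.
  by case: (eqVneq j i) => [->|ji]; [exact: leq_trans (subset_leq_card sBB') | rewrite -BB'].
exists (fun u => #|B i|%:R^-1 * \sum_(b in B i) c (upd u i b) +
   \sum_(b in B' i) zeta (gridpt a (upd u i b))); split.
  move=> u uB'; have [b bB hb] := exists_le_avg (fun b => c (upd u i b)) (B0 i).
  have uB : upd u i b \in box B.
    rewrite inE; apply/forallP => j; rewrite ffunE; case: (eqVneq j i) => [->//|ji].
    by rewrite BB' //; move: uB'; rewrite inE => /forallP.
  apply: reach_trans => //; first exact: reach_le hb (hc _ uB).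
  have ui : u i \in B' i by move: uB'; rewrite inE => /forallP.
  have bB' : b \in B' i by apply: (fintype.subsetP sBB').
  have := @reach_line a u i b (u i) (B' i) bB' ui conv.
  by rewrite upd_id.
rewrite /avg big_split /= -mulr_sumr (sum_upd c BB').
rewrite (@sum_upd B' B' i (zeta \o gridpt a)) //.
have -> : (#|box B'|%:R : R) = #|box B|%:R * #|B' i|%:R / #|B i|%:R.
  rewrite !card_box (bigD1 i) //= [in RHS](bigD1 i) //= !natrM.
  rewrite (eq_bigr (fun j => #|B j|)); last by move=> j ji; rewrite BB'.
  field; by rewrite pnatr_eq0 -lt0n B0.
have : (#|box B|%:R != 0 :> R) by rewrite card_box pnatr_eq0 -lt0n prodn_gt0.
have : (#|B i|%:R != 0 :> R) by rewrite pnatr_eq0 -lt0n.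
have : (#|B' i|%:R != 0 :> R) by rewrite pnatr_eq0 -lt0n.
move=> n1 n2 n3; field.
by rewrite n1 n2 n3.
Qed.

End Grid.

(** * Chaining through dyadic scales *)

Section Dyadic.
Context (d J : nat) (R : realType) (zeta : 'rV[int]_d -> R).
Hypothesis zeta_ge0 : forall x, 0 <= zeta x.
Local Notation G := {ffun 'I_d -> 'I_(2 ^ J)}.
Implicit Types (a : 'rV[int]_d) (g u : G) (b : 'I_(2 ^ J)).

Definition dyadic (j : nat) b : {set 'I_(2 ^ J)} := [set k : 'I_(2 ^ J) | (k %/ 2 ^ j == b %/ 2 ^ j)%N].

Lemma card_dyadic j b : (j <= J)%N -> #|dyadic j b| = (2 ^ j)%N.
Proof.
move=> jJ; have h (k : 'I_(2 ^ j)) : (b %/ 2 ^ j * 2 ^ j + k < 2 ^ J)%N.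
  have : (b %/ 2 ^ j < 2 ^ (J - j))%N by rewrite ltn_divLR ?expn_gt0// -expnD subnK.
  move=> hb; have e : (2 ^ J = 2 ^ (J - j) * 2 ^ j)%N by rewrite -expnD subnK.
  apply: (@leq_trans ((b %/ 2 ^ j).+1 * 2 ^ j)%N); last by rewrite [leqRHS]e leq_mul2r hb orbT.
  by rewrite mulSn addnC ltn_add2r.
have inj : injective (fun k => Ordinal (h k)).
  by move=> k k' /(congr1 val) /= /addnI /val_inj.
rewrite -[RHS]card_ord -(card_imset predT inj); apply: eq_card => k.
rewrite inE; apply/eqP/imsetP => [hk|[k' _ ->]] /=; last first.
  by rewrite divnMDl ?expn_gt0 // (divn_small (ltn_ord k')) addn0.
have kj : (k %% 2 ^ j < 2 ^ j)%N by rewrite ltn_mod expn_gt0.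
by exists (Ordinal kj) => //; apply: val_inj; rewrite /= -hk -divn_eq.
Qed.

Lemma dyadic_convex j b (k k1 k2 : 'I_(2 ^ J)) :
  k1 \in dyadic j b -> k2 \in dyadic j b -> (k1 <= k <= k2)%N -> k \in dyadic j b.
Proof.
rewrite !inE => /eqP h1 /eqP h2 /andP[h3 h4]; rewrite eqn_leq.
by apply/andP; split; [rewrite -h2 | rewrite -h1]; exact: leq_div2r.
Qed.

Lemma dyadic_subset j b : dyadic j b \subset dyadic j.+1 b.
Proof.
by apply/fintype.subsetP => k; rewrite !inE expnSr !divnMA => /eqP ->.
Qed.

(** Doubling the block around [g] takes d applications of [smooth], one per coordinate. Each adds
    the line length 2^(j+1) times an average of [zeta] over a box with sides at least 2^j, which
    [E j] controls. *)
Lemma dyadic_chain a (E : nat -> R) :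
  (forall j (B : 'I_d -> {set 'I_(2 ^ J)}), (j <= J)%N -> (forall i, 2 ^ j <= #|B i|)%N ->
     avg B (zeta \o gridpt a) <= E j) ->
  forall g j, (j <= J)%N -> exists c : G -> R,
    (forall u, u \in box (fun i => dyadic j (g i)) -> reach zeta (gridpt a g) (gridpt a u) (c u)) /\
    avg (fun i => dyadic j (g i)) c <= E 0%N + \sum_(k < j) d%:R * (2 ^ k.+1)%:R * E k.
Proof.
move=> hE g; elim=> [_|j IH jJ].
  exists (fun u => zeta (gridpt a g)).
  have D0 u : u \in box (fun i => dyadic 0 (g i)) -> u = g.
    rewrite inE => /forallP hu; apply/ffunP => i; apply: val_inj.
    by have := hu i; rewrite inE !expn0 !divn1 => /eqP.
  split; first by move=> u /D0 ->; exact: reach_refl.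
  rewrite big_ord0 addr0; apply: le_trans (hE 0%N (fun i => dyadic 0 (g i)) _ _) => //; last first.
    by move=> i; rewrite card_dyadic.
  by rewrite /avg (eq_bigr (zeta \o gridpt a)) // => u /D0 -> //.
have [c [hc avgc]] := IH (ltnW jJ).
(* Hybrid boxes: the first [k] coordinates are already doubled. *)
pose B k (i : 'I_d) := if (i < k)%N then dyadic j.+1 (g i) else dyadic j (g i).
suff H k : (k <= d)%N -> exists c : G -> R,
    (forall u, u \in box (B k) -> reach zeta (gridpt a g) (gridpt a u) (c u)) /\
    avg (B k) c <= E 0%N + \sum_(k < j) d%:R * (2 ^ k.+1)%:R * E k + k%:R * (2 ^ j.+1)%:R * E j.
  have [c' [hc' avgc']] := H d (leqnn d).
  have BE : B d = fun i => dyadic j.+1 (g i) by apply/funext => i; rewrite /B ltn_ord.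
  by exists c'; rewrite -BE; split => //; rewrite big_ord_recr /= addrA.
elim: k => [_|k IHk kd].
  by exists c; have -> : B 0%N = fun i => dyadic j (g i) by []; split => //; rewrite !mul0r addr0.
have [c1 [hc1 avgc1]] := IHk (ltnW kd).
pose i0 := Ordinal kd.
have Bcard k' i : (2 ^ j <= #|B k' i|)%N.
  by rewrite /B; case: ifP => _; rewrite card_dyadic // ?(ltnW jJ) // leq_exp2l.
have [|||||c2 [hc2 avgc2]] := @smooth d _ R zeta zeta_ge0 a (gridpt a g) (B k) (B k.+1) i0 c1.
- move=> i ii0; rewrite /B ltnS [in RHS]leq_eqVlt.
  suff /negPf -> : (i != k :> nat) by [].
  by apply: contra ii0 => /eqP ik; apply/eqP/val_inj.
- by rewrite /B /= ltnn ltnS leqnn dyadic_subset.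
- by move=> i; apply: leq_trans (Bcard k i); rewrite expn_gt0.
- by rewrite /B /= ltnS leqnn => b b1 b2; exact: dyadic_convex.
- exact: hc1.
exists c2; split => //; rewrite avgc2 -(natr1 k) mulrDl mulrDl addrA mul1r.
apply: lerD => //; rewrite {1}/B /= ltnS leqnn card_dyadic //.
by apply: ler_wpM2l => //; apply: hE => //; exact: ltnW.
Qed.

(** At the top scale both chains spread over the whole cube, so some site [u] is at most average for
    the sum of the two costs. The two paths meet there, whence the factor 2. *)
Lemma dyadic_connect a (E : nat -> R) :
  (forall j (B : 'I_d -> {set 'I_(2 ^ J)}), (j <= J)%N -> (forall i, 2 ^ j <= #|B i|)%N ->
     avg B (zeta \o gridpt a) <= E j) ->
  forall g g', reach zeta (gridpt a g) (gridpt a g')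
    (2 * (E 0%N + \sum_(k < J) d%:R * (2 ^ k.+1)%:R * E k)).
Proof.
move=> hE g g'; set M := E 0%N + _.
have DJ b : dyadic J b = [set: 'I_(2 ^ J)]%SET.
  by apply/setP => k; rewrite !inE !divn_small.
have [c [hc]] := dyadic_chain hE g (leqnn J).
have [c' [hc']] := dyadic_chain hE g' (leqnn J).
have inbox g0 u : u \in box (fun i => dyadic J (g0 i)).
  by rewrite inE; apply/forallP => i; rewrite DJ inE.
have G0 : (0 < #|[set: G]%SET|)%N by apply/card_gt0P; exists g; rewrite inE.
have avgE g0 c0 : avg (fun i => dyadic J (g0 i)) c0 = #|[set: G]%SET|%:R^-1 * \sum_(u in [set: G]%SET) c0 u.
  rewrite /avg mulrC; congr (_%:R^-1 * _).
    by apply: eq_card => u; rewrite inbox inE.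
  by apply: eq_bigl => u; rewrite inbox inE.
rewrite !avgE => h' h.
have [u _ hu] := exists_le_avg (fun u => c u + c' u) G0.
apply: reach_le (reach_trans zeta_ge0 (hc u (inbox _ _)) (reach_sym (hc' u (inbox _ _)))).
by apply: le_trans hu _; rewrite big_split /= mulrDr mulr_natl mulr2n lerD.
Qed.

End Dyadic.

(** * Lattice cubes and the discrete Morrey estimate *)

Lemma int_rowP (d : nat) (x y : 'rV[int]_d) :
  (forall i, x ord0 i = y ord0 i :> int) <-> x = y.
Proof. by split => [h|->//]; apply/rowP. Qed.

Lemma min_dist_lt (u v : int) (n : nat) :
  `|u - v| < n%:Z -> (absz (u - Num.min u v)%R < n)%N.
Proof. by rewrite /Num.min; case: ifP => _; lia. Qed.

Lemma min_dist_add (u v : int) : Num.min u v + (absz (u - Num.min u v)%R)%:Z = u.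
Proof.
by have h : 0 <= u - Num.min u v :> int; [rewrite subr_ge0 ge_min lexx | rewrite gez0_abs // subrKC].
Qed.

Lemma min_range (u v : int) (m n : nat) : `|u| <= n%:Z -> `|v| <= n%:Z -> (m <= n)%N ->
  - (2 * n)%N%:Z <= Num.min u v /\ Num.min u v + m%:Z <= (2 * n)%N%:Z + 1.
Proof. by rewrite /Num.min; case: ifP => _; lia. Qed.

Lemma scale_index (i h k : nat) : (k < i - h)%N ->
  (i - k = h + (i - h - k))%N /\ (i = k + (h + (i - h - k)))%N.
Proof. by lia. Qed.

(** The cube is the sup-norm ball of radius [r] about the origin, hence the side [r.*2.+1]. *)
Definition cube_sum (d : nat) (R : realType) (r : nat) (psi : 'rV[int]_d -> R) : R :=
  \sum_(g : {ffun 'I_d -> 'I_(r.*2.+1)}) psi (gridpt (const_mx (- r%:Z)) g).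

Lemma ler_sum_inj (R : realType) (I J : finType) (f : I -> J) (F : J -> R) :
  injective f -> (forall j, 0 <= F j) -> \sum_i F (f i) <= \sum_j F j.
Proof.
move=> inj F0; rewrite -(big_imset F (in2W inj)) /=.
by rewrite [leRHS](bigID (fun j => j \in [set f x | x in predT]%SET)) /= lerDl sumr_ge0.
Qed.

Lemma sum_grid_le_cube (d H r : nat) (R : realType) (psi : 'rV[int]_d -> R) (a : 'rV[int]_d) :
  (forall x, 0 <= psi x) ->
  (forall i, - r%:Z <= a ord0 i /\ a ord0 i + H%:Z <= r%:Z + 1) ->
  \sum_(g : {ffun 'I_d -> 'I_H}) psi (gridpt a g) <= cube_sum r psi.
Proof.
move=> psi0 ha; rewrite /cube_sum.
have hlt i (b : 'I_H) : (absz (a ord0 i + b%:Z + r%:Z)%R < r.*2.+1)%N.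
  by have := ltn_ord b; have := ha i; lia.
pose f (g : {ffun 'I_d -> 'I_H}) : {ffun 'I_d -> 'I_(r.*2.+1)} :=
  [ffun i => Ordinal (hlt i (g i))].
have fE g : gridpt (const_mx (- r%:Z)) (f g) = gridpt a g.
  by apply/int_rowP => i; rewrite !mxE ffunE /=; have := ha i; lia.
have inj : injective f.
  move=> g g' e; have := fE g; rewrite e fE => /int_rowP e'; apply/ffunP => i; apply: val_inj.
  by have := e' i; rewrite !mxE /=; lia.
apply: le_trans (ler_sum_inj inj (F := fun u => psi (gridpt (const_mx (- r%:Z)) u)) _) => //.
by rewrite le_eqVlt; apply/orP; left; apply/eqP/eq_bigr => g _; rewrite fE.
Qed.

(* Splitting at the threshold [t] replaces Hoelder's inequality. *)
Lemma le_threshold (R : realType) (q t z : R) : 1 <= q -> 0 < t -> 0 <= z ->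
  z <= t + t / t `^ q * z `^ q.
Proof.
move=> q1 t0 z0; case: (leP z t) => zt.
  by apply: le_trans zt _; rewrite lerDl mulr_ge0 ?divr_ge0 ?powR_ge0// ltW.
apply: (@le_trans _ _ (t / t `^ q * z `^ q)); last by rewrite lerDr ltW.
have tq : t `^ q = t * t `^ (q - 1) by rewrite mulr_powRB1 // ?(ltW t0) //; lra.
have zq : z `^ q = z * z `^ (q - 1) by rewrite mulr_powRB1 //; lra.
have p0 : 0 < t `^ (q - 1) by rewrite powR_gt0.
have -> : t / t `^ q * z `^ q = z * (z `^ (q - 1) / t `^ (q - 1)).
  by rewrite tq zq; field; rewrite !gt_eqF.
rewrite ler_peMr // ler_pdivlMr // mul1r.
by apply: ge0_ler_powR; rewrite ?nnegrE ?(ltW t0) ?(ltW zt) //; lra.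
Qed.

Lemma geometric_tail (R : realType) (rho : R) (J : nat) : 0 < rho -> rho < 1 ->
  \sum_(k < J) rho ^+ (J - k) <= 1 / (1 - rho).
Proof.
move=> r0 r1; have n0 : 0 < 1 - rho by lra.
elim: J => [|J IH]; first by rewrite big_ord0 divr_ge0 // ltW.
rewrite big_ord_recr /= subSnn expr1.
rewrite (eq_bigr (fun k : 'I_J => rho * rho ^+ (J - k))); last first.
  by move=> k _; rewrite subSn ?exprS // ltnW.
rewrite -mulr_sumr; apply: (@le_trans _ _ (rho * (1 / (1 - rho)) + rho)).
  by rewrite lerD2r ler_pM2l.
rewrite -subr_ge0; have -> : 1 / (1 - rho) - (rho * (1 / (1 - rho)) + rho) = 1 - rho.
  by field; rewrite gt_eqF.
exact: ltW.
Qed.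

Lemma exists_small_exp (R : realType) (rho eps K : R) : 0 < rho -> rho < 1 -> 0 < eps ->
  0 <= K -> exists h : nat, K * rho ^+ h <= eps.
Proof.
move=> r0 r1 e0 K0.
have : (geometric K rho) @ \oo --> 0 by apply: cvg_geometric; rewrite gtr0_norm.
move=> /cvgrPdist_le /(_ _ e0) [h _ /(_ h)]; rewrite /= leqnn => /(_ isT).
by rewrite sub0r normrN /geometric /= ger0_norm ?mulr_ge0 ?exprn_ge0 // ?(ltW r0) // => ?; exists h.
Qed.

(* A discrete Morrey estimate: since q > d, the cost of a path accumulated over the dyadic
   scales from 1 up to 2^(i-h) is at most 2^i times a geometric tail in h. *)
Lemma morrey (d : nat) (R : realType) (q C eps : R) :
  d%:R < q -> 1 <= q -> 0 <= C -> 0 < eps ->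
  exists h : nat, forall zeta : 'rV[int]_d -> R, (forall x, 0 <= zeta x) ->
    (forall i, cube_sum (2 ^ i.+1) (fun x => zeta x `^ q) <= C * (2 ^+ d) ^+ i) ->
    forall i, (h <= i)%N -> forall x y : 'rV[int]_d,
      (forall k, `|x ord0 k| <= 2 ^+ i) -> (forall k, `|y ord0 k| <= 2 ^+ i) ->
      (forall k, `|x ord0 k - y ord0 k| < 2 ^+ (i - h)) ->
      reach zeta x y (eps * 2 ^+ i).
Proof.
move=> dq q1 C0 eps0; have q0 : 0 < q by lra.
(* Averages of [zeta] grow by a factor [r] per scale going down, while line lengths halve. The
   products decay geometrically with ratio [rho] because [r] < 2, which is where d < q enters. *)
pose r : R := 2 `^ (d%:R / q); have r0 : 0 < r by rewrite powR_gt0.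
have rq : r `^ q = 2 ^+ d by rewrite -powRrM divfK ?gt_eqF // powR_mulrn.
have r2 : r < 2.
  rewrite -[ltRHS](powRr1 (ler0n _ 2)) /r /powR pnatr_eq0 /= ltr_expR ltr_pM2r ?ln_gt0 ?ltr1n //.
  by rewrite ltr_pdivrMr ?mul1r.
pose rho := r / 2; have rho0 : 0 < rho by rewrite divr_gt0.
have rho1 : rho < 1 by rewrite /rho ltr_pdivrMr // mul1r.
pose K : R := 2 * (1 + C) * (1 + 2 * d%:R * (1 / (1 - rho))).
have rr : 0 <= 1 / (1 - rho) by rewrite divr_ge0 //; lra.
have dr0 : 0 <= 2 * d%:R * (1 / (1 - rho)) by apply: mulr_ge0 => //; apply: mulr_ge0.
have K0 : 0 <= K by rewrite /K; apply: mulr_ge0; [apply: mulr_ge0|]; lra.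
have [h hh] := exists_small_exp rho0 rho1 eps0 K0.
exists h => zeta zeta0 hS i hi x y hx hy hxy.
(* With the coordinatewise minimum as corner, a cube of side 2^J contains both points and stays
   within radius 2^(i+1). *)
pose J := (i - h)%N; pose a : 'rV[int]_d := \row_k Num.min (x ord0 k) (y ord0 k).
have h2 : (2 : int) ^+ i = (2 ^ i)%N%:Z by rewrite -[RHS]natz natrX.
have h2J : (2 : int) ^+ (i - h) = (2 ^ J)%N%:Z by rewrite -[RHS]natz natrX.
have Ji : (2 ^ J <= 2 ^ i)%N by rewrite leq_exp2l // leq_subr.
have xlt k : (absz (x ord0 k - a ord0 k)%R < 2 ^ J)%N.
  by have := hxy k; rewrite h2J mxE; exact: min_dist_lt.
have ylt k : (absz (y ord0 k - a ord0 k)%R < 2 ^ J)%N.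
  by have := hxy k; rewrite h2J mxE minC distrC; exact: min_dist_lt.
have xE : x = gridpt a [ffun k => Ordinal (xlt k)].
  by apply/int_rowP => k; rewrite !mxE ffunE /= !mxE min_dist_add.
have yE : y = gridpt a [ffun k => Ordinal (ylt k)].
  by apply/int_rowP => k; rewrite !mxE ffunE /= !mxE minC min_dist_add.
(* The threshold is [t] = r^(i-j), whose q-th power is 2^(d(i-j)), the price of comparing a box of
   volume at least 2^(dj) with a total of order 2^(di). The 1 in the constant is the part below [t],
   and [C] the part above. *)
pose E j := (1 + C) * r ^+ (i - j).
have hE j (B : 'I_d -> {set 'I_(2 ^ J)}) : (j <= J)%N -> (forall i, 2 ^ j <= #|B i|)%N ->
    avg B (zeta \o gridpt a) <= E j.
  move=> jJ hB; set t := r ^+ (i - j).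
  have t0 : 0 < t by rewrite exprn_gt0.
  have ji : (j <= i)%N by rewrite (leq_trans jJ) // leq_subr.
  have tq : t `^ q = (2 ^+ d) ^+ (i - j).
    by rewrite /t -powR_mulrn ?(ltW r0) // -powRrM mulrC powRrM rq powR_mulrn ?exprn_ge0.
  have cB : (2 ^+ d) ^+ j <= #|box B|%:R :> R.
    rewrite card_box -[leLHS]exprM mulnC exprM -[_ ^+ d]/(GRing.exp _ d) -natrX -natrX ler_nat.
    have -> : ((2 ^ j) ^ d = \prod_(i < d) 2 ^ j)%N by rewrite prod_nat_const card_ord.
    exact: leq_prod.
  have cB0 : 0 < #|box B|%:R :> R by apply: lt_le_trans cB; rewrite !exprn_gt0.
  have SC : \sum_(g in box B) zeta (gridpt a g) `^ q <= C * (2 ^+ d) ^+ i.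
    apply: le_trans (hS i).
    apply: le_trans (@sum_grid_le_cube d (2 ^ J) _ R (fun x => zeta x `^ q) a _ _); last 2 first.
    - by move=> ?; rewrite powR_ge0.
    - move=> k; have := hx k; have := hy k; rewrite h2 mxE expnS => ? ?; exact: min_range.
    by rewrite [leRHS](bigID (fun g => g \in box B)) /= lerDl sumr_ge0 // => g _; rewrite powR_ge0.
  rewrite /avg ler_pdivrMr //.
  apply: (@le_trans _ _ (\sum_(g in box B) (t + t / t `^ q * zeta (gridpt a g) `^ q))).
    by apply: ler_sum => g _ /=; exact: le_threshold.
  rewrite big_split /= sumr_const -mulr_sumr /E -/t tq.
  have -> : (1 + C) * t * #|box B|%:R = t * #|box B|%:R + t * (C * #|box B|%:R) by ring.
  rewrite mulr_natr lerD2l -mulrA ler_pM2l //.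
  rewrite ler_pdivrMl ?exprn_gt0 //; apply: le_trans SC _.
  by rewrite -{1}(subnK ji) exprD mulrCA ler_wpM2l ?exprn_ge0 // ler_wpM2l.
rewrite xE yE; apply: reach_le (dyadic_connect zeta0 hE _ _).
have rE m : r ^+ m = 2 ^+ m * rho ^+ m by rewrite -exprMn /rho mulrC divfK.
have C1 : 0 <= 1 + C by lra.
apply: (@le_trans _ _ (2 ^+ i * (K * rho ^+ h))); last first.
  by rewrite mulrC ler_wpM2r ?exprn_ge0.
have E0 : E 0%N <= (1 + C) * (2 ^+ i * rho ^+ h).
  rewrite /E subn0 rE ler_wpM2l // ler_wpM2l ?exprn_ge0 //.
  by apply: ler_wiXn2l => //; rewrite ltW.
(* Here 2^k r^(i-k) = 2^i rho^(i-k), and i - k = h + (J - k) splits off the small factor rho^h. *)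
have -> : \sum_(k < J) d%:R * (2 ^ k.+1)%:R * E k =
    2 * d%:R * (1 + C) * (2 ^+ i * rho ^+ h) * \sum_(k < J) rho ^+ (J - k).
  rewrite mulr_sumr; apply: eq_bigr => k _; rewrite /E rE natrX exprS.
  have -> : (i - k = h + (J - k))%N by exact: (scale_index (ltn_ord k)).1.
  have -> : (2 : R) ^+ i = 2 ^+ k * 2 ^+ (h + (J - k)).
    by rewrite -exprD; congr (_ ^+ _); exact: (scale_index (ltn_ord k)).2.
  by rewrite (exprD rho); ring.
have := geometric_tail J rho0 rho1; set S := \sum_(k < J) _ => hS'.
set X := 2 ^+ i * rho ^+ h; have X0 : 0 <= X by rewrite mulr_ge0 ?exprn_ge0 // ltW.
have : 2 * d%:R * (1 + C) * X * S <= 2 * d%:R * (1 + C) * X * (1 / (1 - rho)).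
  by rewrite ler_wpM2l //; do 3?[apply: mulr_ge0 => //].
have -> : 2 ^+ i * (K * rho ^+ h) = 2 * ((1 + C) * X + 2 * d%:R * (1 + C) * X * (1 / (1 - rho))).
  by rewrite /X /K; ring.
move: E0; rewrite -/X; lra.
Qed.

(** * Maximal inequalities *)

Section Vitali.
Context (d H : nat) (R : realType).
Local Notation G := {ffun 'I_d -> 'I_H}.
Implicit Types (x y : G) (S : {set G}).

Definition cube x (r : nat) : {set G} :=
  [set y : G | [forall i, (x i <= y i + r)%N && (y i <= x i + r)%N]]%SET.

Lemma cubeP x r y : reflect (forall i, (x i <= y i + r)%N /\ (y i <= x i + r)%N) (y \in cube x r).
Proof. by rewrite inE; apply: (iffP forallP) => h i; apply/andP/h. Qed.

Lemma card_cube_le x r : (#|cube x r| <= (r.*2.+1) ^ d)%N.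
Proof.
pose B i : {set 'I_H} := [set b : 'I_H | (x i <= b + r)%N && (b <= x i + r)%N]%SET.
have -> : #|cube x r| = #|box B|.
  apply: eq_card => y; rewrite !inE; apply: eq_forallb => i.
  by rewrite !inE.
rewrite card_box; have -> : ((r.*2.+1) ^ d = \prod_(i < d) r.*2.+1)%N.
  by rewrite prod_nat_const card_ord.
apply: leq_prod => i _.
pose f (b : 'I_H) : 'I_(r.*2.+1) := inord (b + r - x i).
rewrite -[leqRHS]card_ord; apply: (@leq_trans #|[set f b | b in B i]%SET|); last exact: max_card.
rewrite card_in_imset // => b b'; rewrite !inE => /andP[h1 h2] /andP[h3 h4] /(congr1 val).
rewrite /= !inordK; try lia.
by move=> e; apply: val_inj => /=; lia.
Qed.

(** Greedy selection: take a centre of largest radius r and discard the centres within distance 2r.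
    The remaining cubes have radius at most r and miss the selected one, so the sums over [W] add
    up. The constant 2^d comes from 4r + 1 <= 2 (2r + 1). *)
Lemma vitali S (rad : G -> nat) (W : G -> R) (t : R) : 0 <= t -> (forall y, 0 <= W y) ->
  (forall x, x \in S -> t * ((rad x).*2.+1 ^ d)%:R <= \sum_(y in cube x (rad x)) W y) ->
  t * #|S|%:R <= (2 ^ d)%:R * \sum_(y | [exists x in S, y \in cube x (rad x)]) W y.
Proof.
move=> t0 W0; have [n] := ubnP #|S|; elim: n S => // n IH S; rewrite ltnS => Sn hS.
have [->|[x0 x0S]] := set_0Vmem S; first by rewrite cards0 mulr0 mulr_ge0 ?sumr_ge0.
case: (arg_maxnP rad x0S) => x xS xmax.
set r := rad x in xmax; pose S' := (S :\: cube x r.*2)%SET.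
have xball m : x \in cube x m by apply/cubeP => i; rewrite !leq_addr.
have S'S : S' \subset S by exact: subsetDl.
have IHS' : t * #|S'|%:R <= (2 ^ d)%:R * \sum_(y | [exists x in S', y \in cube x (rad x)]) W y.
  apply: IH; last by move=> y yS'; apply: hS; exact: (fintype.subsetP S'S).
  apply: leq_trans Sn; apply: proper_card; apply/properP; split => //.
  by exists x => //; rewrite finset.in_setD xball.
have cS : (#|S| <= #|S'| + r.*2.*2.+1 ^ d)%N.
  rewrite -(cardsID (cube x r.*2) S) addnC leq_add2l.
  apply: leq_trans (card_cube_le x r.*2).
  by apply: subset_leq_card; exact: finset.subsetIr.
have cS2 : (r.*2.*2.+1 ^ d <= 2 ^ d * r.*2.+1 ^ d)%N.
  by rewrite -expnMn; case: (d) => [//|d']; rewrite leq_exp2r //; lia.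
apply: (@le_trans _ _ (t * #|S'|%:R + (2 ^ d)%:R * (t * (r.*2.+1 ^ d)%:R))).
  rewrite [X in _ <= _ + X]mulrCA -mulrDr ler_wpM2l // -natrM -natrD ler_nat.
  by apply: leq_trans cS _; rewrite leq_add2l.
apply: (@le_trans _ _ ((2 ^ d)%:R * (\sum_(y | [exists x in S', y \in cube x (rad x)]) W y +
    \sum_(y in cube x r) W y))).
  rewrite mulrDr lerD // ler_wpM2l //; exact: hS.
rewrite ler_wpM2l // [leRHS](bigID (fun y => y \in cube x r)) /= addrC; apply: lerD; last first.
  rewrite le_eqVlt; apply/orP; left; apply/eqP/eq_bigl => y.
  case hy: (y \in cube x r); last by rewrite andbF.
  by rewrite andbT; apply/esym/existsP; exists x; apply/andP.
rewrite [leRHS](bigID (fun y => [exists x in S', y \in cube x (rad x)])) /=.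
rewrite [X in _ <= X + _](eq_bigl (fun y => [exists x in S', y \in cube x (rad x)])).
  by rewrite lerDl sumr_ge0.
move=> y; case hy: [exists x in S', y \in cube x (rad x)]; last by rewrite andbF.
rewrite andbT; move/existsP: hy => [x' /andP[x'S' yx']].
apply/andP; split.
  by apply/existsP; exists x'; rewrite yx' andbT; apply: (fintype.subsetP S'S).
move: x'S'; rewrite /S' finset.in_setD => /andP[+ x'S].
apply: contra => /cubeP yx; apply/cubeP => i.
move/cubeP: yx' => /(_ i); have := yx i; have := xmax _ x'S; rewrite -/r; lia.
Qed.

End Vitali.

(** * Expectations and measurability of events *)

Section Expectation.
Context (dsp : measure_display) (Omega : measurableType dsp) (R : realType)
  (P : probability Omega R).
Implicit Types (f g : Omega -> R) (A B : set Omega).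

Definition L1 f := P.-integrable setT (EFin \o f).
Definition Ex f : R := \int[P]_w f w.

Lemma L1_measurable f : L1 f -> measurable_fun setT f.
Proof. by move=> /measurable_int /measurable_EFinP. Qed.

Lemma L1_cst c : L1 (cst c).
Proof. exact: finite_measure_integrable_cst. Qed.

Lemma L1_dom g f : measurable_fun setT f -> (forall w, `|f w| <= g w) -> L1 g -> L1 f.
Proof.
move=> mf fg; apply: le_integrable => //; first exact/measurable_EFinP.
by move=> w _ /=; rewrite lee_fin; apply: le_trans (fg w) (ler_norm _).
Qed.

Lemma L1D f g : L1 f -> L1 g -> L1 (fun w => f w + g w).
Proof. by move=> hf hg; have := integrableD measurableT hf hg. Qed.

Lemma L1B f g : L1 f -> L1 g -> L1 (fun w => f w - g w).
Proof. by move=> hf hg; have := integrableB measurableT hf hg. Qed.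

Lemma L1Z c f : L1 f -> L1 (fun w => c * f w).
Proof. by move=> hf; have := integrableZl measurableT c hf. Qed.

Lemma L1_norm f : L1 f -> L1 (fun w => `|f w|).
Proof. by move=> hf; have := integrable_norm hf. Qed.

Lemma L1_indic A : measurable A -> L1 (\1_A).
Proof. by move=> mA; exact: integrable_indic. Qed.

Lemma L1_sum (I : Type) (s : seq I) (F : I -> Omega -> R) :
  (forall i, L1 (F i)) -> L1 (fun w => \sum_(i <- s) F i w).
Proof.
move=> hF; elim: s => [|i s IH].
  by under eq_fun do rewrite big_nil; exact: L1_cst.
by under eq_fun do rewrite big_cons; exact: L1D.
Qed.

Lemma ExD f g : L1 f -> L1 g -> Ex (fun w => f w + g w) = Ex f + Ex g.
Proof. by move=> hf hg; rewrite /Ex RintegralD. Qed.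

Lemma ExB f g : L1 f -> L1 g -> Ex (fun w => f w - g w) = Ex f - Ex g.
Proof. by move=> hf hg; rewrite /Ex RintegralB. Qed.

Lemma ExZ c f : L1 f -> Ex (fun w => c * f w) = c * Ex f.
Proof. by move=> hf; rewrite /Ex RintegralZl. Qed.

Lemma Ex_cst c : Ex (cst c) = c.
Proof.
rewrite /Ex Rintegral_cst //; transitivity (c * fine 1%E); last exact: mulr1.
by congr (_ * fine _); exact: probability_setT.
Qed.

Lemma Ex_le f g : L1 f -> L1 g -> (forall w, f w <= g w) -> Ex f <= Ex g.
Proof. by move=> hf hg h; apply: le_Rintegral. Qed.

Lemma Ex_ge0 f : (forall w, 0 <= f w) -> 0 <= Ex f.
Proof. by move=> h; apply: Rintegral_ge0. Qed.

Lemma Ex_indic A : measurable A -> Ex (\1_A) = fine (P A).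
Proof. by move=> mA; rewrite /Ex /Rintegral integral_indic // setIT. Qed.

Lemma Ex_sum (I : Type) (s : seq I) (F : I -> Omega -> R) :
  (forall i, L1 (F i)) -> Ex (fun w => \sum_(i <- s) F i w) = \sum_(i <- s) Ex (F i).
Proof.
move=> hF; elim: s => [|i s IH].
  by under eq_fun do rewrite big_nil; rewrite big_nil Ex_cst.
under eq_fun do rewrite big_cons.
by rewrite ExD // ?IH ?big_cons //; exact: L1_sum.
Qed.

Lemma probE A : measurable A -> P A = (fine (P A))%:E.
Proof. by move=> mA; rewrite fineK // fin_num_measure. Qed.

Lemma prob_le A B : measurable A -> measurable B -> A `<=` B -> fine (P A) <= fine (P B).
Proof. by move=> mA mB AB; rewrite fine_le ?fin_num_measure // le_measure ?inE. Qed.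

Lemma measurable_le_set f g : measurable_fun setT f -> measurable_fun setT g ->
  measurable [set w | f w <= g w].
Proof.
move=> mf mg; have := measurable_fun_ler mf mg measurableT (Y := [set true]).
by rewrite setTI; apply.
Qed.

Lemma measurable_lt_set f g : measurable_fun setT f -> measurable_fun setT g ->
  measurable [set w | f w < g w].
Proof.
move=> mf mg; have := measurable_fun_ltr mf mg measurableT (Y := [set true]).
by rewrite setTI; apply.
Qed.

Lemma measurable_forall (Q : nat -> set Omega) : (forall n, measurable (Q n)) ->
  measurable [set w | forall n, Q n w].
Proof.
move=> mQ; rewrite (_ : mkset _ = \bigcap_n Q n); last by apply/seteqP; split => w /= h n; [move=> _; exact: h | exact: (h n Logic.I)].
exact: bigcapT_measurable.
Qed.

Lemma measurable_exists (Q : nat -> set Omega) : (forall n, measurable (Q n)) ->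
  measurable [set w | exists n, Q n w].
Proof.
move=> mQ; rewrite (_ : mkset _ = \bigcup_n Q n); last first.
  by apply/seteqP; split => w /= [n]; [exists n | exists n].
exact: bigcupT_measurable.
Qed.

Lemma measurable_impl (Q : Prop) A : measurable A -> measurable [set w | Q -> A w].
Proof.
move=> mA; have [q|q] := pselect Q.
  by rewrite (_ : mkset _ = A) //; apply/seteqP; split => w /=; [apply|].
by rewrite (_ : mkset _ = setT) //; apply/seteqP; split => w // _ /q.
Qed.

Lemma measurable_conj (Q : Prop) A : measurable A -> measurable [set w | Q /\ A w].
Proof.
move=> mA; have [q|q] := pselect Q.
  by rewrite (_ : mkset _ = A) //; apply/seteqP; split => [w []|w Aw] //; split.
by rewrite (_ : mkset _ = set0) //; apply/seteqP; split => [w [/q]|w []].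
Qed.

Lemma prob_eq0_le A : measurable A -> (forall e : R, 0 < e -> fine (P A) <= e) -> P A = 0%E.
Proof.
move=> mA h; rewrite probE //; congr EFin; apply/eqP; rewrite eq_le fine_ge0 // andbT.
by apply/ler_addgt0Pr => e e0; rewrite add0r; exact: h.
Qed.

Lemma ae_prob0 A : measurable A -> P (~` A) = 0%E -> {ae P, forall w, A w}.
Proof. by move=> mA h; exists (~` A); split => //; exact: measurableC. Qed.

(** Dominated convergence for functions that vanish from some random index on, the only form needed
    for truncations and indicators below. *)
Lemma Ex_eventually0 (f : nat -> Omega -> R) g (e : R) : 0 < e ->
  (forall n, measurable_fun setT (f n)) -> L1 g -> (forall n w, `|f n w| <= g w) ->
  {ae P, forall w, exists N, forall n, (N <= n)%N -> f n w = 0} ->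
  exists N, forall n, (N <= n)%N -> Ex (f n) <= e.
Proof.
move=> e0 mf Lg fg f0.
have [|||||_ _] := @dominated_convergence _ _ _ P setT measurableT
  (fun n => EFin \o f n) (cst 0%E) (EFin \o g).
- by move=> n; apply/measurable_EFinP.
- exact: measurable_cst.
- apply: filterS f0 => w [N hN] _.
  apply: cvg_near_cst; exists N => // n /= Nn; by rewrite hN.
- exact: Lg.
- by apply: aeW => w n _ /=; rewrite lee_fin.
rewrite integral0 => /fine_cvgP [_].
move=> /cvgrPdist_le /(_ _ e0) [N _ hN]; exists N => n Nn.
have := hN n Nn; rewrite /= sub0r normrN; apply: le_trans; exact: ler_norm.
Qed.

End Expectation.

(** * Measure-preserving maps, coboundaries and the ergodic maximal inequality *)

Section MeasurePreserving.
Context (dsp : measure_display) (Omega : measurableType dsp) (R : realType)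
  (P : probability Omega R).
Implicit Types (f g : Omega -> R) (A B : set Omega) (tau : Omega -> Omega).

Definition mpres tau :=
  measurable_fun setT tau /\ forall A, measurable A -> P (tau @^-1` A) = P A.

Lemma mpres_measurable tau f : mpres tau -> measurable_fun setT f ->
  measurable_fun setT (f \o tau).
Proof. by move=> [mtau _] mf; exact: measurableT_comp. Qed.

Lemma mpres_preimage tau A : mpres tau -> measurable A -> measurable (tau @^-1` A).
Proof. by move=> [mtau _] mA; rewrite -[_ @^-1` _]setTI; exact: mtau. Qed.

Lemma mpres_id : mpres id.
Proof. by split. Qed.

Lemma mpres_comp tau tau' : mpres tau -> mpres tau' -> mpres (tau \o tau').
Proof.
move=> h h'; split; first exact: measurableT_comp h.1 h'.1.
move=> A mA; rewrite comp_preimage h'.2 ?h.2 //.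
exact: mpres_preimage.
Qed.

Lemma mpres_iter tau n : mpres tau -> mpres (iter n tau).
Proof. by move=> h; elim: n => [|n IH]; [exact: mpres_id | exact: (mpres_comp h IH)]. Qed.

Lemma mpres_ge0_integral tau (F : Omega -> \bar R) : mpres tau -> measurable_fun setT F ->
  (forall w, 0 <= F w)%E -> (\int[P]_w F (tau w) = \int[P]_w F w)%E.
Proof.
move=> [mtau htau] mF F0; have := ge0_integral_pushforward mtau P measurableT mF (fun y _ => F0 y).
rewrite preimage_setT => <-; apply: eq_measure_integral => A mA _; exact: htau.
Qed.

Lemma L1_mpres tau f : mpres tau -> L1 P f -> L1 P (f \o tau).
Proof.
move=> h Lf; have mf := L1_measurable Lf.
apply/integrableP; split; first by apply/measurable_EFinP; exact: mpres_measurable.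
move/integrableP : Lf => [_]; rewrite -(mpres_ge0_integral h (F := fun w => `|(EFin \o f) w|%E)) //.
by apply: measurableT_comp => //; exact/measurable_EFinP.
Qed.

Lemma Ex_mpres tau f : mpres tau -> L1 P f -> Ex P (f \o tau) = Ex P f.
Proof.
move=> h Lf; congr fine; have mf := L1_measurable Lf; case: (h) => mtau htau.
have mEf : measurable_fun setT (EFin \o f) by exact/measurable_EFinP.
have := @integral_pushforward _ _ _ _ R tau mtau P setT (EFin \o f) mEf.
rewrite preimage_setT => /(_ (L1_mpres h Lf) measurableT) H.
transitivity (\int[P]_w ((EFin \o f) \o tau) w)%E => //; rewrite -H.
by apply: eq_measure_integral => A mA _; exact: htau.
Qed.

Lemma mpres_ae tau (Q : Omega -> Prop) : mpres tau ->
  {ae P, forall w, Q w} -> {ae P, forall w, Q (tau w)}.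
Proof.
move=> h [N [mN N0 QN]]; exists (tau @^-1` N); split.
- exact: mpres_preimage.
- by rewrite -N0; exact: h.2.
- by move=> w /= hw; apply: QN.
Qed.

(** Since [v] need not be integrable, it is truncated at level k. The truncated increments [D k]
    have mean zero, and the positive part of [phi - D k] is dominated by [phi] in absolute value and
    vanishes for large k. *)
Lemma Ex_coboundary_le0 tau (v phi : Omega -> R) : mpres tau ->
  measurable_fun setT v -> (forall w, 0 <= v w) -> L1 P phi ->
  (forall w, phi w <= v w - v (tau w)) -> Ex P phi <= 0.
Proof.
move=> h mv v0 Lphi hphi; have mphi := L1_measurable Lphi.
have mc (k : nat) : measurable_fun setT (fun w => Num.min (v w) k%:R).
  by apply: measurable_minr => //; exact: measurable_cst.
have Lc (k : nat) : L1 P (fun w => Num.min (v w) k%:R).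
  apply: (L1_dom (g := cst k%:R)) => //; last exact: L1_cst.
  by move=> w; rewrite ger0_norm; [rewrite ge_min lexx orbT | rewrite le_min v0 ler0n].
pose D k w := Num.min (v w) k%:R - Num.min (v (tau w)) k%:R.
have LD k : L1 P (D k) by apply: L1B => //; exact: (L1_mpres h (Lc k)).
have ED k : Ex P (D k) = 0.
  by rewrite ExB //; [rewrite (Ex_mpres h (Lc k)) subrr | exact: (L1_mpres h (Lc k))].
have LpD k : L1 P (fun w => phi w - D k w) by exact: L1B.
have Lmax k : L1 P (fun w => Num.max (phi w - D k w) 0).
  apply: L1_dom (L1_norm (LpD k)).
    by apply: measurable_maxr; [exact: L1_measurable | exact: measurable_cst].
  by move=> w; rewrite /Num.max; case: ifP => [|_]; rewrite ?normr0.
apply/ler_addgt0Pr => e e0; rewrite add0r.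
have [||||N /(_ N (leqnn N)) hN] := @Ex_eventually0 _ _ _ P
  (fun k w => Num.max (phi w - D k w) 0) (fun w => `|phi w|) e e0.
- by move=> k; exact: L1_measurable.
- exact: L1_norm.
(* If [v w] is at most k then [phi w - D k w] is nonpositive; otherwise [D k w] is nonnegative. *)
- move=> k w; rewrite ger0_norm ?le_max ?lexx ?orbT // ge_max normr_ge0 andbT.
  have h1 := hphi w; have h2 := ler_norm (phi w); have h3 := normr_ge0 (phi w).
  by rewrite /D; case: (leP (v w) k%:R) => h4; case: (leP (v (tau w)) k%:R) => h5; lra.
- apply: aeW => w; pose M := Num.max (v w) (v (tau w)).
  have M0 : 0 <= M by rewrite le_max v0.
  exists (Num.trunc M).+1 => n hn; apply/max_idPr; rewrite subr_le0.
  have Mn : M <= n%:R.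
    by apply: ltW; apply: lt_le_trans (truncnS_gt M) _; rewrite ler_nat.
  by rewrite /D !min_l // ?(le_trans _ Mn) // /M le_max lexx ?orbT.
apply: le_trans hN; rewrite -[leLHS]subr0 -[X in _ - X <= _](ED N) -ExB //.
by apply: Ex_le => // w; rewrite le_max lexx.
Qed.

Section Maximal.
Context (tau : Omega -> Omega) (phi : Omega -> R) (c : R).
Hypotheses (htau : mpres tau) (Lphi : L1 P phi) (phi0 : forall w, 0 <= phi w) (c0 : 0 < c).

Definition birkhoff_sum (k : nat) w : R := \sum_(i < k) phi (iter i tau w).

Lemma birkhoff_sumS k w : birkhoff_sum k.+1 w = phi w + birkhoff_sum k (tau w).
Proof.
rewrite /birkhoff_sum big_ord_recl /=; congr (_ + _); apply: eq_bigr => i _.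
by rewrite -iterS iterSr.
Qed.

Lemma L1_birkhoff_sum k : L1 P (birkhoff_sum k).
Proof. by apply: L1_sum => i; exact: (L1_mpres (mpres_iter i htau) Lphi). Qed.

(** Recursive form of the maximum over k <= N of [birkhoff_sum k w - c * k%:R]; the recursion is the
    identity on which Garsia's argument rests. *)
Fixpoint max_excess (N : nat) (w : Omega) : R :=
  if N is N'.+1 then Num.max 0 (phi w - c + max_excess N' (tau w)) else 0.

Lemma max_excess_ge0 N w : 0 <= max_excess N w.
Proof. by case: N => [|N] //=; rewrite le_max lexx. Qed.

Lemma max_excess_le N w : max_excess N w <= max_excess N.+1 w.
Proof.
elim: N w => [|N IH] w; first exact: max_excess_ge0.
rewrite [leLHS]/= [leRHS]/=.
by rewrite ge_max le_max lexx /= le_max; apply/orP; right; rewrite lerD2l IH.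
Qed.

Lemma L1_max_excess N : L1 P (max_excess N).
Proof.
elim: N => [|N IH]; first exact: L1_cst.
have L : L1 P (fun w => phi w - c + max_excess N (tau w)).
  by apply: L1D; [apply: L1B => //; exact: L1_cst | exact: (L1_mpres htau IH)].
apply: L1_dom (L1_norm L).
  have := measurable_maxr (measurable_cst (0 : R) (D := setT)) (L1_measurable L); exact.
by move=> w /=; case: (leP 0 (phi w - c + max_excess N (tau w))) => _; rewrite ?normr0 ?lexx ?normr_ge0.
Qed.

Lemma birkhoff_sum_le_max k N w : (k <= N)%N -> birkhoff_sum k w - c * k%:R <= max_excess N w.
Proof.
elim: N k w => [|N IH] [|k] w // hk; rewrite ?/birkhoff_sum ?big_ord0 ?mulr0 ?subrr ?max_excess_ge0 //.
rewrite -/(birkhoff_sum k.+1 w) birkhoff_sumS /= le_max; apply/orP; right.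
by have := IH k (tau w) hk; rewrite -natr1; lra.
Qed.

(** Garsia's argument: on the set where [max_excess N] is positive, its increment along [tau] is at
    most [phi - c]; elsewhere it is nonpositive, hence at most [phi]. The increment has mean zero,
    which bounds c P(A N) by the mean of [phi]; then N goes to infinity. *)
Lemma maximal_inequality :
  fine (P [set w | exists k, c * k%:R < birkhoff_sum k w]) <= Ex P phi / c.
Proof.
pose A N := [set w | 0 < max_excess N w].
have mA N : measurable (A N).
  by apply: measurable_lt_set; [exact: measurable_cst | exact: L1_measurable (L1_max_excess N)].
have PA N : fine (P (A N)) <= Ex P phi / c.
  rewrite ler_pdivlMr // mulrC -Ex_indic // -ExZ; last exact: L1_indic.
  have LI : L1 P (fun w => c * \1_(A N) w) by apply: L1Z; exact: L1_indic.
  rewrite -subr_ge0 -ExB //.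
  have <- : Ex P (fun w => max_excess N w - max_excess N (tau w)) = 0.
    rewrite ExB ?subrr //; try exact: L1_max_excess.
      by rewrite (Ex_mpres htau (L1_max_excess N)) subrr.
    exact: (L1_mpres htau (L1_max_excess N)).
  apply: Ex_le; first by apply: L1B; [|apply: (L1_mpres htau)]; exact: L1_max_excess.
    exact: L1B.
  move=> w; rewrite indicE; case: (ltP 0 (max_excess N w)) => h; last first.
    rewrite memNset; last by rewrite /A /= => /lt_geF; rewrite h.
    by rewrite /= mulr0 subr0; have := max_excess_ge0 N (tau w); have := phi0 w; lra.
  rewrite mem_set // mulr1; case: N h {LI} => [|N] h; first by rewrite /= ltxx in h.
  have e : max_excess N.+1 w = phi w - c + max_excess N (tau w).
    by move: h; rewrite /= lt_max ltxx /= => h; rewrite max_r // ltW.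
  by have := max_excess_le N (tau w); rewrite e; lra.
have mU : measurable (\bigcup_N A N) by exact: bigcupT_measurable.
have mE : measurable [set w | exists k, c * k%:R < birkhoff_sum k w].
  apply: measurable_exists => k; apply: measurable_lt_set; first exact: measurable_cst.
  exact: L1_measurable (L1_birkhoff_sum k).
apply: (@le_trans _ _ (fine (P (\bigcup_N A N)))).
  apply: prob_le => // w /= [k hk]; exists k => //; rewrite /A /=.
  by apply: lt_le_trans (birkhoff_sum_le_max w (leqnn k)); rewrite subr_gt0.
have cvgA : P (A n) @[n --> \oo] --> P (\bigcup_N A N).
  apply: nondecreasing_cvg_mu => // n m nm; apply/subsetPset => w.
  rewrite /A /=; elim: m nm => [|m IH]; first by rewrite leqn0 => /eqP ->.
  rewrite leq_eqVlt => /orP[/eqP -> //|nm] h.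
  exact: lt_le_trans (IH nm h) (max_excess_le m w).
rewrite -lee_fin -probE // -(cvg_lim _ cvgA) //; apply: lime_le.
  by apply/cvg_ex; eexists; exact: cvgA.
by apply: nearW => n; rewrite probE // lee_fin.
Qed.

End Maximal.
End MeasurePreserving.

(** * Superadditive sequences *)

Section Greedy.
Context (R : realType) (alpha : nat -> nat -> R) (psi phi : nat -> R) (h : R) (N : nat).
Hypothesis alphaD : forall i k l, alpha i k + alpha (i + k)%N l <= alpha i (k + l)%N.
Hypothesis alpha0 : forall i, 0 <= alpha i 0%N.
Hypothesis alpha1 : forall i, h - psi i <= alpha i 1%N.
Hypothesis phi0 : forall i, 0 <= phi i.
(** Bad sites pay [psi] in full. At good sites the bound [psi i <= N%:R] allows a block cut off by
    the time horizon to be crossed by single steps. *)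
Hypothesis dichotomy : forall i, phi i = psi i \/
  psi i <= N%:R /\ exists n, (0 < n <= N)%N /\ h * n%:R <= alpha i n.

Let psi_le i : psi i <= N%:R + phi i.
Proof.
case: (dichotomy i) => [->|[hN _]]; first by rewrite lerDr.
by rewrite (le_trans hN) // lerDl.
Qed.

Let shift_sum (F : nat -> R) i K :
  \sum_(j < K.+1) F (i + j)%N = F i + \sum_(j < K) F (i.+1 + j)%N.
Proof.
by rewrite big_ord_recl addn0; congr (_ + _); apply: eq_bigr => j _; rewrite addSnnS.
Qed.

Let single_steps K i : h * K%:R - \sum_(j < K) psi (i + j)%N <= alpha i K.
Proof.
elim: K i => [|K IH] i; first by rewrite big_ord0 mulr0 subrr.
rewrite shift_sum; have := alphaD i 1 K; rewrite addn1 add1n.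
by have := alpha1 i; have := IH i.+1; rewrite -natr1; lra.
Qed.

Let ler_tail_sum m n i : \sum_(j < m) phi (i + n + j)%N <= \sum_(j < n + m) phi (i + j)%N.
Proof.
rewrite big_split_ord /=; under [X in _ <= _ + X]eq_bigr do rewrite addnA.
by rewrite lerDr sumr_ge0.
Qed.

(* Follow good blocks, pay [psi] on bad sites; the last, possibly truncated, block costs N^2. *)
Lemma greedy_lower_bound K i :
  h * K%:R - \sum_(j < K) phi (i + j)%N - N%:R * N%:R <= alpha i K.
Proof.
have NN : 0 <= N%:R * N%:R :> R by rewrite mulr_ge0.
have [m] := ubnP K; elim: m K i => // m IH [|K] i hK.
  by rewrite big_ord0 mulr0; have := alpha0 i; lra.
case: (dichotomy i) => [e|[_ [n [/andP[n0 nN] hn]]]].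
  rewrite shift_sum e; have := alphaD i 1 K; rewrite addn1 add1n.
  by have := alpha1 i; have := IH K i.+1 hK; rewrite -natr1; lra.
case: (leqP n K.+1) => nK.
  have := alphaD i n (K.+1 - n); rewrite subnKC // => h1.
  have h2 : (K.+1 - n < m)%N by move: n0 nK hK; lia.
  have := IH (K.+1 - n)%N (i + n)%N h2; rewrite natrB // => h3.
  suff : \sum_(j < K.+1 - n) phi (i + n + j)%N <= \sum_(j < K.+1) phi (i + j)%N by lra.
  have := ler_tail_sum (K.+1 - n) n i; by rewrite subnKC.
have := single_steps K.+1 i.
suff : \sum_(j < K.+1) psi (i + j)%N <= \sum_(j < K.+1) phi (i + j)%N + N%:R * N%:R by lra.
apply: (@le_trans _ _ (\sum_(j < K.+1) (phi (i + j)%N + N%:R))).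
  by apply: ler_sum => j _; rewrite addrC.
rewrite big_split /= lerD2l sumr_const card_ord -[X in X <= _]mulr_natl -!natrM ler_nat leq_mul2r.
by rewrite (leq_trans (ltnW nK)) ?orbT.
Qed.

End Greedy.

Section Superadditive.
Context (dsp : measure_display) (Omega : measurableType dsp) (R : realType)
  (P : probability Omega R) (tau : Omega -> Omega) (a : nat -> Omega -> R) (psi : Omega -> R) (h : R).
Hypotheses (htau : mpres P tau) (ma : forall k, measurable_fun setT (a k)) (Lpsi : L1 P psi)
  (psi0 : forall w, 0 <= psi w).
Hypothesis aD : {ae P, forall w, forall k l, a k w + a l (iter k tau w) <= a (k + l)%N w}.
Hypothesis a0 : {ae P, forall w, 0 <= a 0%N w}.
Hypothesis a1 : {ae P, forall w, - psi w <= a 1%N w}.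
Hypothesis limsup_a : {ae P, forall w, forall (e : R) K, 0 < e ->
  exists k, (K <= k)%N /\ (h - e) * k%:R <= a k w}.

(* A site is good if [a] attains the rate within [N] steps. Since [psi] restricted to the bad sites
   has small mean, the maximal inequality bounds its Birkhoff sums linearly in time. *)
Lemma superadditive_liminf (e : R) : 0 < e ->
  {ae P, forall w, exists K, forall k, (K <= k)%N -> (h - e) * k%:R <= a k w}.
Proof.
move=> e0; pose G := [set w | exists K, forall k, (K <= k)%N -> (h - e) * k%:R <= a k w].
have mG : measurable G.
  apply: measurable_exists => K; apply: measurable_forall => k; apply: measurable_impl.
  by apply: measurable_le_set => //; exact: measurable_cst.
apply: (ae_prob0 mG); apply: prob_eq0_le; first exact: measurableC.
(* Three losses of size [d]: lowering the rate to [h'], the Birkhoff sum over bad sites, and the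
   boundary term N^2 once k is large. *)
suff small d : 0 < d -> 3 * d <= e -> fine (P (~` G)) <= d.
  move=> d d0; pose d' := Num.min d (e / 3).
  have d'0 : 0 < d' by rewrite lt_min d0 divr_gt0.
  apply: (@le_trans _ _ d'); last by rewrite ge_min lexx.
  apply: small => //; apply: (@le_trans _ _ (3 * (e / 3))); last by rewrite mulrC divfK.
  by rewrite ler_pM2l // ge_min lexx orbT.
(* Adding the absolute value of [h'] gives [h' - psi'] <= [- psi], so one step is bounded as the
   greedy estimate requires. *)
move=> d0 de; pose h' := h - d; pose psi' w := psi w + `|h'|.
have Lpsi' : L1 P psi' by apply: L1D => //; exact: L1_cst.
have psi'0 w : 0 <= psi' w by rewrite addr_ge0.
pose good N := [set w | psi' w <= N%:R /\ exists n, (0 < n <= N)%N /\ h' * n%:R <= a n w].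
have mgood N : measurable (good N).
  apply: measurableI.
    by apply: measurable_le_set; [exact: L1_measurable Lpsi' | exact: measurable_cst].
  apply: (@measurable_exists _ _ (fun n => [set w | (0 < n <= N)%N /\ h' * n%:R <= a n w])) => n.
  by apply: measurable_conj; apply: measurable_le_set => //; exact: measurable_cst.
pose phi N w := psi' w * \1_(~` good N) w.
have phiE N w : phi N w = psi' w \/ good N w /\ phi N w = 0.
  rewrite /phi indicE; case: (pselect (good N w)) => gw; last by left; rewrite mem_set ?mulr1.
  by right; split => //; rewrite memNset ?mulr0 //= => /(_ gw).
have phi0 N w : 0 <= phi N w by case: (phiE N w) => [->//|[_ ->]].
have phi_le N w : phi N w <= psi' w by case: (phiE N w) => [->//|[_ ->]].
have mphi N : measurable_fun setT (phi N).
  apply: measurable_funM; first exact: L1_measurable Lpsi'.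
  by apply: measurable_indic; exact: measurableC.
have Lphi N : L1 P (phi N).
  by apply: L1_dom Lpsi' => // w; rewrite ger0_norm.
(* A mean of at most d^2, tested at level [d] in the maximal inequality, leaves an exceptional
   probability of at most [d]. *)
have [N /(_ N (leqnn N)) hN] : exists N, forall n, (N <= n)%N -> Ex P (phi n) <= d * d.
  apply: (Ex_eventually0 _ mphi Lpsi'); first exact: mulr_gt0.
    by move=> n w; rewrite ger0_norm.
  apply: filterS limsup_a => w /(_ d 1%N d0) [n [n1 hn]].
  exists (maxn n (Num.trunc (psi' w)).+1) => m hm.
  have gw : good m w.
    split; first by apply: ltW; apply: lt_le_trans (truncnS_gt _) _; rewrite ler_nat (leq_trans (leq_maxr _ _) hm).
    by exists n; rewrite n1 (leq_trans (leq_maxl _ _) hm).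
  by rewrite /phi indicE memNset ?mulr0 //= => /(_ gw).
pose B := [set w | exists k, d * k%:R < birkhoff_sum tau (phi N) k w].
have PB : fine (P B) <= d.
  apply: le_trans (maximal_inequality htau (Lphi N) (phi0 N) d0) _.
  by rewrite ler_pdivrMr.
have mB : measurable B.
  apply: measurable_exists => k; apply: measurable_lt_set; first exact: measurable_cst.
  exact: L1_measurable (L1_birkhoff_sum htau (Lphi N) k).
apply: le_trans PB; have mGC : measurable (~` G) by exact: measurableC.
rewrite fine_le ?fin_num_measure //.
have orbit (Q : Omega -> Prop) : {ae P, forall w, Q w} -> {ae P, forall w, forall i, Q (iter i tau w)}.
  by move=> hQ; apply: ae_foralln => i; apply: mpres_ae hQ; exact: mpres_iter.
have aeB : {ae P, forall w, ~ B w -> G w}.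
  apply: filterS3 (orbit _ aD) (orbit _ a0) (orbit _ a1) => w hD h0 h1 nB.
  have bnd k : birkhoff_sum tau (phi N) k w <= d * k%:R.
    by rewrite leNgt; apply/negP => hk; apply: nB; exists k.
  exists (Num.trunc (d^-1 * (N%:R * N%:R))).+1 => k hk.
  have NNk : N%:R * N%:R <= d * k%:R.
    rewrite -ler_pdivrMl //; apply: ltW; apply: lt_le_trans (truncnS_gt _) _.
    by rewrite ler_nat.
  have := @greedy_lower_bound R (fun i k => a k (iter i tau w)) (fun i => psi' (iter i tau w))
    (fun i => phi N (iter i tau w)) h' N _ _ _ _ _ k 0%N.
  move=> H; apply: le_trans (H _ _ _ _ _).
  - have := bnd k; rewrite /birkhoff_sum /h'.
    have : 0 <= (k%:R : R) by [].
    under [in X in _ -> _ -> X]eq_bigr do rewrite add0n.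
    move=> k0 hk'; have : 3 * d * k%:R <= e * k%:R by rewrite ler_wpM2r.
    lra.
  - by move=> i m l; have := hD i m l; rewrite -iterD addnC.
  - by move=> i; exact: h0.
  - by move=> i; have := h1 i; rewrite /psi'; have := ler_norm h'; lra.
  - by move=> i; exact: phi0.
  - move=> i; case: (phiE N (iter i tau w)) => [->|[[g1 g2] _]]; [by left | right].
    by split.
have [M [mM M0 BM]] := aeB.
apply: (@le_trans _ _ (P (B `|` M))).
  apply: le_measure; rewrite ?inE //; first exact: measurableU.
  move=> w nG; case: (pselect (B w)) => Bw; [by left | right].
  by apply: BM => /= H; apply: nG; exact: H.
apply: le_trans (measureU2 P mB mM) _.
by rewrite -[leRHS]adde0; apply: leeD => //; rewrite le_eqVlt; apply/orP; left; apply/eqP.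
Qed.

End Superadditive.

(** * Centered Birkhoff sums have no linear drift *)

Section LinearDrift.
Context (dsp : measure_display) (Omega : measurableType dsp) (R : realType)
  (P : probability Omega R) (tau : Omega -> Omega) (phi : Omega -> R) (eta : R).
Hypotheses (htau : mpres P tau) (Lphi : L1 P phi) (Ephi : Ex P phi = 0) (eta0 : 0 < eta).

Lemma Ex_birkhoff_sum f k : L1 P f -> Ex P (birkhoff_sum tau f k) = k%:R * Ex P f.
Proof.
move=> Lf; rewrite /birkhoff_sum Ex_sum => [|i]; last exact: (L1_mpres (mpres_iter i htau) Lf).
rewrite (eq_bigr (fun=> Ex P f)) => [|i _]; first by rewrite sumr_const card_ord mulr_natl.
exact: (Ex_mpres (mpres_iter i htau) Lf).
Qed.

(** Integrate at one large time K. Outside an event of small probability the sum is at most -eta K;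
    on that event [phi] is bounded by a constant [c] plus an excess [f c] of small mean. The mean of
    the sum would be at most -eta K / 2, yet it is zero. *)
Lemma no_linear_drift :
  ~ {ae P, forall w, exists K, forall k, (K <= k)%N -> birkhoff_sum tau phi k w <= - eta * k%:R}.
Proof.
move=> drift; have mphi := L1_measurable Lphi.
pose f (n : nat) w := Num.max (`|phi w| - n%:R) 0.
have mf n : measurable_fun setT (f n).
  apply: (@measurable_maxr _ _ _ _ (fun w => `|phi w| - n%:R) (cst 0)); last exact: measurable_cst.
  by apply: measurable_funB; [apply: measurableT_comp mphi; exact: normr_measurable | exact: measurable_cst].
have f0 n w : 0 <= f n w by rewrite le_max lexx orbT.
have f_le n w : `|f n w| <= `|phi w|.
  by rewrite ger0_norm // ge_max normr_ge0 andbT lerBlDr lerDl.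
have Lf n : L1 P (f n) by apply: L1_dom (f_le n) (L1_norm Lphi).
have [||c /(_ c (leqnn c)) hc] := Ex_eventually0 (_ : 0 < eta / 4) mf (L1_norm Lphi) f_le.
- by rewrite divr_gt0.
- apply: aeW => w; exists (Num.trunc `|phi w|).+1 => n hn; apply/max_idPr.
  by rewrite subr_le0 ltW // (lt_le_trans (truncnS_gt _)) // ler_nat.
pose A K := [set w | forall k, (K <= k)%N -> birkhoff_sum tau phi k w <= - eta * k%:R].
have mA K : measurable (A K).
  apply: measurable_forall => k; apply: measurable_impl; apply: measurable_le_set.
    exact: L1_measurable (L1_birkhoff_sum htau Lphi k).
  exact: measurable_cst.
pose g K : Omega -> R := \1_(~` A K).
have Lg K : L1 P (g K) by apply: L1_indic; exact: measurableC.
have ec : 0 < eta / (4 * (eta + c%:R)) by rewrite divr_gt0 // mulr_gt0 // ltr_wpDr.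
have [||N hN] := Ex_eventually0 ec (fun K => L1_measurable (Lg K)) (L1_cst P 1).
- by move=> K w; rewrite /g indicE; case: (_ \in _); rewrite ?normr1 ?normr0.
- apply: filterS drift => w [K hK]; exists K => n hn; rewrite /g indicE memNset //=; apply.
  by move=> k nk; apply: hK; exact: leq_trans nk.
pose K := N.+1; have {}hN := hN K (leqnSn N).
have K0 : 0 < K%:R :> R by [].
have Lb : L1 P (birkhoff_sum tau (f c) K) := L1_birkhoff_sum htau (Lf c) K.
have Lc1 : L1 P (fun w => (eta + c%:R) * K%:R * g K w) by exact: L1Z.
have pointwise w : birkhoff_sum tau phi K w <=
    - eta * K%:R + ((eta + c%:R) * K%:R * g K w + birkhoff_sum tau (f c) K w).
  have b0 : 0 <= birkhoff_sum tau (f c) K w by rewrite sumr_ge0.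
  case: (pselect (A K w)) => hw.
    rewrite /g indicE memNset /=; last exact.
    by have := hw K (leqnn K); rewrite mulr0 add0r; lra.
  rewrite /g indicE mem_set //= mulr1 mulrDl addrA mulNr addKr.
  rewrite mulr_natr -[K in X in X + _]card_ord -sumr_const -big_split /=; apply: ler_sum => i _.
  rewrite addrC -lerBlDr le_max; apply/orP; left.
  by rewrite lerD2r ler_norm.
have Lc0 : L1 P (fun w => - eta * K%:R) := L1_cst P _.
have := Ex_le (L1_birkhoff_sum htau Lphi K) (L1D Lc0 (L1D Lc1 Lb)) pointwise.
rewrite Ex_birkhoff_sum // Ephi mulr0 (ExD Lc0 (L1D Lc1 Lb)) (ExD Lc1 Lb) (Ex_birkhoff_sum _ (Lf c)) (ExZ _ (Lg K)).
have Ec : Ex P (fun=> - eta * K%:R) = - eta * K%:R := Ex_cst P _.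
rewrite {}Ec => h.
have h1 : (eta + c%:R) * K%:R * Ex P (g K) <= K%:R * (eta / 4).
  have -> : K%:R * (eta / 4) = (eta + c%:R) * K%:R * (eta / (4 * (eta + c%:R))).
    by field; rewrite gt_eqF // ltr_wpDr.
  by rewrite ler_pM2l // mulr_gt0 // ltr_wpDr.
have h2 : K%:R * Ex P (f c) <= K%:R * (eta / 4) by rewrite ler_pM2l.
have h3 : 0 < eta * K%:R by rewrite mulr_gt0.
lra.
Qed.

End LinearDrift.

Lemma shift_bounds (u N r k : nat) : (r <= N)%N -> (k < r.*2.+1)%N ->
  (u + N <= u + N + k - r + r)%N /\ (u + N + k - r <= u + N + r)%N.
Proof. by lia. Qed.

Lemma shift_int (u N r k : nat) : (r <= N)%N ->
  - r%:Z + k%:Z + (0 + (u + N)%N%:Z) = 0 + (u + N + k - r)%N%:Z.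
Proof. by lia. Qed.

(** * Weak-type maximal inequality for the lattice action *)

Section LatticeMaximal.
Context (dsp : measure_display) (Omega : measurableType dsp) (R : realType)
  (P : probability Omega R) (d : nat) (theta : 'rV[int]_d -> Omega -> Omega) (W : Omega -> R).
Hypotheses (mtheta : forall x, mpres P (theta x))
  (thetaD : forall x y w, theta (x + y) w = theta x (theta y w))
  (LW : L1 P W) (W0 : forall w, 0 <= W w).

Definition large_average (t : R) (N : nat) : set Omega :=
  [set w | exists r, (r <= N)%N /\ t * (r.*2.+1 ^ d)%:R < cube_sum r (fun y => W (theta y w))].

Lemma L1_theta x : L1 P (fun w => W (theta x w)).
Proof. exact: (L1_mpres (mtheta x) LW). Qed.

Lemma measurable_cube_sum r : measurable_fun setT (fun w => cube_sum r (fun y => W (theta y w))).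
Proof. by apply: (@L1_measurable _ _ _ P); apply: L1_sum => g; exact: L1_theta. Qed.

Lemma measurable_large_average t N : measurable (large_average t N).
Proof.
apply: (@measurable_exists _ _ (fun r => [set w | (r <= N)%N /\
  t * (r.*2.+1 ^ d)%:R < cube_sum r (fun y => W (theta y w))])) => r.
apply: measurable_conj; apply: measurable_lt_set; first exact: measurable_cst.
exact: measurable_cube_sum.
Qed.

(* Transference: average over a large cube of shifts and apply the covering lemma on each orbit. *)
Lemma large_average_prob t N : 0 < t -> t * fine (P (large_average t N)) <= (4 ^ d)%:R * Ex P W.
Proof.
move=> t0; set E := large_average t N; have mE : measurable E by exact: measurable_large_average.
(* Shifts run over the middle part [N, 3N]^d of [0, 4N]^d, so that cubes of radius at most [N] about
   them stay inside. *)
pose H := (N.*2.*2.+1)%N; pose S := {ffun 'I_d -> 'I_(N.*2.+1)}.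
have embP (u : S) i : (u i + N < H)%N by have := ltn_ord (u i); rewrite /H; lia.
pose emb (u : S) : {ffun 'I_d -> 'I_H} := [ffun i => Ordinal (embP u i)].
have emb_inj : injective emb.
  move=> u u' e; apply/ffunP => i; apply: val_inj => /=.
  by move/ffunP/(_ i)/(congr1 val): e; rewrite !ffunE /=; lia.
pose pt (g : {ffun 'I_d -> 'I_H}) := gridpt 0 g.
have pointwise w : t * (\sum_(u : S) \1_E (theta (pt (emb u)) w)) <=
    (2 ^ d)%:R * \sum_g W (theta (pt g) w).
  have /choice [rad hrad] : forall g, exists r, E (theta (pt g) w) -> (r <= N)%N /\
      t * (r.*2.+1 ^ d)%:R < cube_sum r (fun y => W (theta y (theta (pt g) w))).
    move=> g; case: (pselect (E (theta (pt g) w))) => [[r hr]|nE]; first by exists r.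
    by exists 0%N => /nE.
  pose A : {set S} := [set u : S | theta (pt (emb u)) w \in E]%SET.
  have -> : \sum_(u : S) \1_E (theta (pt (emb u)) w) = #|[set emb u | u in A]%SET|%:R :> R.
    rewrite card_imset // -sum1_card natr_sum [RHS]big_mkcond /=; apply: eq_bigr => u _.
    by rewrite indicE inE; case: (_ \in E).
  apply: (@le_trans _ _ ((2 ^ d)%:R * \sum_(y | [exists x in [set emb u | u in A]%SET,
      y \in cube x (rad x)]) W (theta (pt y) w))).
    apply: vitali; [exact: ltW | by move=> y; exact: W0 | ].
    move=> x /imsetP[u]; rewrite inE => /set_mem uE ->{x}.
    have [rN hr] := hrad _ uE; apply: ltW; apply: lt_le_trans hr _.
    set r := rad (emb u) in rN *; set x := emb u.
    have fP (g : {ffun 'I_d -> 'I_(r.*2.+1)}) i : (u i + N + g i - r < H)%N.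
      by have := ltn_ord (u i); have := ltn_ord (g i); rewrite /H; lia.
    pose f (g : {ffun 'I_d -> 'I_(r.*2.+1)}) : {ffun 'I_d -> 'I_H} := [ffun i => Ordinal (fP g i)].
    have f_inj : injective f.
      move=> g g' e; apply/ffunP => i; apply: val_inj => /=.
      by move/ffunP/(_ i)/(congr1 val): e; rewrite !ffunE /=; lia.
    rewrite [leRHS]big_mkcond /=.
    apply: le_trans (ler_sum_inj f_inj (F := fun y => if y \in cube x r then W (theta (pt y) w) else 0) _).
      rewrite le_eqVlt; apply/orP; left; apply/eqP/eq_bigr => g _.
      have -> : f g \in cube x r.
        apply/cubeP => i; rewrite /x !ffunE /=; exact: shift_bounds rN (ltn_ord (g i)).
      rewrite -thetaD; congr (W (theta _ w)); apply/int_rowP => i.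
      by rewrite !mxE !ffunE /=; exact: shift_int.
    by move=> y; case: ifP.
  rewrite ler_wpM2l // [leRHS](bigID (fun y => [exists x in [set emb u | u in A]%SET,
      y \in cube x (rad x)])) /= lerDl sumr_ge0 //.
have LI (u : S) : L1 P (fun w => \1_E (theta (pt (emb u)) w)).
  exact: (L1_mpres (mtheta _) (L1_indic P mE)).
have Lf : L1 P (fun w => t * (\sum_(u : S) \1_E (theta (pt (emb u)) w))).
  by apply: L1Z; apply: L1_sum.
have Lg : L1 P (fun w => (2 ^ d)%:R * \sum_g W (theta (pt g) w)).
  by apply: L1Z; apply: L1_sum => g; exact: L1_theta.
have e1 : \sum_(u : S) Ex P (fun w => \1_E (theta (pt (emb u)) w)) =
    (N.*2.+1 ^ d)%:R * fine (P E).
  rewrite (eq_bigr (fun=> fine (P E))); first by rewrite sumr_const card_ffun !card_ord mulr_natl.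
  by move=> u _; rewrite -(Ex_indic P mE) -(Ex_mpres (mtheta (pt (emb u))) (L1_indic P mE)).
have e2 : \sum_g Ex P (fun w => W (theta (pt g) w)) = (H ^ d)%:R * Ex P W.
  rewrite (eq_bigr (fun=> Ex P W)); first by rewrite sumr_const card_ffun !card_ord mulr_natl.
  by move=> g _; rewrite -(Ex_mpres (mtheta (pt g)) LW).
have := Ex_le Lf Lg pointwise.
have LW' g := L1_theta (pt g).
rewrite (ExZ t (L1_sum _ LI)) (ExZ _ (L1_sum _ LW')) (Ex_sum _ LI) (Ex_sum _ LW') e1 e2 => h.
have K0 : 0 < (N.*2.+1 ^ d)%:R :> R by rewrite ltr0n expn_gt0.
rewrite -(ler_pM2l K0); apply: le_trans (_ : t * ((N.*2.+1 ^ d)%:R * fine (P E)) <= _).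
  by rewrite mulrCA.
apply: le_trans h _; rewrite !mulrA ler_wpM2r ?Ex_ge0 // -!natrM ler_nat.
(* One factor 2^d is the covering constant, the other bounds the volume ratio of the outer cube to
   the cube of shifts. *)
have -> : (4 ^ d = 2 ^ d * 2 ^ d)%N by rewrite -expnMn.
rewrite mulnCA leq_mul2l; apply/orP; right; rewrite mulnC -expnMn.
by case: (d) => [//|d']; rewrite leq_exp2r // /H; lia.
Qed.

(** The bound on [large_average] does not depend on the largest radius, so the set where some
    average exceeds n has probability of order 1 / n. *)
Lemma cube_average_bounded :
  {ae P, forall w, exists C : R, 0 <= C /\
    forall r, cube_sum r (fun y => W (theta y w)) <= C * (r.*2.+1 ^ d)%:R}.
Proof.
pose A (n : nat) := [set w | forall r, cube_sum r (fun y => W (theta y w)) <= n%:R * (r.*2.+1 ^ d)%:R].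
have mA n : measurable (A n).
  apply: measurable_forall => r; apply: measurable_le_set; last exact: measurable_cst.
  exact: measurable_cube_sum.
have mU : measurable [set w | exists n, A n w] by exact: measurable_exists.
suff h : {ae P, forall w, exists n, A n w}.
  by apply: filterS h => w [n hn]; exists n%:R.
apply: (ae_prob0 mU); apply: prob_eq0_le; first exact: measurableC.
move=> e e0; pose K := (4 ^ d)%:R * Ex P W.
have K0 : 0 <= K by rewrite mulr_ge0 // Ex_ge0.
pose n := (Num.trunc (K / e)).+1; have n0 : 0 < n%:R :> R by rewrite ltr0n.
have hn : K / n%:R <= e.
  by rewrite ler_pdivrMr // mulrC -ler_pdivrMr // ltW // truncnS_gt.
have cvgE : P (large_average n%:R N) @[N --> \oo] --> P (\bigcup_N large_average n%:R N).
  apply: nondecreasing_cvg_mu => [N||N M NM].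
  - exact: measurable_large_average.
  - by apply: bigcupT_measurable => N; exact: measurable_large_average.
  - by apply/subsetPset => w [r [rN hr]]; exists r; split => //; exact: leq_trans NM.
have mV : measurable (\bigcup_N large_average n%:R N).
  by apply: bigcupT_measurable => N; exact: measurable_large_average.
apply: (@le_trans _ _ (fine (P (\bigcup_N large_average n%:R N)))).
  apply: prob_le => //; first exact: measurableC.
  move=> w /= nA; apply: contrapT => nV; apply: nA; exists n => r.
  by rewrite leNgt; apply/negP => hr; apply: nV; exists r => //; exists r.
rewrite -lee_fin -probE // -(cvg_lim _ cvgE) //; apply: lime_le.
  by apply/cvg_ex; eexists; exact: cvgE.
apply: nearW => N; have mE := measurable_large_average n%:R N; rewrite probE // lee_fin.
by apply: le_trans hn; rewrite ler_pdivlMr // mulrC; exact: large_average_prob.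
Qed.

End LatticeMaximal.

(** * The walk and its lazy kernel *)

Section Action.
Context (Omega : Type) (d : nat) (T : dir d -> Omega -> Omega).
Hypothesis Tcomm : forall e e', T e \o T e' = T e' \o T e.
Hypothesis Tinv : forall e, T (dir_opp e) \o T e = id /\ T e \o T (dir_opp e) = id.

Let comm e e' w : T e (T e' w) = T e' (T e w).
Proof. by have /(congr1 (fun f => f w)) := Tcomm e e'. Qed.

Let pn i w : T (i, false) (T (i, true) w) = w.
Proof. by have [_ /(congr1 (fun f => f w))] := Tinv (i, false). Qed.

Let np i w : T (i, true) (T (i, false) w) = w.
Proof. by have [/(congr1 (fun f => f w)) h _] := Tinv (i, false). Qed.

Let TpowS i (z : int) w : Tpow T i (z + 1) w = T (i, false) (Tpow T i z w).
Proof.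
case: z => [n|[|n]]; first by rewrite -PoszD addn1.
  by rewrite /= pn.
have -> : (Negz n.+1 + 1 = Negz n)%R by lia.
by rewrite [in RHS]/Tpow iterS pn.
Qed.

Let TpowP i (z : int) w : Tpow T i (z - 1) w = T (i, true) (Tpow T i z w).
Proof.
by have := TpowS i (z - 1) w; rewrite subrK => ->; rewrite np.
Qed.

Lemma TpowD i (y z : int) w : Tpow T i (y + z) w = Tpow T i y (Tpow T i z w).
Proof.
elim/int_ind: y => [|n IH|n IH]; first by rewrite add0r.
  by rewrite -addn1 PoszD addrAC TpowS IH -TpowS.
by rewrite -addn1 PoszD opprD addrAC TpowP IH -TpowP.
Qed.

Lemma Tpow_comm_T i z e w : Tpow T i z (T e w) = T e (Tpow T i z w).
Proof.
elim/int_ind: z => // n IH.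
  by rewrite -addn1 PoszD !TpowS IH comm.
by rewrite -addn1 PoszD opprD !TpowP IH comm.
Qed.

Lemma Tpow_comm i j y z w : Tpow T i y (Tpow T j z w) = Tpow T j z (Tpow T i y w).
Proof.
elim/int_ind: y => // n IH.
  by rewrite -addn1 PoszD !TpowS IH Tpow_comm_T.
by rewrite -addn1 PoszD opprD !TpowP IH Tpow_comm_T.
Qed.

Let Fs (s : seq 'I_d) (x : 'rV[int]_d) := foldr (fun i f => Tpow T i (x ord0 i) \o f) id s.

Let Tpow_comm_Fs i z s x w : Tpow T i z (Fs s x w) = Fs s x (Tpow T i z w).
Proof. by elim: s => //= j s IH; rewrite Tpow_comm IH. Qed.

Lemma TxD x y w : Tx T (x + y) w = Tx T x (Tx T y w).
Proof.
rewrite /Tx; elim: (enum 'I_d) => //= i s IH.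
by rewrite mxE TpowD IH -/(Fs s x) -/(Fs s y) Tpow_comm_Fs.
Qed.

Lemma Tx0 w : Tx T 0 w = w.
Proof. by rewrite /Tx; elim: (enum 'I_d) w => //= i s IH w; rewrite IH mxE. Qed.

Lemma Tx_vec e w : Tx T (vec_of e) w = T e w.
Proof.
case: e => i b.
have key s : uniq s -> Fs s (vec_of (i, b)) w = if i \in s then T (i, b) w else w.
  elim: s => //= j s IH /andP[js us]; rewrite IH // in_cons.
  rewrite /vec_of /=; case: (eqVneq i j) => [ij|ij] /=.
    rewrite -ij in js *; rewrite (negPf js); case: b {IH} => /=; rewrite !mxE eqxx //.
  have -> : ((if b then - unitvec i else unitvec i) ord0 j = 0)%R.
    by case: b {IH} => /=; rewrite !mxE (negPf ij) ?oppr0.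
  by [].
by rewrite /Tx -/(Fs _ _) key ?enum_uniq // mem_enum.
Qed.

Lemma Tx_iter k z w : Tx T (z *+ k) w = iter k (Tx T z) w.
Proof. by elim: k => [|k IH]; rewrite ?Tx0 // mulrS TxD IH. Qed.

Lemma TxC x y w : Tx T x (Tx T y w) = Tx T y (Tx T x w).
Proof. by rewrite -!TxD addrC. Qed.

End Action.

Section ActionMeasure.
Context (d : nat) (dsp : measure_display) (Omega : measurableType dsp)
    (R : realType) (P : probability Omega R) (T : dir d -> Omega -> Omega).
Hypothesis mT : forall e, measurable_fun setT (T e).
Hypothesis PT : forall e A, measurable A -> P (T e @^-1` A) = P A.

Lemma mpres_T e : mpres P (T e).
Proof. by split => // A; exact: PT. Qed.

Lemma mpres_Tx x : mpres P (Tx T x).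
Proof.
rewrite /Tx; elim: (enum 'I_d) => [|i s IH] /=; first exact: mpres_id.
apply: mpres_comp IH; case: (x ord0 i) => n; apply: mpres_iter; exact: mpres_T.
Qed.

End ActionMeasure.

Lemma absz_add_le (a b : int) : (absz (a + b)%R <= absz a + absz b)%N.
Proof. by lia. Qed.

Lemma cube_shift_range (r : nat) (v : int) : - 1 <= v -> v <= 1 ->
  - r.+1%:Z <= - r%:Z + v /\ - r%:Z + v + (r.*2.+1)%:Z <= r.+1%:Z + 1.
Proof. by lia. Qed.

Definition l1norm (d : nat) (x : 'rV[int]_d) : nat := \sum_i absz (x ord0 i).

Lemma l1normD (d : nat) (x y : 'rV[int]_d) : (l1norm (x + y) <= l1norm x + l1norm y)%N.
Proof.
rewrite /l1norm -big_split /=; apply: leq_sum => i _; rewrite mxE.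
exact: absz_add_le.
Qed.

Lemma l1norm_vec (d : nat) (e : dir d) : l1norm (vec_of e) = 1%N.
Proof.
case: e => i b; rewrite /l1norm (bigD1 i) //= big1 => [|j ji].
  by rewrite /vec_of /=; case: b; rewrite !mxE eqxx.
by rewrite /vec_of /= eq_sym in ji *; case: b; rewrite !mxE (negPf ji).
Qed.

Lemma vec_of_bound (d : nat) (e : dir d) (i : 'I_d) :
  - 1 <= (vec_of e ord0 i : int) /\ (vec_of e ord0 i : int) <= 1.
Proof. by case: e => j b; rewrite /vec_of /=; case: b; rewrite !mxE; case: (j == i). Qed.

Lemma absz_vec_of (d : nat) (e : dir d) (i : 'I_d) : (absz (vec_of e ord0 i) <= 1)%N.
Proof. by case: e => j b; rewrite /vec_of /=; case: b; rewrite !mxE; case: (j == i). Qed.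

Lemma dotZD (R : realType) (d : nat) (lam : 'rV[R]_d) x y :
  dotZ lam (x + y) = dotZ lam x + dotZ lam y.
Proof.
by rewrite /dotZ -big_split /=; apply: eq_bigr => i _; rewrite mxE intrD mulrDr.
Qed.

Lemma dotZ0 (R : realType) (d : nat) (lam : 'rV[R]_d) : dotZ lam 0 = 0.
Proof. by rewrite /dotZ big1 // => i _; rewrite mxE mulr0. Qed.

Lemma dotZ_vec_bound (R : realType) (d : nat) (lam : 'rV[R]_d) (e : dir d) :
  `|dotZ lam (vec_of e)| <= \sum_i `|lam ord0 i|.
Proof.
apply: le_trans (ler_norm_sum _ _ _) _; apply: ler_sum => i _; rewrite normrM.
rewrite ler_piMr //; have [h1 h2] := vec_of_bound e i.
by rewrite -intr_norm -[leRHS]/(1%:~R) ler_int ler_norml h1 h2.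
Qed.

(** * Moment generating function and lazy kernel *)

Section Walk.
Context (Omega : Type) (R : realType) (d : nat) (T : dir d -> Omega -> Omega)
  (p : Omega -> dir d -> R) (lam : 'rV[R]_d).
Hypothesis Tcomm : forall e e', T e \o T e' = T e' \o T e.
Hypothesis Tinv : forall e, T (dir_opp e) \o T e = id /\ T e \o T (dir_opp e) = id.
Hypothesis p01 : forall w e, 0 <= p w e <= 1.
Hypothesis p1 : forall w, \sum_(e : dir d) p w e = 1.

Definition weight (w : Omega) (e : dir d) : R := p w e * expR (dotZ lam (vec_of e)).
Local Notation mgf n w := (quenched_mgf T p w lam n).
Local Notation L := (\sum_i `|lam ord0 i|).

Lemma weight_ge0 w e : 0 <= weight w e.
Proof. by rewrite mulr_ge0 ?expR_ge0 //; case/andP: (p01 w e). Qed.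

Lemma path_prob_shift w x s : path_prob T p w x s = path_prob T p (Tx T x w) 0 s.
Proof.
elim: s w x => //= e s IH w x; rewrite IH [in RHS]IH add0r Tx0.
by rewrite TxC // -TxD // [vec_of e + x]addrC -TxD.
Qed.

Lemma mgf0 w : mgf 0 w = 1.
Proof.
rewrite /quenched_mgf (big_pred1 [tuple]) => [|t]; last by apply/esym/eqP; exact: tuple0.
by rewrite /= path_end_nil dotZ0 expR0 mulr1.
Qed.

Lemma mgfS n w : mgf n.+1 w = \sum_e weight w e * mgf n (T e w).
Proof.
rewrite /quenched_mgf.
have h : cancel (fun q : dir d * n.-tuple (dir d) => [tuple of q.1 :: q.2])
    (fun t : n.+1.-tuple (dir d) => (thead t, [tuple of behead t])).
  by move=> [e t]; congr (_, _); apply: val_inj.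
have h' : cancel (fun t : n.+1.-tuple (dir d) => (thead t, [tuple of behead t]))
    (fun q : dir d * n.-tuple (dir d) => [tuple of q.1 :: q.2]).
  by move=> t; case: (tupleP t) => e t'; apply: val_inj.
rewrite (reindex _ (onW_bij _ (Bijective h h'))) /=.
under [RHS]eq_bigr do rewrite mulr_sumr.
rewrite pair_big /=; apply: eq_bigr => -[e t] _ /=.
rewrite path_prob_shift Tx0 add0r Tx_vec // path_end_cons add0r /weight.
have -> : path_end (vec_of e) t = vec_of e + path_end 0 t by rewrite /path_end add0r.
by rewrite dotZD expRD; ring.
Qed.

Lemma mgf_ge0 n w : 0 <= mgf n w.
Proof.
elim: n w => [|n IH] w; first by rewrite mgf0.
by rewrite mgfS sumr_ge0 // => e _; rewrite mulr_ge0 // weight_ge0.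
Qed.

(** The additional step is the last one: a single step contributes an average of numbers at least
    exp(- L), and the first-step recursion carries this bound to every n. *)
Lemma mgfS_ge n w : expR (- L) * mgf n w <= mgf n.+1 w.
Proof.
elim: n w => [|n IH] w.
  rewrite mgf0 mulr1 mgfS -[leLHS]mul1r -(p1 w) mulr_suml; apply: ler_sum => e _.
  rewrite mgf0 mulr1 ler_wpM2l //; first by case/andP: (p01 w e).
  by rewrite ler_expR; have := dotZ_vec_bound lam e; rewrite ler_norml => /andP[].
rewrite mgfS [leRHS]mgfS mulr_sumr; apply: ler_sum => e _.
by rewrite mulrCA ler_wpM2l // weight_ge0.
Qed.

Lemma mgf_add_ge j n w : expR (- L * j%:R) * mgf n w <= mgf (n + j) w.
Proof.
elim: j => [|j IH]; first by rewrite mulr0 expR0 mul1r addn0.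
rewrite addnS; apply: le_trans (mgfS_ge _ _).
apply: le_trans (_ : expR (- L) * (expR (- L * j%:R) * mgf n w) <= _).
  by rewrite mulrA -expRD -natr1 mulrDr mulr1 addrC.
by rewrite ler_wpM2l // expR_ge0.
Qed.

Lemma mgf_ge n w : expR (- L * n%:R) <= mgf n w.
Proof. by have := mgf_add_ge n 0 w; rewrite mgf0 mulr1 add0n. Qed.

Lemma mgf_gt0 n w : 0 < mgf n w.
Proof. exact: lt_le_trans (expR_gt0 _) (mgf_ge n w). Qed.

Section Lazy.
Context (kappa : R).
Hypothesis kappaL : L <= kappa.

(* The best weight of reaching [y] at time [N] when waiting costs a factor exp (- kappa) per unit
   of time; waiting removes both the parity and the exact-time constraints of the walk. *)
Fixpoint lazyk (N : nat) (y : 'rV[int]_d) (w : Omega) : R :=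
  if N is N'.+1 then
    Num.max (expR (- kappa) * lazyk N' y w) (\sum_e weight w e * lazyk N' (y - vec_of e) (T e w))
  else (y == 0)%:R.

Lemma lazyk_ge0 N y w : 0 <= lazyk N y w.
Proof.
elim: N y w => [|N IH] y w /=; first by rewrite ler0n.
by rewrite le_max mulr_ge0 ?expR_ge0.
Qed.

Lemma lazyk_wait1 N y w : expR (- kappa) * lazyk N y w <= lazyk N.+1 y w.
Proof. by rewrite /= le_max lexx. Qed.

Lemma lazyk_step N y w e : weight w e * lazyk N y (T e w) <= lazyk N.+1 (vec_of e + y) w.
Proof.
rewrite /= le_max; apply/orP; right; rewrite (bigD1 e) //= addrAC subrr add0r lerDl.
by rewrite sumr_ge0 // => e' _; rewrite mulr_ge0 ?weight_ge0 ?lazyk_ge0.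
Qed.

Lemma lazyk_wait j N y w : expR (- kappa * j%:R) * lazyk N y w <= lazyk (N + j) y w.
Proof.
elim: j => [|j IH]; first by rewrite mulr0 expR0 mul1r addn0.
rewrite addnS; apply: le_trans (lazyk_wait1 _ _ _).
apply: le_trans (_ : expR (- kappa) * (expR (- kappa * j%:R) * lazyk N y w) <= _).
  by rewrite mulrA -expRD -natr1 mulrDr mulr1 addrC.
by rewrite ler_wpM2l // expR_ge0.
Qed.

Lemma lazykM N N' y y' w :
  lazyk N y w * lazyk N' y' (Tx T y w) <= lazyk (N + N') (y + y') w.
Proof.
elim: N y w => [|N IH] y w.
  rewrite /=; case: eqP => [->|_]; last by rewrite mul0r lazyk_ge0.
  by rewrite mul1r add0n add0r Tx0.
rewrite addSn [X in X * _ <= _]/= maxr_pMl ?lazyk_ge0 // ge_max; apply/andP; split.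
  by apply: le_trans (lazyk_wait1 _ _ _); rewrite -mulrA ler_wpM2l ?expR_ge0.
rewrite [leRHS]/= le_max; apply/orP; right; rewrite mulr_suml; apply: ler_sum => e _.
rewrite -mulrA ler_wpM2l ?weight_ge0 //.
have -> : y + y' - vec_of e = (y - vec_of e) + y' by rewrite addrAC.
have -> : Tx T y w = Tx T (y - vec_of e) (T e w) by rewrite -Tx_vec // -TxD // subrK.
exact: IH.
Qed.

(** Here [kappa] must be at least [L]: replacing a wait by a genuine step multiplies the generating
    function by at least exp(- L). *)
Lemma lazyk_le_mgf N y w : lazyk N y w <= mgf N w.
Proof.
elim: N y w => [|N IH] y w; first by rewrite mgf0 /=; case: eqP.
rewrite /= ge_max; apply/andP; split.
  apply: le_trans (mgfS_ge N w); apply: ler_pM; rewrite ?expR_ge0 ?lazyk_ge0 //.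
  by rewrite ler_expR lerN2.
by rewrite mgfS; apply: ler_sum => e _; rewrite ler_wpM2l ?weight_ge0.
Qed.

Lemma lazyk_support N y w : lazyk N y w != 0 -> (l1norm y <= N)%N.
Proof.
elim: N y w => [|N IH] y w /=.
  by case: (eqVneq y 0) => [-> _|_]; rewrite ?eqxx //; rewrite /l1norm big1 // => i _; rewrite mxE.
apply: contraNT; rewrite -ltnNge => hy.
have z y' w' : (N < l1norm y')%N -> lazyk N y' w' = 0.
  by move=> h; apply/eqP; apply: contraTT h => /IH; rewrite -leqNgt.
rewrite z ?(ltnW hy) // mulr0 big1 ?maxxx // => e _; rewrite z ?mulr0 //.
have := l1normD (y - vec_of e) (vec_of e); rewrite subrK l1norm_vec => h.
by have := leq_trans hy h; rewrite addn1.
Qed.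

(** Dropping the waiting branch of the maximum leaves the first-step recursion of the walk, whose
    endpoints lie within radius N. *)
Lemma mgf_le_cube_sum N r w : (N <= r)%N -> mgf N w <= cube_sum r (fun y => lazyk N y w).
Proof.
elim: N r w => [|N IH] r w.
  move=> _; rewrite mgf0.
  have h0 : (r < r.*2.+1)%N by lia.
  pose g0 : {ffun 'I_d -> 'I_(r.*2.+1)} := [ffun=> Ordinal h0].
  have e0 : gridpt (const_mx (- r%:Z)) g0 == 0.
    by apply/eqP/int_rowP => i; rewrite !mxE ffunE /= addrC subrr.
  by rewrite /cube_sum (bigD1 g0) //= e0 lerDl sumr_ge0.
case: r => // r; rewrite ltnS => Nr; rewrite mgfS.
apply: (@le_trans _ _ (\sum_e weight w e * cube_sum r (fun y => lazyk N y (T e w)))).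
  by apply: ler_sum => e _; rewrite ler_wpM2l ?weight_ge0 ?IH.
apply: (@le_trans _ _ (\sum_e weight w e *
    cube_sum r.+1 (fun y => lazyk N (y - vec_of e) (T e w)))).
  apply: ler_sum => e _; rewrite ler_wpM2l ?weight_ge0 //.
  apply: le_trans (@sum_grid_le_cube d (r.*2.+1) r.+1 R (fun y => lazyk N (y - vec_of e) (T e w))
    (const_mx (- r%:Z) + vec_of e) _ _).
  - rewrite le_eqVlt; apply/orP; left; apply/eqP/eq_bigr => g _; congr lazyk.
    by apply/int_rowP => i; rewrite !mxE addrAC addrK.
  - by move=> y; exact: lazyk_ge0.
  - by move=> i; rewrite !mxE; have [h1 h2] := vec_of_bound e i; exact: cube_shift_range.
rewrite /cube_sum; under eq_bigr do rewrite mulr_sumr.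
by rewrite exchange_big /=; apply: ler_sum => g _; rewrite le_max lexx orbT.
Qed.

End Lazy.
End Walk.

Lemma path_cost_le (R : realType) (d : nat) (zeta : 'rV[int]_d -> R) (b : R)
    (x : 'rV[int]_d) (s : seq (dir d)) (r : nat) :
  (forall y : 'rV[int]_d, (forall k, absz (y ord0 k) <= r + size s)%N -> zeta y <= b) ->
  (forall k, absz (x ord0 k) <= r)%N -> path_cost zeta x s <= (size s).+1%:R * b.
Proof.
elim: s x r => [|e s IH] x r hb hx.
  by rewrite /= addr0 mul1r; apply: hb => k; rewrite addn0.
rewrite [path_cost _ _ _]/= -[_.+2%:R]natr1 mulrDl mul1r addrC; apply: lerD.
  apply: (IH _ r.+1) => [y hy|k].
    by apply: hb => k; rewrite /= addnS -addSn; exact: hy.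
  rewrite mxE; apply: leq_trans (absz_add_le _ _) _; rewrite -(addn1 r) leq_add //.
  exact: absz_vec_of.
by apply: hb => k; rewrite (leq_trans (hx k)) // leq_addr.
Qed.

Section WalkBounds.
Context (Omega : Type) (R : realType) (d : nat) (T : dir d -> Omega -> Omega)
  (p : Omega -> dir d -> R) (lam : 'rV[R]_d) (kappa : R).
Hypothesis Tcomm : forall e e', T e \o T e' = T e' \o T e.
Hypothesis Tinv : forall e, T (dir_opp e) \o T e = id /\ T e \o T (dir_opp e) = id.
Hypothesis p01 : forall w e, 0 <= p w e <= 1.
Local Notation lazyk := (lazyk T p lam kappa).
Local Notation weight := (weight p lam).

Section PathBound.
Context (Z : Omega -> R) (w : Omega).
Hypotheses (Z1 : forall w, 1 <= Z w)
  (hZ : forall x e, expR (- Z (Tx T x w)) <= weight (Tx T x w) e).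

Lemma path_lazyk x s : expR (- path_cost (fun x => Z (Tx T x w)) x s) <=
  lazyk (size s) (\sum_(e <- s) vec_of e) (Tx T x w).
Proof.
elim: s x => [|e s IH] x.
  by rewrite big_nil /= eqxx addr0 -expR0 ler_expR; have := Z1 (Tx T x w); lra.
rewrite big_cons [path_cost _ _ _]/= opprD expRD.
rewrite -[size (e :: s)]/(size s).+1; apply: le_trans (lazyk_step T lam p01 _ _ _ _ _).
apply: ler_pM; rewrite ?expR_ge0 // (_ : T e _ = Tx T (x + vec_of e) w) //.
by rewrite addrC TxD // Tx_vec.
Qed.

Lemma size_le_path_cost x s : (size s)%:R <= path_cost (fun x => Z (Tx T x w)) x s.
Proof.
elim: s x => [|e s IH] x; first by rewrite /= addr0 (le_trans _ (Z1 _)).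
by rewrite [size _]/= -natr1 /= addrC lerD.
Qed.

(** As every site costs at least 1, the same number [c] bounds both the duration of the path and the
    logarithm of its inverse weight. *)
Lemma reach_lazyk x y c : reach (fun x => Z (Tx T x w)) x y c ->
  exists l : nat, l%:R <= c /\ expR (- c) <= lazyk l (y - x) (Tx T x w).
Proof.
move=> [s [-> hs]]; exists (size s); split; first exact: le_trans (size_le_path_cost x s) hs.
rewrite /path_end addrC addKr; apply: le_trans (path_lazyk x s).
by rewrite ler_expR lerN2.
Qed.

End PathBound.

(** Supersolution argument: sums of [F] depend only on endpoints and so define a potential. The
    exponential of M N minus this potential dominates both branches of the recursion, the waiting
    one by [- kappa <= M] and the moving one by the bound with [F]. *)
Lemma lazyk_le_exp (F : Omega -> dir d -> R) (M : R) w : - kappa <= M ->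
  (forall x0 s, \sum_(e <- s) vec_of e = 0 -> path_sum T F w x0 s = 0) ->
  (forall x, \sum_e weight (Tx T x w) e * expR (F (Tx T x w) e) <= expR M) ->
  forall N x y s, \sum_(e <- s) vec_of e = y ->
    lazyk N y (Tx T x w) <= expR (M * N%:R - path_sum T F w x s).
Proof.
move=> kM closed hM; elim=> [|N IH] x y s hs.
  rewrite /= mulr0 sub0r; case: eqP => [y0|_]; last exact: expR_ge0.
  by rewrite closed ?oppr0 ?expR0 // hs.
rewrite -natr1 mulrDr mulr1 addrAC expRD mulrC /= ge_max; apply/andP; split.
  by apply: ler_pM; rewrite ?expR_ge0 ?lazyk_ge0 ?ler_expR // IH.
apply: (@le_trans _ _ (\sum_e weight (Tx T x w) e *
    (expR (F (Tx T x w) e) * expR (M * N%:R - path_sum T F w x s)))).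
  apply: ler_sum => e _; rewrite ler_wpM2l ?weight_ge0 // -expRD.
  have -> : T e (Tx T x w) = Tx T (x + vec_of e) w by rewrite addrC TxD // Tx_vec.
  (* Stepping back along [e] before following [s] reaches the same site from the shifted start; the
     loop made of [e] and its opposite cancels the extra term. *)
  have hs' : \sum_(e' <- dir_opp e :: s) vec_of e' = y - vec_of e.
    by rewrite big_cons vec_of_opp hs addrC.
  apply: le_trans (IH _ _ _ hs') _; rewrite ler_expR /= vec_of_opp addrK.
  have : path_sum T F w x [:: e; dir_opp e] = 0.
    by apply: closed; rewrite !big_cons big_nil addr0 vec_of_opp subrr.
  by move=> /=; rewrite addr0; lra.
under eq_bigr do rewrite mulrA.
by rewrite -mulr_suml ler_wpM2r // expR_ge0.
Qed.

End WalkBounds.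

(** * Functions with finite moments, and elementary estimates *)

Section Lq.
Context (dsp : measure_display) (Omega : measurableType dsp) (R : realType)
  (P : probability Omega R) (q : R).
Hypothesis q1 : 1 <= q.
Implicit Types f g : Omega -> R.

Let q0 : 0 <= q.
Proof. exact: le_trans ler01 q1. Qed.

Definition Lq f := measurable_fun setT f /\ L1 P (fun w => `|f w| `^ q).

Lemma measurable_powR_norm f : measurable_fun setT f -> measurable_fun setT (fun w => `|f w| `^ q).
Proof.
move=> mf; apply: (measurableT_comp (measurable_powR q)).
by apply: measurableT_comp mf; exact: normr_measurable.
Qed.

Lemma powRD_le (x y : R) : 0 <= x -> 0 <= y -> (x + y) `^ q <= 2 `^ q * (x `^ q + y `^ q).
Proof.
move=> x0 y0.
wlog xy : x y x0 y0 / x <= y.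
  move=> H; case: (leP x y) => [|/ltW]; first exact: H.
  by rewrite addrC [x `^ q + _]addrC; exact: H.
apply: (@le_trans _ _ ((2 * y) `^ q)).
  by apply: ge0_ler_powR => //; rewrite ?nnegrE; lra.
by rewrite powRM // ler_wpM2l ?powR_ge0 // lerDr powR_ge0.
Qed.

Lemma LqP f : measurable_fun setT f -> (\int[P]_w ((`|f w| `^ q)%:E) < +oo)%E -> Lq f.
Proof.
move=> mf hf; split => //; apply/integrableP; split.
  by apply/measurable_EFinP; exact: measurable_powR_norm.
apply: le_lt_trans hf; rewrite le_eqVlt; apply/orP; left; apply/eqP.
by apply: eq_integral => w _ /=; rewrite (ger0_norm (powR_ge0 _ _)).
Qed.

Lemma Lq_integral f : Lq f -> (\int[P]_w ((`|f w| `^ q)%:E) < +oo)%E.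
Proof.
move=> [_ /integrableP[_]]; apply: le_lt_trans.
rewrite le_eqVlt; apply/orP; left; apply/eqP.
by apply: eq_integral => w _ /=; rewrite (ger0_norm (powR_ge0 _ _)).
Qed.

Lemma Lq_dom g f : measurable_fun setT f -> (forall w, `|f w| <= g w) -> Lq g -> Lq f.
Proof.
move=> mf fg [mg Lg]; split => //; apply: L1_dom Lg; first exact: measurable_powR_norm.
move=> w; rewrite ger0_norm ?powR_ge0 //; apply: ge0_ler_powR; rewrite ?nnegrE ?normr_ge0 //.
by apply: le_trans (fg w) (ler_norm _).
Qed.

Lemma Lq_L1 f : Lq f -> L1 P f.
Proof.
move=> [mf Lf]; apply: (@L1_dom _ _ _ _ (fun w => 1 + `|f w| `^ q)) => //.
  move=> w; case: (leP `|f w| 1) => h; first by rewrite (le_trans h) // lerDl powR_ge0.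
  by apply: (@le_trans _ _ (`|f w| `^ q)); [exact: le1r_powR (ltW h) q1 | rewrite lerDr].
by apply: L1D => //; exact: L1_cst.
Qed.

Lemma Lq_cst c : Lq (cst c).
Proof. by split; [exact: measurable_cst | exact: (L1_cst P (`|c| `^ q))]. Qed.

Lemma LqD f g : Lq f -> Lq g -> Lq (fun w => f w + g w).
Proof.
move=> [mf Lf] [mg Lg]; have m : measurable_fun setT (fun w => f w + g w) by exact: measurable_funD.
split => //; apply: (L1_dom (g := fun w => 2 `^ q * (`|f w| `^ q + `|g w| `^ q))).
- exact: measurable_powR_norm.
- move=> w; rewrite ger0_norm ?powR_ge0 //; apply: le_trans (powRD_le _ _); rewrite ?normr_ge0 //.
  by apply: ge0_ler_powR; rewrite ?nnegrE ?addr_ge0 ?ler_normD.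
- by apply: L1Z; exact: L1D.
Qed.

Lemma Lq_norm f : Lq f -> Lq (fun w => `|f w|).
Proof.
move=> [mf Lf]; split; first by apply: measurableT_comp mf; exact: normr_measurable.
by under eq_fun do rewrite normr_id.
Qed.

Lemma Lq_sum (I : Type) (s : seq I) (F : I -> Omega -> R) :
  (forall i, Lq (F i)) -> Lq (fun w => \sum_(i <- s) F i w).
Proof.
move=> hF; elim: s => [|i s IH].
  by under eq_fun do rewrite big_nil; exact: Lq_cst.
by under eq_fun do rewrite big_cons; exact: LqD.
Qed.

Lemma Lq_mpres tau f : mpres P tau -> Lq f -> Lq (f \o tau).
Proof. by move=> h [mf Lf]; split; [exact: mpres_measurable h mf | exact: (L1_mpres h Lf)]. Qed.

End Lq.

Lemma poly_le_exp (R : realType) (d : nat) (s : R) : 0 < s ->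
  exists N0 : nat, forall n, (N0 <= n)%N -> ((n.*2.+1 ^ d)%:R : R) <= expR (s * n%:R).
Proof.
move=> s0; case: d => [|d].
  by exists 0%N => n _; rewrite expn0 -expR0 ler_expR mulr_ge0 // ltW.
(* With this [t], exp(s n) is the d.+1-th power of exp(t n)^2, so it suffices that 2n + 1 <= 3n <=
   (t n)^2, which holds once n is at least 3 / t^2. *)
pose t := s / (2 * d.+1%:R); have t0 : 0 < t by rewrite divr_gt0 // mulr_gt0.
exists (maxn 1 (Num.trunc (3 / t ^+ 2)).+1) => n hn.
have n1 : (1 <= n)%N by rewrite (leq_trans (leq_maxl _ _) hn).
have -> : s * n%:R = (t * n%:R) * (2 * d.+1)%:R.
  by rewrite natrM /t mulrAC divfK // mulf_neq0 ?pnatr_eq0.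
rewrite expRM_natr exprM natrX lerXn2r ?nnegrE ?exprn_ge0 ?expR_ge0 //.
have h3 : 3 <= t ^+ 2 * n%:R.
  rewrite -ler_pdivrMl ?exprn_gt0 // mulrC; apply: ltW; apply: lt_le_trans (truncnS_gt _) _.
  by rewrite ler_nat (leq_trans (leq_maxr _ _) hn).
have e1 : t * n%:R <= expR (t * n%:R).
  by apply: le_trans (expR_ge1Dx _); rewrite lerDr.
apply: (@le_trans _ _ ((t * n%:R) ^+ 2)); last first.
  by rewrite lerXn2r ?nnegrE ?expR_ge0 // mulr_ge0 // ltW.
apply: (@le_trans _ _ (3 * n%:R)).
  by rewrite -natrM ler_nat; lia.
by rewrite (_ : (t * n%:R) ^+ 2 = t ^+ 2 * n%:R * n%:R); [rewrite ler_wpM2r | ring].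
Qed.

(** Rounding towards zero, so that [quot_vec x k *+ k] is never larger than [x] in any
    coordinate. *)
Definition quot_vec (d : nat) (x : 'rV[int]_d) (k : nat) : 'rV[int]_d :=
  \row_i (Num.sg (x ord0 i) * (absz (x ord0 i) %/ k)%:Z).

Lemma quot_int (u : int) (k : nat) : (0 < k)%N ->
  `|u - (Num.sg u * (absz u %/ k)%:Z) * k%:Z| < k%:Z /\ `|(Num.sg u * (absz u %/ k)%:Z) * k%:Z| <= `|u|.
Proof.
move=> k0; have h1 := divn_eq (absz u) k; have h2 : (absz u %% k < k)%N by rewrite ltn_mod.
case: (ltrgt0P u) h1 h2 => u0; set Q := (absz u %/ k)%N; set S := (absz u %% k)%N => h1 h2.
- by rewrite gtr0_sg // mul1r; nia.
- by rewrite ltr0_sg // mulN1r; nia.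
- by rewrite u0 sgr0 !mul0r subrr; lia.
Qed.

Lemma mulvn_entry (d : nat) (z : 'rV[int]_d) (k : nat) i :
  (z *+ k) ord0 i = (z ord0 i : int) * k%:Z :> int.
Proof. by rewrite mulmxnE -mulr_natr natz. Qed.

Lemma quot_vec_dist (d : nat) (x : 'rV[int]_d) (k : nat) i : (0 < k)%N ->
  `|x ord0 i - (quot_vec x k *+ k) ord0 i| < k%:Z /\
  `|(quot_vec x k *+ k) ord0 i| <= `|x ord0 i|.
Proof. by move=> k0; rewrite mulvn_entry mxE; exact: quot_int. Qed.

Lemma l1norm_quot_vec (d : nat) (x : 'rV[int]_d) (k : nat) : (l1norm (quot_vec x k) * k <= l1norm x)%N.
Proof.
rewrite /l1norm big_distrl /=; apply: leq_sum => i _; rewrite mxE abszM /=.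
have h : (absz (Num.sg (x ord0 i : int)) <= 1)%N by case: sgrP.
apply: leq_trans (leq_trunc_div (absz (x ord0 i)) k).
by rewrite leq_mul2r; apply/orP; right; rewrite -[leqRHS]mul1n leq_mul2r h orbT.
Qed.

(* The time m k lies slightly beyond n, leaving n / D units of time to correct the endpoint. *)
Lemma block_count (D H n : nat) : (0 < D)%N -> (0 < H)%N -> (2 * D * H <= n)%N ->
  let m := (4 * D * H)%N in let k := ((n + n %/ D) %/ m).+1 in
  [/\ (n + n %/ D < m * k)%N, (m * k <= n + n %/ D + m)%N, (k <= n %/ D)%N & (k * H <= n)%N].
Proof.
move=> D0 H0 hn m k; have m0 : (0 < m)%N by rewrite !muln_gt0 D0 H0.
have h1 : (n + n %/ D < m * k)%N by rewrite mulnC /k -ltn_divLR.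
have h2 : (m * k <= n + n %/ D + m)%N.
  by rewrite /k mulnS addnC leq_add2r mulnC leq_trunc_div.
have h3 : (n %/ D <= n)%N by exact: leq_div.
have h4 : (2 * (D * (H * k.-1)) <= n)%N.
  by move: h2; rewrite /m; case: (k) => [|k'] /=; nia.
have kE : k = k.-1.+1 by [].
split => //.
  by rewrite leq_divRL // kE; nia.
by rewrite kE; nia.
Qed.

Lemma up_log_range (n : nat) : (1 < n)%N -> (n <= 2 ^ up_log 2 n)%N /\ (2 ^ up_log 2 n < 2 * n)%N.
Proof.
move=> n1; have /andP[h1 h2] := @up_log_bounds 2 n isT n1; split => //.
have h : (0 < up_log 2 n)%N by rewrite lt0n up_log_eq0 //= -ltnNge.
by rewrite -(prednK h) expnS ltn_pmul2l.
Qed.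

Lemma bounded_partial_sums (R : realType) (u : nat -> R) K r :
  (forall n, 0 <= u n) -> 0 <= r -> r < 1 -> (forall n, (K <= n)%N -> u n <= r ^+ n) ->
  exists B : nat, forall N, \sum_(n < N) u n <= B%:R.
Proof.
move=> u0 r0 r1 ur; have r10 : 0 < 1 - r by rewrite subr_gt0.
exists (Num.trunc (\sum_(n < K) u n + (1 - r)^-1)).+1 => N.
apply: ltW; apply: le_lt_trans (truncnS_gt _).
apply: (@le_trans _ _ (\sum_(n < N + K) u n)); first by rewrite big_split_ord lerDl sumr_ge0.
rewrite addnC big_split_ord lerD2l.
apply: (@le_trans _ _ (\sum_(n < N) r ^+ n)).
  apply: ler_sum => n _; apply: le_trans (ur _ (leq_addr _ _)) _.
  by rewrite /= exprD ler_piMl ?exprn_ge0 // exprn_ile1 // ltW.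
rewrite -[leRHS]mul1r ler_pdivlMr // mulrC -opprB mulNr -subrX1 opprB gerBl exprn_ge0 //.
Qed.

Lemma exists_path (d : nat) (x : 'rV[int]_d) :
  exists s : seq (dir d), size s = l1norm x /\ \sum_(e <- s) vec_of e = x.
Proof.
have [n nE] : exists n, n = l1norm x by exists (l1norm x).
elim: n x nE => [|n IH] x nE.
  exists [::]; split => //; rewrite big_nil; apply/int_rowP => i; rewrite mxE.
  have : (absz (x ord0 i) <= l1norm x)%N by rewrite /l1norm (bigD1 i) //= leq_addr.
  by rewrite -nE leqn0 absz_eq0 => /eqP ->.
have [i xi] : exists i, x ord0 i != 0.
  apply: contrapT => h; have : l1norm x = 0%N.
    rewrite /l1norm big1 // => i _; case: (eqVneq (x ord0 i) 0) => [->//|xi].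
    by exfalso; apply: h; exists i.
  by rewrite -nE.
pose e : dir d := (i, x ord0 i < 0).
have eE j : vec_of e ord0 j = if i == j then (if x ord0 i < 0 then -1 else 1) else 0 :> int.
  by rewrite /e /vec_of /=; case: ifP => _; rewrite !mxE; case: (i == j).
have hn : n = l1norm (x - vec_of e).
  move: nE; rewrite /l1norm (bigD1 i) //= [in X in _ -> _ = X](bigD1 i) //=.
  rewrite [in X in _ -> _ = (_ + X)%N](eq_bigr (fun j => absz (x ord0 j))); last first.
    by move=> j ji; rewrite mxE mxE eE eq_sym (negPf ji) oppr0 addr0.
  rewrite mxE mxE eE eqxx; move: xi; set S := (\sum_(_ | _) _)%N.
  case: ifP; move: (x ord0 i : int) => z; lia.
have [s [ss sx]] := IH _ hn; exists (e :: s); split; first by rewrite /= ss -hn nE.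
by rewrite big_cons sx addrC subrK.
Qed.

Lemma ae_forall_countable (dsp : measure_display) (Omega : measurableType dsp) (R : realType)
    (P : probability Omega R) (I : countType) (Q : I -> Omega -> Prop) :
  (forall i, {ae P, forall w, Q i w}) -> {ae P, forall w, forall i, Q i w}.
Proof.
move=> h; have : {ae P, forall w, forall n, if unpickle n is Some i then Q i w else True}.
  by apply: ae_foralln => n; case: unpickle => [i|]; [exact: h | exact: aeW].
by apply: filterS => w hw i; have := hw (pickle i); rewrite pickleK.
Qed.

(** * Growth rates in the random environment *)

Section Environment.
Context (d : nat) (dsp : measure_display) (Omega : measurableType dsp)
    (R : realType) (P : probability Omega R)
    (T : dir d -> Omega -> Omega) (p : Omega -> dir d -> R) (a : R) (lam : 'rV[R]_d).
Hypotheses (d0 : (0 < d)%N) (mT : forall e, measurable_fun setT (T e))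
  (PT : forall e A, measurable A -> P (T e @^-1` A) = P A)
  (Tcomm : forall e e', T e \o T e' = T e' \o T e)
  (Tinv : forall e, T (dir_opp e) \o T e = id /\ T e \o T (dir_opp e) = id)
  (ergodic : forall A, measurable A -> (forall e, T e @^-1` A = A) -> P A = 0%E \/ P A = 1%E)
  (mp : forall e, measurable_fun setT (fun w => p w e))
  (p01 : forall w e, 0 <= p w e <= 1)
  (p1 : forall w, \sum_(e : dir d) p w e = 1)
  (a_gt0 : 0 < a)
  (moment : forall e, (\int[P]_w (if (p w e == 0)%R then +oo
                 else ((`|ln (p w e)| `^ (d%:R + a))%R%:E)) < +oo)%E).

Local Notation q := (d%:R + a).
Local Notation L := (\sum_i `|lam ord0 i|).
Local Notation mgf n w := (quenched_mgf T p w lam n).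

Let dR1 : 1 <= d%:R :> R.
Proof. by rewrite ler1n. Qed.

Lemma exponent_ge1 : 1 <= q.
Proof. by move: dR1 a_gt0; lra. Qed.

Lemma exponent_gtd : d%:R < q.
Proof. by rewrite ltrDl. Qed.

Let mpT e : mpres P (T e) := mpres_T mT PT e.
Let mpTx x : mpres P (Tx T x) := mpres_Tx mT PT x.

Lemma ae_all_shifts (Q : Omega -> Prop) : {ae P, forall w, Q w} ->
  {ae P, forall w, forall x, Q (Tx T x w)}.
Proof.
by move=> hQ; apply: ae_forall_countable => x; apply: mpres_ae hQ.
Qed.

Let mln e : measurable_fun setT (fun w => ln (p w e)).
Proof. exact: (measurableT_comp (@measurable_ln R) (mp e)). Qed.

Let mmoment e : measurable_fun setT (fun w =>
  if (p w e == 0)%R then +oo%E else ((`|ln (p w e)| `^ q)%R%:E)).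
Proof.
apply: measurable_fun_ifT; last by apply/measurable_EFinP; exact: measurable_powR_norm.
  by apply: measurable_fun_eqr; [exact: mp | exact: measurable_cst].
exact: measurable_cst.
Qed.

(** The integrand of the moment condition is infinite where [p] vanishes, and an integrable function
    is finite almost everywhere. *)
Lemma p_pos_ae : {ae P, forall w, forall e, 0 < p w e}.
Proof.
apply: ae_forall_countable => e.
pose f w : \bar R := if p w e == 0 then +oo%E else (`|ln (p w e)| `^ q)%:E.
have mf : measurable_fun setT f by exact: mmoment.
have f0 w : (0 <= f w)%E by rewrite /f; case: ifP => _; rewrite ?leey ?lee_fin ?powR_ge0.
have fi : P.-integrable setT f.
  apply/integrableP; split => //; apply: le_lt_trans (moment e).
  rewrite le_eqVlt; apply/orP; left; apply/eqP; apply: eq_integral => w _.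
  by rewrite gee0_abs.
apply: filterS (integrable_ae measurableT fi) => w /(_ Logic.I).
rewrite /f; case: eqP => // /eqP pn0 _; rewrite lt_neqAle eq_sym pn0 /=.
by case/andP: (p01 w e).
Qed.

(** The 1 makes path lengths bounded by path costs, [L] absorbs the exponential tilt, and summing
    over all directions gives a cost per site rather than per edge. *)
Definition step_cost (w : Omega) : R := 1 + L + \sum_(e : dir d) `|ln (p w e)|.

Lemma step_cost_ge1 w : 1 <= step_cost w.
Proof. by rewrite /step_cost -addrA lerDl addr_ge0 // sumr_ge0. Qed.

Lemma Lq_ln_p e : Lq P q (fun w => ln (p w e)).
Proof.
apply: LqP => //; apply: le_lt_trans (moment e); apply: ge0_le_integral.
- exact: measurableT.
- by move=> w _; rewrite lee_fin powR_ge0.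
- by apply/measurable_EFinP; exact: measurable_powR_norm.
- exact: mmoment.
- by move=> w _; case: ifP => _; rewrite ?leey.
Qed.

Lemma Lq_step_cost : Lq P q step_cost.
Proof.
apply: LqD; [exact: exponent_ge1 | exact: Lq_cst |].
by apply: Lq_sum => [|e]; [exact: exponent_ge1 | apply: Lq_norm; exact: Lq_ln_p].
Qed.

Lemma weight_ge w e : 0 < p w e -> expR (- step_cost w) <= weight p lam w e.
Proof.
move=> p0; rewrite /weight -[X in X * _](lnK p0) -expRD ler_expR /step_cost.
have h1 : - ln (p w e) <= `|ln (p w e)| by rewrite -normrN ler_norm.
have h2 : `|ln (p w e)| <= \sum_(e : dir d) `|ln (p w e)|.
  by rewrite (bigD1 e) //= lerDl sumr_ge0.
have h3 : - dotZ lam (vec_of e) <= L.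
  by apply: le_trans (dotZ_vec_bound lam e); rewrite -normrN ler_norm.
lra.
Qed.

(** Ergodicity concerns exactly invariant events. The event that all shifts lie in [A] is exactly
    invariant, and it agrees with [A] up to a null set since any site is reached by finitely many
    steps. *)
Lemma zero_one A : measurable A -> {ae P, forall w, forall e, A w -> A (T e w)} ->
  P A = 0%E \/ {ae P, forall w, A w}.
Proof.
move=> mA hA; pose B := [set w | forall x, A (Tx T x w)].
have mB : measurable B.
  pose C (n : nat) := if (unpickle n : option 'rV[int]_d) is Some x then Tx T x @^-1` A else setT.
  have -> : B = [set w | forall n, C n w].
    apply/seteqP; split => w h; first by move=> n; rewrite /C; case: unpickle => // x; exact: h.
    by move=> x; have := h (pickle x); rewrite /C pickleK.
  by apply: measurable_forall => n; rewrite /C; case: unpickle => // x; exact: mpres_preimage.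
have Binv e : T e @^-1` B = B.
  apply/seteqP; split => w h x.
    by have := h (x - vec_of e); rewrite -Tx_vec // -TxD // subrK.
  by rewrite -Tx_vec // -TxD //; exact: h.
have AB : {ae P, forall w, A w -> B w}.
  apply: filterS (ae_all_shifts hA) => w hw Aw x.
  have [s [_ <-]] := exists_path x.
  elim/last_ind: s => [|s e IH]; first by rewrite big_nil Tx0.
  rewrite -cats1 big_cat big_seq1 /= addrC TxD // Tx_vec //; exact: hw.
case: (ergodic mB Binv) => PB; last first.
  right; apply: filterS (_ : {ae P, forall w, B w}).
    by move=> w /(_ 0); rewrite Tx0.
  by apply: ae_prob0 => //; rewrite probability_setC // PB subee.
left; apply/negligibleP => //; have [N [mN N0 hN]] := AB.
apply: (@negligibleS _ _ _ P (B `|` N)); last by apply: negligibleU; apply/negligibleP.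
move=> w Aw; case: (pselect (B w)) => Bw; [by left | right].
by apply: hN => /= h; apply: Bw; exact: h.
Qed.

(** * The corrector built from the Green function *)

Section UpperBoundLambda.
Context (c : R).

Let u (N : nat) (w : Omega) : R := \sum_(n < N) expR (- c * n%:R) * mgf n w.

(** Bounding partial sums by a natural number makes measurability a matter of countable unions and
    intersections. *)
Definition green_finite : set Omega := [set w | exists B : nat, forall N, u N w <= B%:R].

Let term_ge0 n w : 0 <= expR (- c * n%:R) * mgf n w.
Proof. by rewrite mulr_ge0 ?expR_ge0 // mgf_ge0. Qed.

Let uS N w : u N.+1 w = 1 + expR (- c) * \sum_e weight p lam w e * u N (T e w).
Proof.
rewrite /u big_ord_recl mulr0 expR0 mul1r mgf0; congr (_ + _).
under [in RHS]eq_bigr do rewrite mulr_sumr.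
rewrite [in RHS]exchange_big /= mulr_sumr; apply: eq_bigr => n _.
rewrite mgfS // !mulr_sumr; apply: eq_bigr => e _.
by rewrite /bump /= add1n -natr1 mulrDr mulr1 expRD; ring.
Qed.

Lemma measurable_mgf n : measurable_fun setT (fun w => mgf n w).
Proof.
elim: n => [|n IH]; first by under eq_fun do rewrite mgf0; exact: measurable_cst.
under eq_fun do rewrite mgfS //.
apply: measurable_sum => e; apply: measurable_funM.
  by apply: measurable_funM; [exact: mp | exact: measurable_cst].
exact: (mpres_measurable (mpT e) IH).
Qed.

Let mu N : measurable_fun setT (u N).
Proof.
apply: measurable_sum => n; apply: measurable_funM; first exact: measurable_cst.
exact: measurable_mgf.
Qed.

Lemma measurable_green_finite : measurable green_finite.
Proof.
apply: measurable_exists => B; apply: measurable_forall => N.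
by apply: measurable_le_set; [exact: mu | exact: measurable_cst].
Qed.

Let u_nd w : {homo u ^~ w : n m / (n <= m)%N >-> n <= m}.
Proof.
apply: homo_leq => [x //|x y z|n]; first exact: le_trans.
by rewrite /u big_ord_recr /= lerDl.
Qed.

Let uE w := limn (u ^~ w).

Let u_cvg w : green_finite w -> u ^~ w @ \oo --> uE w.
Proof.
move=> [B hB]; apply: nondecreasing_is_cvgn; first exact: u_nd.
by exists B%:R => _ [N _ <-].
Qed.

Let weight_u_le N w e : weight p lam w e * u N (T e w) <= expR c * u N.+1 w.
Proof.
have h : 0 <= \sum_(e' | e' != e) weight p lam w e' * u N (T e' w).
  by apply: sumr_ge0 => e' _; rewrite mulr_ge0 ?weight_ge0 // sumr_ge0.
rewrite uS (bigD1 e) //= mulrDr mulr1 mulrA -expRD subrr expR0 mul1r.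
by have := expR_gt0 c; lra.
Qed.

(** The first-step recursion contains the sum at [T e w] with a positive weight, so it is bounded by
    a multiple of the sum at [w]. *)
Lemma green_finite_invariant w e : 0 < p w e -> green_finite w -> green_finite (T e w).
Proof.
move=> p0 [B hB]; have w0 : 0 < weight p lam w e by rewrite mulr_gt0 ?expR_gt0.
exists (Num.trunc ((weight p lam w e)^-1 * (expR c * B%:R))).+1 => N.
apply: ltW; apply: le_lt_trans (truncnS_gt _); rewrite ler_pdivlMl //.
by apply: le_trans (weight_u_le _ _ _) _; rewrite ler_wpM2l ?expR_ge0.
Qed.

Lemma green_finite_zero_one : P green_finite = 0%E \/ {ae P, forall w, green_finite w}.
Proof.
apply: zero_one; first exact: measurable_green_finite.
by apply: filterS p_pos_ae => w hp e; exact: green_finite_invariant.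
Qed.

(** An exactly invariant set. Putting [v] equal to 0 outside it makes [F] a true coboundary
    everywhere, not merely almost surely. *)
Let good : set Omega :=
  [set w | forall x, green_finite (Tx T x w) /\ forall e, 0 < p (Tx T x w) e].

Let mgood : measurable good.
Proof.
pose A := green_finite `&` \bigcap_(e in [set: dir d]) [set w | 0 < p w e].
have mA : measurable A.
  apply: measurableI; first exact: measurable_green_finite.
  apply: fin_bigcap_measurable; first exact: finite_finset.
  by move=> e _; apply: measurable_lt_set; [exact: measurable_cst | exact: mp].
pose C (n : nat) := if (unpickle n : option 'rV[int]_d) is Some x then Tx T x @^-1` A else setT.
have -> : good = [set w | forall n, C n w].
  apply/seteqP; split => w h.
    by move=> n; rewrite /C; case: unpickle => // x; have [h1 h2] := h x; split => // e _; exact: h2.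
  move=> x; have := h (pickle x); rewrite /C pickleK => -[h1 h2]; split => // e; exact: (h2 e Logic.I).
by apply: measurable_forall => n; rewrite /C; case: unpickle => // x; exact: mpres_preimage.
Qed.

Let good_T e w : good (T e w) <-> good w.
Proof.
split => h x; last by rewrite -Tx_vec // -TxD //; exact: h.
by have := h (x - vec_of e); rewrite -Tx_vec // -TxD // subrK.
Qed.

Let v (w : Omega) : R := if w \in good then ln (uE w) else 0.

Let uE_rec w : good w -> uE w = 1 + expR (- c) * \sum_e weight p lam w e * uE (T e w).
Proof.
move=> gw; have [g0 _] := gw 0; rewrite Tx0 in g0.
have h1 : (fun N => u N.+1 w) @ \oo --> uE w by have := u_cvg g0; rewrite -cvg_shiftS.
have h2 : (fun N => u N.+1 w) @ \oo --> 1 + expR (- c) * \sum_e weight p lam w e * uE (T e w).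
  under eq_fun do rewrite uS.
  apply: cvgD; first exact: cvg_cst.
  apply: cvgMl_tmp; apply: cvg_big => [|e _]; first exact: add_continuous.
  apply: cvgMl_tmp; apply: u_cvg.
  by have [] := gw (vec_of e); rewrite Tx_vec.
exact: (cvg_unique _ h1 h2).
Qed.

Let uE_ge1 w : good w -> 1 <= uE w.
Proof.
move=> gw; have [g0 _] := gw 0; rewrite Tx0 in g0.
have u1 : u 1 w = 1 by rewrite /u big_ord1 mulr0 expR0 mul1r mgf0.
by rewrite -u1; apply: nondecreasing_cvgn_le; [exact: u_nd | apply/cvg_ex; eexists; exact: u_cvg].
Qed.

Let mv : measurable_fun setT v.
Proof.
have muE : measurable_fun setT (fun w => if w \in good then uE w else 1).
  apply: (@measurable_fun_cvg _ _ _ _ (fun N w => if w \in good then u N w else 1)).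
    move=> N; apply: measurable_fun_ifT; [|exact: mu|exact: measurable_cst].
    apply: (measurable_fun_bool true); rewrite setTI (_ : _ @^-1` _ = good) //.
    by apply/seteqP; split => w' /=; [exact: set_mem | exact: mem_set].
  move=> w _; case: ifP => [/set_mem gw|_]; last exact: cvg_cst.
  by apply: u_cvg; have [] := gw 0; rewrite Tx0.
have -> : v = (fun w => ln (if w \in good then uE w else 1)).
  by apply/funext => w; rewrite /v; case: ifP => //; rewrite ln1.
exact: (measurableT_comp (@measurable_ln R) muE).
Qed.

Let v_ge0 w : 0 <= v w.
Proof. by rewrite /v; case: ifP => // /set_mem gw; rewrite ln_ge0 // uE_ge1. Qed.

Let F (w : Omega) (e : dir d) : R := v (T e w) - v w.

Let mF e : measurable_fun setT (fun w => F w e).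
Proof. by apply: measurable_funB => //; exact: (mpres_measurable (mpT e) mv). Qed.

Let sum_weight_le w : good w -> \sum_e weight p lam w e * uE (T e w) <= expR c * uE w.
Proof.
move=> gw; rewrite (uE_rec gw) mulrDr mulr1 mulrA -expRD subrr expR0 mul1r.
by rewrite lerDr expR_ge0.
Qed.

Let F_le w e : good w -> F w e <= `|c| + step_cost w.
Proof.
move=> gw; have [_ p0] := gw 0; have {}p0 := p0 e; rewrite Tx0 in p0.
have gTw : good (T e w) by apply/good_T.
rewrite /F /v !mem_set //.
have ue : 0 < uE (T e w) by apply: lt_le_trans (uE_ge1 gTw).
have uw : 0 < uE w by apply: lt_le_trans (uE_ge1 gw).
have h : expR (- step_cost w) * uE (T e w) <= expR c * uE w.
  apply: le_trans (sum_weight_le gw); rewrite (bigD1 e) //= ler_wpDr //.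
    apply: sumr_ge0 => e' _; rewrite mulr_ge0 ?weight_ge0 //.
    by apply: le_trans ler01 (uE_ge1 _); apply/good_T.
  by rewrite ler_wpM2r ?(ltW ue) // weight_ge.
have : ln (expR (- step_cost w) * uE (T e w)) <= ln (expR c * uE w).
  by rewrite ler_ln ?posrE ?mulr_gt0 ?expR_gt0.
rewrite !lnM ?posrE ?expR_gt0 // !expRK; have := ler_norm c; lra.
Qed.

(** The recursion bounds [F] only from above; the lower bound is the upper bound for the reversed
    step, because [F (T e w) (dir_opp e)] is [- F w e]. *)
Let F_bound w e : `|F w e| <= 2 * `|c| + (step_cost w + step_cost (T e w)).
Proof.
have c0 := normr_ge0 c; have s1 := step_cost_ge1 w; have s2 := step_cost_ge1 (T e w).
case: (pselect (good w)) => gw; last first.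
  have ngT : ~ good (T e w) by move=> /good_T.
  by rewrite /F /v !memNset // subrr normr0; lra.
have gTw : good (T e w) by apply/good_T.
have h1 := F_le e gw; have h2 := F_le (dir_opp e) gTw.
have h3 : F (T e w) (dir_opp e) = - F w e.
  by rewrite /F; have [/(congr1 (fun f => f w)) /= -> _] := Tinv e; rewrite opprB.
by rewrite ler_norml; move: h1 h2; rewrite h3; lra.
Qed.

Let Lq_F e : Lq P q (fun w => F w e).
Proof.
apply: (Lq_dom exponent_ge1 (mF e) (fun w => F_bound w e)).
apply: LqD; [exact: exponent_ge1 | exact: Lq_cst |].
apply: LqD; [exact: exponent_ge1 | exact: Lq_step_cost |].
exact: Lq_mpres (mpT e) Lq_step_cost.
Qed.

(** [Ex_coboundary_le0] is one-sided, so it is applied once along [T e] and once along its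
    inverse. *)
Let Ex_F e : Ex P (fun w => F w e) = 0.
Proof.
have LF e' : L1 P (fun w => F w e') := Lq_L1 exponent_ge1 (Lq_F e').
apply/eqP; rewrite eq_le; apply/andP; split.
  have h : (fun w => F w e) = (fun w => v w - v (T (dir_opp e) w)) \o T e.
    apply/funext => w /=; rewrite /F.
    by have [/(congr1 (fun f => f w)) /= -> _] := Tinv e.
  have L' : L1 P (fun w => v w - v (T (dir_opp e) w)).
    rewrite (_ : (fun w => _) = (fun w => -1 * F w (dir_opp e))); first exact: L1Z.
    by apply/funext => w; rewrite /F mulN1r opprB.
  rewrite h (Ex_mpres (mpT e) L').
  by apply: (Ex_coboundary_le0 (mpT (dir_opp e)) mv v_ge0 L').
have L' : L1 P (fun w => -1 * F w e) by exact: L1Z.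
have := Ex_coboundary_le0 (mpT e) mv v_ge0 L'.
rewrite ExZ // mulN1r oppr_le0; apply.
by move=> w; rewrite /F mulN1r opprB.
Qed.

Let path_sum_F w x s : path_sum T F w x s = v (Tx T (x + \sum_(e <- s) vec_of e) w) - v (Tx T x w).
Proof.
elim: s x => [|e s IH] x /=; first by rewrite big_nil addr0 subrr.
rewrite IH big_cons [x + (_ + _)]addrA /F.
have -> : T e (Tx T x w) = Tx T (x + vec_of e) w by rewrite addrC TxD // Tx_vec.
by rewrite [LHS]addrC addrA subrK.
Qed.

Let classK_F : classK P T F.
Proof.
split; first exact: mF.
split; first by exists a; split => // e; exact: Lq_integral (Lq_F e).
split.
  move=> e; have LF : L1 P (fun w => F w e) := Lq_L1 exponent_ge1 (Lq_F e).
  have := Ex_F e; rewrite /Ex /Rintegral => h.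
  by rewrite -[LHS]fineK ?h //; exact: (integrable_fin_num _ LF).
by apply: aeW => w x0 s hs; rewrite path_sum_F hs addr0 subrr.
Qed.

(* The corrector is [F w e = v (T e w) - v w] with [v] the logarithm of the Green function. *)
Lemma Lambda_le : {ae P, forall w, green_finite w} -> (Lambda P T p lam <= c%:E)%E.
Proof.
move=> hA; apply: ereal_inf_le; eexists; first by exists F; [exact: classK_F | reflexivity].
apply/ess_supP; apply: filterS2 (ae_all_shifts hA) (ae_all_shifts p_pos_ae) => w h1 h2.
have gw : good w by move=> x; split.
have uw : 0 < uE w by apply: lt_le_trans (uE_ge1 gw).
rewrite lee_fin.
have -> : \sum_e p w e * expR (dotZ lam (vec_of e) + F w e) =
    (\sum_e weight p lam w e * uE (T e w)) / uE w.
  rewrite mulr_suml; apply: eq_bigr => e _.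
  have gTw : good (T e w) by apply/good_T.
  rewrite /weight expRD /F /v !mem_set // expRD expRN !lnK ?posrE ?mulrA //.
  by apply: lt_le_trans (uE_ge1 gTw).
have S0 : 0 < \sum_e weight p lam w e * uE (T e w).
  have e0 : dir d := (Ordinal d0, true).
  rewrite (bigD1 e0) //= ltr_wpDr //.
    apply: sumr_ge0 => e' _; rewrite mulr_ge0 ?weight_ge0 //.
    by apply: le_trans ler01 (uE_ge1 _); apply/good_T.
  rewrite mulr_gt0 //; last by apply: lt_le_trans (uE_ge1 _) => //; apply/good_T.
  by rewrite mulr_gt0 ?expR_gt0 //; have := h2 0 e0; rewrite Tx0.
rewrite -[leRHS]expRK ler_ln ?posrE ?expR_gt0 ?divr_gt0 //.
by rewrite ler_pdivrMr //; exact: sum_weight_le.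
Qed.

End UpperBoundLambda.

(** * From frequent growth to steady growth in a fixed direction *)

Section Velocity.
Context (kappa : R).
Hypothesis kappaL : L <= kappa.
Local Notation lazyk := (lazyk T p lam kappa).

Let kappa0 : 0 <= kappa.
Proof. by apply: le_trans kappaL; rewrite sumr_ge0. Qed.

Lemma measurable_lazyk N y : measurable_fun setT (fun w => lazyk N y w).
Proof.
elim: N y => [|N IH] y /=; first exact: measurable_cst.
apply: (@measurable_maxr _ _ _ _ (fun w => expR (- kappa) * lazyk N y w)
  (fun w => \sum_e weight p lam w e * lazyk N (y - vec_of e) (T e w))).
  by apply: measurable_funM; [exact: measurable_cst | exact: IH].
apply: measurable_sum => e; apply: measurable_funM.
  by apply: measurable_funM; [exact: mp | exact: measurable_cst].
exact: (mpres_measurable (mpT e) (IH _)).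
Qed.

Definition positive_env (w : Omega) := forall x e, 0 < p (Tx T x w) e.

Definition cost_bounded (C : R) (w : Omega) :=
  forall r, cube_sum r (fun x => step_cost (Tx T x w) `^ q) <= C * (r.*2.+1 ^ d)%:R.

Lemma positive_env_ae : {ae P, forall w, positive_env w}.
Proof. exact: ae_all_shifts p_pos_ae. Qed.

Let L1_cost_pow : L1 P (fun w => step_cost w `^ q).
Proof.
have := Lq_step_cost.2; rewrite (_ : (fun w => `|step_cost w| `^ q) = (fun w => step_cost w `^ q)) //.
by apply/funext => w; rewrite ger0_norm // (le_trans ler01) // step_cost_ge1.
Qed.

Lemma measurable_cost_bounded C : measurable (cost_bounded C).
Proof.
apply: measurable_forall => r; apply: measurable_le_set; last exact: measurable_cst.
exact: (measurable_cube_sum mpTx L1_cost_pow).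
Qed.

Lemma cost_bounded_ae : {ae P, forall w, exists C, 0 <= C /\ cost_bounded C w}.
Proof.
exact: (cube_average_bounded mpTx (TxD Tcomm Tinv) L1_cost_pow (fun w => powR_ge0 _ _)).
Qed.

(* The cost [eps * 2 ^+ i] of joining two sites is sublinear in the scale, so a displacement of the
   endpoint does not affect exponential growth rates. *)
Lemma harnack (C eps : R) : 0 <= C -> 0 < eps ->
  exists h : nat, forall w, positive_env w -> cost_bounded C w ->
    forall i, (h <= i)%N -> forall x y : 'rV[int]_d,
      (forall k, `|x ord0 k| <= 2 ^+ i) -> (forall k, `|y ord0 k| <= 2 ^+ i) ->
      (forall k, `|x ord0 k - y ord0 k| < 2 ^+ (i - h)) ->
      step_cost (Tx T x w) <= eps * 2 ^+ i /\
      exists l : nat, l%:R <= eps * 2 ^+ i /\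
        expR (- (eps * 2 ^+ i)) <= lazyk l (y - x) (Tx T x w).
Proof.
move=> C0 e0.
(* A cube of radius 2^(j+1) has side 4 * 2^j + 1, at most 8 * 2^j. *)
have C80 : 0 <= C * 8 ^+ d by rewrite mulr_ge0 ?exprn_ge0.
have [h hh] := morrey exponent_gtd exponent_ge1 C80 e0.
exists h => w wp wC i hi x y hx hy hxy.
have hr : reach (fun x => step_cost (Tx T x w)) x y (eps * 2 ^+ i).
  apply: hh hi _ _ hx hy hxy.
    by move=> z; rewrite (le_trans ler01) // step_cost_ge1.
  move=> j; apply: le_trans (wC _) _; rewrite -mulrA ler_wpM2l //.
  rewrite -exprAC -exprMn natrX lerXn2r ?nnegrE ?mulr_ge0 ?exprn_ge0 //.
  rewrite -natrX -natrM ler_nat expnS.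
  have : (0 < 2 ^ j)%N by rewrite expn_gt0.
  lia.
split.
  have Z0 z : 0 <= step_cost (Tx T z w) by rewrite (le_trans ler01) // step_cost_ge1.
  exact: (reach_src Z0 hr).
have hZ z e : expR (- step_cost (Tx T z w)) <= weight p lam (Tx T z w) e by exact: weight_ge.
exact: (reach_lazyk kappa Tcomm Tinv p01 step_cost_ge1 hZ hr).
Qed.

Let lz_ge0 N y w : 0 <= lazyk N y w.
Proof. exact: lazyk_ge0. Qed.

(** Pigeonhole over the (2n + 1)^d endpoints. The generating function is positive, so the selected
    endpoint lies in the support of the kernel, which bounds its norm by n. *)
Lemma endpoint_exists n w : exists x, (l1norm x <= n)%N /\
  mgf n w <= (n.*2.+1 ^ d)%:R * lazyk n x w.
Proof.
have G0 : (0 < #|[set: {ffun 'I_d -> 'I_(n.*2.+1)}]%SET|)%N.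
  by rewrite cardsT card_ffun !card_ord expn_gt0.
have [g _ hg] := exists_le_avg (fun g => - lazyk n (gridpt (const_mx (- n%:Z)) g) w) G0.
set x := gridpt _ g in hg; exists x.
have h : mgf n w <= (n.*2.+1 ^ d)%:R * lazyk n x w.
  apply: le_trans (mgf_le_cube_sum Tcomm Tinv p01 kappaL w (leqnn n)) _.
  move: hg; rewrite sumrN mulrN lerN2 ler_pdivrMl ?ltr0n // /cube_sum.
  rewrite (eq_bigl xpredT) => [|u]; last by rewrite inE.
  by rewrite cardsT card_ffun !card_ord.
split => //; apply: (@lazyk_support _ _ _ T p lam kappa n x w).
apply/eqP => z0; move: h; rewrite z0 mulr0 leNgt.
by rewrite (lt_le_trans (expR_gt0 _) (mgf_ge lam Tcomm Tinv p01 p1 n w)).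
Qed.

(** Go to a best endpoint [x] at time n, correct it to a multiple z k within n / D units of time,
    and wait until time m k. That [m] does not depend on n or [w] confines z to a finite set. *)
Lemma velocity_at_scale (C c eps : R) : 0 <= C -> 0 < eps ->
  exists m N0 : nat, (0 < m)%N /\ forall w, positive_env w -> cost_bounded C w ->
    forall n, (N0 <= n)%N -> expR (c * n%:R) <= mgf n w ->
    exists z k, [/\ (l1norm z + 2 <= m)%N, (n <= m * k)%N &
      expR ((c - eps) * (m * k)%:R) <= lazyk (m * k) (z *+ k) w].
Proof.
(* Price per unit of extra time: [c] in absolute value for replacing n by m k, [kappa] for waiting,
   1 for the correcting path. The loss [eps] is shared equally by the polynomial factor, the time n
   / D and the additive [m]. *)
move=> C0 e0; pose A : R := `|c| + kappa + 1.
have A0 : 0 < A by rewrite /A; have := normr_ge0 c; have := kappa0; lra.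
pose D := (Num.trunc (3 * A / eps)).+1.
have D0 : 0 < D%:R :> R by rewrite ltr0n.
have hD : 3 * A <= eps * D%:R.
  by rewrite -ler_pdivrMl // mulrC ltW // truncnS_gt.
have D20 : 0 < 1 / (2 * D%:R) :> R by rewrite divr_gt0 // mulr_gt0.
have [h hh] := harnack C0 D20.
(* This size gives k * 2^h <= n, so the rounding error below k is small enough for [harnack], and k
   <= n / D, so z is strictly shorter than [m]. *)
pose m := (4 * D * 2 ^ h)%N.
have e3 : 0 < eps / 3 by rewrite divr_gt0.
have [N1 hN1] := poly_le_exp d e3.
pose N2 := (Num.trunc (3 * (A * m%:R) / eps)).+1.
exists m, (maxn (maxn N1 N2) (2 * D * 2 ^ h)%N); split.
  by rewrite /m !muln_gt0 expn_gt0.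
move=> w wp wC n hn gn.
have nN1 : (N1 <= n)%N by rewrite (leq_trans _ hn) // !leq_max leqnn.
have nN2 : (N2 <= n)%N by rewrite (leq_trans _ hn) // !leq_max leqnn orbT.
have nDH : (2 * D * 2 ^ h <= n)%N by rewrite (leq_trans _ hn) // leq_max leqnn orbT.
have H0 : (0 < 2 ^ h)%N by rewrite expn_gt0.
pose k := ((n + n %/ D) %/ m).+1.
have [k1 k2 k3 k4] : [/\ (n + n %/ D < m * k)%N, (m * k <= n + n %/ D + m)%N, (k <= n %/ D)%N
  & (k * 2 ^ h <= n)%N] := block_count (ltn0Sn _) H0 nDH.
have [x [xn hx]] := endpoint_exists n w.
exists (quot_vec x k), k.
have k0 : (0 < k)%N by [].
clearbody k; clearbody m.
have nmk : (n <= m * k)%N by rewrite (leq_trans _ (ltnW k1)) // leq_addr.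
split => //.
  have h1 := l1norm_quot_vec x k.
  have h2 : (l1norm (quot_vec x k) * k + k < m * k)%N.
    by apply: leq_ltn_trans k1; apply: leq_add => //; exact: leq_trans h1 xn.
  by move: h2; rewrite -mulSnr ltn_mul2r => /andP[_]; rewrite addn2.
have n1 : (1 < n)%N by apply: leq_trans nDH; rewrite -mulnA leq_pmulr // muln_gt0 H0.
have [] := up_log_range n1; move: (up_log 2 n) => i i1 i2.
have hi : (h <= i)%N.
  rewrite -(leq_exp2l (m := 2)) //; apply: leq_trans i1; apply: leq_trans nDH.
  by rewrite leq_pmull.
have natz2 j : (2 : int) ^+ j = (2 ^ j)%N%:Z by rewrite -[RHS]natz natrX.
have xi j : (absz (x ord0 j) <= 2 ^ i)%N.
  by apply: leq_trans i1; apply: leq_trans xn; rewrite /l1norm (bigD1 j) //= leq_addr.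
have ki : (k <= 2 ^ (i - h))%N.
  have e : (2 ^ i = 2 ^ (i - h) * 2 ^ h)%N by rewrite -expnD subnK.
  by rewrite -(leq_pmul2r H0) -e (leq_trans k4).
have xi' j : `|x ord0 j| <= 2 ^+ i by rewrite natz2 -abszE lez_nat.
have xk j : `|x ord0 j - (quot_vec x k *+ k) ord0 j| < 2 ^+ (i - h).
  by apply: lt_le_trans (quot_vec_dist x j k0).1 _; rewrite natz2 lez_nat.
have [_ [l [hl1 hl2]]] := hh w wp wC i hi x (quot_vec x k *+ k) xi'
  (fun j => le_trans (quot_vec_dist x j k0).2 (xi' j)) xk.
have D2 : 1 / (2 * D%:R) * 2 ^+ i <= n%:R / D%:R :> R.
  have : (2 ^+ i : R) <= 2 * n%:R by rewrite -natrX -natrM ler_nat ltnW.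
  have -> : 1 / (2 * D%:R) * 2 ^+ i = 2 ^+ i / 2 / D%:R :> R.
    by field; rewrite gt_eqF.
  by rewrite ler_pM2r ?invr_gt0 // ler_pdivrMr // [2 * _]mulrC.
have lD : (l <= n %/ D)%N.
  rewrite leq_divRL // -(ler_nat R) natrM -ler_pdivlMr //.
  exact: le_trans hl1 D2.
have nl : (n + l <= m * k)%N by apply: leq_trans (ltnW k1); rewrite leq_add2l.
have := lazykM lam Tcomm Tinv p01 kappa n l x (quot_vec x k *+ k - x) w.
rewrite subrKC => h1.
have := lazyk_wait T p lam kappa (m * k - (n + l)) (n + l) (quot_vec x k *+ k) w.
rewrite subnKC // => h2; apply: le_trans h2.
have pol := hN1 n nN1.
have lx : expR (c * n%:R - eps / 3 * n%:R) <= lazyk n x w.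
  rewrite expRD expRN ler_pdivrMr ?expR_gt0 //.
  apply: le_trans gn _; apply: le_trans hx _; rewrite mulrC ler_wpM2l //.
have ll : expR (- (n%:R / D%:R)) <= lazyk l (quot_vec x k *+ k - x) (Tx T x w).
  by apply: le_trans hl2; rewrite ler_expR lerN2.
have nD : n%:R / D%:R <= eps * n%:R / (3 * A).
  rewrite ler_pdivrMr // (_ : _ * D%:R = n%:R * (eps * D%:R / (3 * A))); last first.
    by field; rewrite gt_eqF.
  by rewrite ler_peMr // ler_pdivlMr ?mulr_gt0 // mul1r.
have mA : A * m%:R <= eps / 3 * n%:R.
  have : 3 * (A * m%:R) / eps <= n%:R.
    by apply: ltW; apply: lt_le_trans (truncnS_gt _) _; rewrite ler_nat.
  rewrite ler_pdivrMr //; lra.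
have gap : (m * k)%:R - n%:R <= n%:R / D%:R + m%:R :> R.
  have : (m * k)%:R <= (n + n %/ D + m)%:R :> R by rewrite ler_nat.
  have : (n %/ D)%:R <= n%:R / D%:R :> R.
    by rewrite ler_pdivlMr // -natrM ler_nat leq_trunc_div.
  rewrite !natrD; lra.
have gap0 : n%:R <= (m * k)%:R :> R by rewrite ler_nat.
apply: (@le_trans _ _ (expR (- kappa * (m * k - (n + l))%:R) *
    (expR (c * n%:R - eps / 3 * n%:R) * expR (- (n%:R / D%:R))))); last first.
  rewrite ler_wpM2l ?expR_ge0 //; apply: le_trans h1.
  by apply: ler_pM; rewrite ?expR_ge0.
rewrite -!expRD ler_expR.
have w1 : kappa * (m * k - (n + l))%:R <= kappa * (n%:R / D%:R + m%:R).
  apply: ler_wpM2l => //; apply: le_trans gap; rewrite natrB // natrD.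
  by have : 0 <= l%:R :> R by []; lra.
have w2 : c * ((m * k)%:R - n%:R) <= `|c| * (n%:R / D%:R + m%:R).
  apply: (@le_trans _ _ (`|c| * ((m * k)%:R - n%:R))).
    by apply: ler_wpM2r; [rewrite subr_ge0 | exact: ler_norm].
  by apply: ler_wpM2l.
have w3 : eps * n%:R <= eps * (m * k)%:R by rewrite ler_pM2l.
have w4 : A * (n%:R / D%:R) <= eps / 3 * n%:R.
  have -> : eps / 3 * n%:R = A * (eps * n%:R / (3 * A)) by field; rewrite gt_eqF.
  by rewrite ler_pM2l.
have nD0 : 0 <= n%:R / D%:R :> R by rewrite divr_ge0 // ltW.
have m0 : 0 <= m%:R :> R by [].
move: w1 w2 w3 w4 mA; rewrite /A !mulrDl !mulrDr !mulNr !mul1r.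
lra.
Qed.

Definition frequent_growth (c : R) : set Omega :=
  [set w | forall K, exists n, (K <= n)%N /\ expR (c * n%:R) <= mgf n w].

Lemma measurable_frequent_growth c : measurable (frequent_growth c).
Proof.
apply: measurable_forall => K.
apply: (@measurable_exists _ _ (fun n => [set w | (K <= n)%N /\ expR (c * n%:R) <= mgf n w])) => n.
by apply: measurable_conj; apply: measurable_le_set; [exact: measurable_cst | exact: measurable_mgf].
Qed.

(** Only finitely many z have norm at most m - 2. If each worked for boundedly many k, the largest
    of these bounds would contradict growth at arbitrarily late times. *)
Lemma frequent_velocity (C c eps : R) : 0 <= C -> 0 < eps ->
  exists m, (0 < m)%N /\ forall w, positive_env w -> cost_bounded C w -> frequent_growth c w ->
    exists z, (l1norm z + 2 <= m)%N /\ forall K, exists k, (K <= k)%N /\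
      expR ((c - eps) * (m * k)%:R) <= lazyk (m * k) (z *+ k) w.
Proof.
move=> C0 e0; have [m [N0 [m0 hm]]] := velocity_at_scale c C0 e0.
exists m; split => // w wp wC wf; apply: contrapT => nz.
pose pt (g : {ffun 'I_d -> 'I_(m.*2.+1)}) := gridpt (const_mx (- m%:Z)) g.
have /choice [Kz hKz] : forall g, exists K, (l1norm (pt g) + 2 <= m)%N ->
    forall k, (K <= k)%N -> lazyk (m * k) (pt g *+ k) w < expR ((c - eps) * (m * k)%:R).
  move=> g; apply: contrapT => h; apply: nz; exists (pt g).
  have hg : (l1norm (pt g) + 2 <= m)%N.
    by apply: contrapT => hg; apply: h; exists 0%N => /hg.
  split => // K; apply: contrapT => hK; apply: h; exists K => _ k Kk.
  by rewrite ltNge; apply/negP => hk; apply: hK; exists k.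
pose K := (\max_g Kz g)%N.
have [n [hn gn]] := wf (maxn N0 (m * K)).
have [z [k [zm nmk hk]]] := hm w wp wC n (leq_trans (leq_maxl _ _) hn) gn.
have Kk : (K <= k)%N.
  by rewrite -(leq_pmul2l m0) (leq_trans (leq_trans (leq_maxr _ _) hn)).
have zi i : (absz (z ord0 i) <= m)%N.
  apply: leq_trans (leq_trans (leq_addr 2 _) zm).
  by rewrite /l1norm (bigD1 i) //= leq_addr.
have zlt i : (absz (z ord0 i + m%:Z)%R < m.*2.+1)%N.
  by have := zi i; move: (z ord0 i : int) => u; clear; lia.
have ze : z = pt [ffun i => Ordinal (zlt i)].
  apply/int_rowP => i; rewrite !mxE ffunE /=.
  by have := zi i; move: (z ord0 i : int) => u; clear; lia.
rewrite ze in zm hk.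
have := hKz _ zm k (leq_trans (leq_bigmax _) Kk).
by rewrite ltNge hk.
Qed.

(** Allowing every loss 1 / (j + 1) makes the event insensitive to moving the starting site, which
    consumes an arbitrarily small part of the rate. *)
Definition velocity_event (m : nat) (z : 'rV[int]_d) (h : R) : set Omega :=
  [set w | forall j K, exists k, (K <= k)%N /\
     expR ((h - j.+1%:R^-1) * (m * k)%:R) <= lazyk (m * k) (z *+ k) w].

Lemma measurable_velocity_event m z h : measurable (velocity_event m z h).
Proof.
apply: measurable_forall => j; apply: (@measurable_forall _ _ (fun K => [set w | exists k, (K <= k)%N /\
     expR ((h - j.+1%:R^-1) * (m * k)%:R) <= lazyk (m * k) (z *+ k) w])) => K.
apply: (@measurable_exists _ _ (fun k => [set w | (K <= k)%N /\
     expR ((h - j.+1%:R^-1) * (m * k)%:R) <= lazyk (m * k) (z *+ k) w])) => k.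
apply: measurable_conj; apply: measurable_le_set; first exact: measurable_cst.
exact: measurable_lazyk.
Qed.

(** From [w], step along [e], follow the good stretch of displacement z k, then walk z - e and wait:
    this reaches z (k + 1) at time m (k + 1). The 2 leaves room for the step [e] and for undoing
    it. *)
Lemma velocity_event_shift m z h C w e : (l1norm z + 2 <= m)%N -> 0 <= C ->
  positive_env w -> cost_bounded C w -> velocity_event m z h (T e w) -> velocity_event m z h w.
Proof.
move=> zm C0 wp wC hT j K; pose s : R := j.+1%:R^-1.
have s0 : 0 < s by rewrite invr_gt0.
have m0 : (0 < m)%N by apply: leq_trans zm; rewrite addn2.
have mR : 0 < m%:R :> R by rewrite ltr0n.
(* The correcting path visits at most [m] sites, each costing at most eps 2^i with 2^i < 2n; in
   total at most a quarter of [s] times n. *)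
pose eps : R := s / (8 * m%:R); have eps0 : 0 < eps by rewrite divr_gt0 // mulr_gt0.
have [h0 hh] := harnack C0 eps0.
pose K2 := (Num.trunc (4 * ((h - s) * m%:R + step_cost w + kappa * m%:R + s * m%:R) / (s * m%:R))).+1.
(* This index halves the loss: 1 / (2j + 2) is s / 2, and the rest of [s] pays for the detour. *)
have [k [hk hl]] := hT j.*2.+1 (maxn (maxn K K2) (2 ^ h0)%N).
have kK : (K <= k)%N by rewrite (leq_trans _ hk) // !leq_max leqnn.
have kK2 : (K2 <= k)%N by rewrite (leq_trans _ hk) // !leq_max leqnn orbT.
have kh0 : (2 ^ h0 <= k)%N by rewrite (leq_trans _ hk) // leq_max leqnn orbT.
exists k.+1; split; first exact: leqW.
have [t [st tz]] := exists_path (z - vec_of e).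
have tm : (size t < m)%N.
  apply: leq_trans zm; rewrite st addn2 ltnS.
  by apply: leq_trans (l1normD _ _) _; rewrite -vec_of_opp l1norm_vec addn1.
pose x := z *+ k + vec_of e; pose n := (m * k + m + 1)%N.
have n1 : (1 < n)%N by rewrite /n addn1 ltnS addn_gt0 m0 orbT.
have [] := up_log_range n1; move: (up_log 2 n) => i i1 i2.
have hi : (h0 <= i)%N.
  rewrite -(leq_exp2l (m := 2)) //; apply: leq_trans i1; apply: leq_trans kh0 _.
  by rewrite /n -addnA; apply: leq_trans (leq_addr _ _); rewrite leq_pmull.
(* [harnack] with equal endpoints bounds the cost of every single site in the cube. *)
have pc : path_cost (fun x => step_cost (Tx T x w)) x t <= (size t).+1%:R * (eps * 2 ^+ i).
  apply: (@path_cost_le _ _ _ _ _ _ (m * k + 1)%N).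
    move=> y hy; have hy' c' : `|y ord0 c'| <= 2 ^+ i.
      have -> : (2 : int) ^+ i = (2 ^ i)%N%:Z by rewrite -[RHS]natz natrX.
      rewrite -abszE lez_nat; apply: leq_trans i1; apply: leq_trans (hy c') _.
      by rewrite /n addnAC leq_add2r leq_add2l ltnW.
    by have [] := hh w wp wC i hi y y hy' hy'; first by move=> c'; rewrite subrr normr0 exprn_gt0.
  move=> c'; rewrite /x mxE; apply: leq_trans (absz_add_le _ _) _; apply: leq_add.
    rewrite mulvn_entry abszM /= leq_mul2r; apply/orP; right.
    apply: leq_trans (leq_trans (leq_addr 2 _) zm).
    by rewrite /l1norm (bigD1 c') //= leq_addr.
  exact: absz_vec_of.
have hZ y e' : expR (- step_cost (Tx T y w)) <= weight p lam (Tx T y w) e' by exact: weight_ge.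
have l1 := path_lazyk kappa Tcomm Tinv p01 step_cost_ge1 hZ x t.
rewrite tz /x TxD // Tx_vec // in l1.
have l2 := lazykM lam Tcomm Tinv p01 kappa (m * k) (size t) (z *+ k) (z - vec_of e) (T e w).
have l3 := lazyk_step T lam p01 kappa (m * k + size t) (z *+ k + (z - vec_of e)) w e.
have l4 := lazyk_wait T p lam kappa (m - (size t).+1) (m * k + size t).+1 (z *+ k.+1) w.
have e1 : vec_of e + (z *+ k + (z - vec_of e)) = z *+ k.+1.
  by rewrite addrCA subrKC mulrSr.
rewrite e1 in l3.
have e2 : ((m * k + size t).+1 + (m - (size t).+1) = m * k.+1)%N.
  by rewrite -addnS -addnA subnKC // mulnS addnC.
rewrite e2 in l4; apply: le_trans l4.
have w0 : expR (- step_cost w) <= weight p lam w e by apply: weight_ge; have := wp 0 e; rewrite Tx0.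
apply: (@le_trans _ _ (expR (- kappa * m%:R) * (expR (- step_cost w) *
   (expR ((h - s / 2) * (m * k)%:R) * expR (- (m%:R * (eps * 2 ^+ i))))))); last first.
  apply: ler_pM; rewrite ?mulr_ge0 ?expR_ge0 //.
    rewrite ler_expR !mulNr lerN2 ler_wpM2l // ler_nat; exact: leq_subr.
  apply: le_trans l3; apply: ler_pM; rewrite ?mulr_ge0 ?expR_ge0 //.
  apply: le_trans l2; apply: ler_pM; rewrite ?expR_ge0 //.
    apply: le_trans hl; rewrite ler_expR ler_wpM2r // lerD2l lerN2 /s.
    rewrite -[j.*2.+2]/(j.+1.*2) -muln2 natrM invfM lexx //.
  apply: le_trans l1; rewrite ler_expR lerN2; apply: le_trans pc _.
  by apply: ler_wpM2r; [rewrite mulr_ge0 ?exprn_ge0 // ltW | rewrite ler_nat].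
rewrite -!expRD ler_expR.
have b1 : m%:R * (eps * 2 ^+ i) <= s / 4 * (m%:R * (k%:R + 2)).
  have h2 : 2 ^+ i <= 2 * n%:R :> R by rewrite -natrX -natrM ler_nat ltnW.
  have h3 : n%:R <= m%:R * (k%:R + 2) :> R.
    by rewrite -(natrD _ k 2) -natrM ler_nat /n mulnDr -addnA leq_add2l muln2 -addnn leq_add2l.
  have -> : m%:R * (eps * 2 ^+ i) = s / 8 * 2 ^+ i by rewrite /eps; field; rewrite gt_eqF.
  have : s / 8 * 2 ^+ i <= s / 8 * (2 * n%:R) by rewrite ler_pM2l // divr_gt0.
  have : s / 4 * n%:R <= s / 4 * (m%:R * (k%:R + 2)) by rewrite ler_pM2l // divr_gt0.
  lra.
have b2 : 4 * ((h - s) * m%:R + step_cost w + kappa * m%:R + s * m%:R) <= s * m%:R * k%:R.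
  rewrite -ler_pdivrMl ?mulr_gt0 // mulrC; apply: ltW; apply: lt_le_trans (truncnS_gt _) _.
  by rewrite ler_nat.
have -> : (h - j.+1%:R^-1) * (m * k.+1)%:R = (h - s) * m%:R * k%:R + (h - s) * m%:R.
  by rewrite -/s natrM -[k.+1%:R]natr1; ring.
have -> : (h - s / 2) * (m * k)%:R = (h - s) * m%:R * k%:R + s * m%:R * k%:R / 2.
  by rewrite natrM; field.
move: b1; have -> : s / 4 * (m%:R * (k%:R + 2)) = s * m%:R * k%:R / 4 + s * m%:R / 2.
  by field.
have sm : 0 < s * m%:R by rewrite mulr_gt0.
move: sm b2; rewrite mulNr.
move: (s * m%:R * k%:R) (s * m%:R) ((h - s) * m%:R * k%:R) ((h - s) * m%:R) (kappa * m%:R)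
  (step_cost w) (m%:R * (eps * 2 ^+ i)) => A B D E F G I.
lra.
Qed.

Lemma lazyk_lower_bound m z s w x : positive_env w -> (size s <= m)%N -> \sum_(e <- s) vec_of e = z ->
  expR (- (kappa * m%:R + path_cost (fun x => step_cost (Tx T x w)) x s)) <= lazyk m z (Tx T x w).
Proof.
move=> wp sm sz.
have hZ y e' : expR (- step_cost (Tx T y w)) <= weight p lam (Tx T y w) e' by exact: weight_ge.
have l1 := path_lazyk kappa Tcomm Tinv p01 step_cost_ge1 hZ x s; rewrite sz in l1.
have l2 := lazyk_wait T p lam kappa (m - size s) (size s) z (Tx T x w).
rewrite subnKC // in l2; apply: le_trans l2; rewrite opprD expRD.
apply: ler_pM; rewrite ?expR_ge0 // ler_expR mulNr lerN2 ler_wpM2l // ler_nat.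
exact: leq_subr.
Qed.

Lemma lazyk_pos m z k w : positive_env w -> (l1norm z <= m)%N -> 0 < lazyk (m * k) (z *+ k) w.
Proof.
move=> wp zm; have [s [sz szz]] := exists_path z.
elim: k => [|k IH]; first by rewrite muln0 mulr0n /= eqxx.
have h := lazykM lam Tcomm Tinv p01 kappa (m * k) m (z *+ k) z w.
rewrite mulnS addnC mulrSr; apply: lt_le_trans h; apply: mulr_gt0 => //.
apply: lt_le_trans (lazyk_lower_bound (z *+ k) wp _ szz); first exact: expR_gt0.
by rewrite sz.
Qed.

Lemma L1_path_cost x s : L1 P (fun w => path_cost (fun x => step_cost (Tx T x w)) x s).
Proof.
have Lc y : L1 P (fun w => step_cost (Tx T y w)).
  exact: (L1_mpres (mpTx y) (Lq_L1 exponent_ge1 Lq_step_cost)).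
elim: s x => [|e s IH] x /=; first by apply: L1D => //; exact: (L1_cst P 0).
exact: L1D.
Qed.

Let ae_not (A : set Omega) : measurable A -> P A = 0%E -> {ae P, forall w, ~ A w}.
Proof. by move=> mA A0; exists A; split => // w /contrapT. Qed.

Let prob0_of_ae (A : set Omega) : measurable A -> {ae P, forall w, ~ A w} -> P A = 0%E.
Proof.
move=> mA h; apply/negligibleP => //; apply: negligibleS h => w Aw /=; exact.
Qed.

(** The block length [m] depends on the constant [C], so [C] is first made deterministic on an event
    of positive probability. *)
Lemma frequent_growth_cost_bounded c : P (frequent_growth c) <> 0%E ->
  exists n : nat, P (frequent_growth c `&` cost_bounded n%:R) <> 0%E.
Proof.
move=> nz; apply: contrapT => h; apply: nz.
have m n : measurable (frequent_growth c `&` cost_bounded n%:R).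
  by apply: measurableI; [exact: measurable_frequent_growth | exact: measurable_cost_bounded].
have h' : {ae P, forall w, forall n : nat, ~ (frequent_growth c `&` cost_bounded n%:R) w}.
  apply: ae_foralln => n; apply: ae_not => //; apply: contrapT => hn; apply: h.
  by exists n.
apply: prob0_of_ae; first exact: measurable_frequent_growth.
apply: filterS2 h' cost_bounded_ae => w hw [C [C0 hC]] wf.
apply: (hw (Num.trunc C).+1); split => // r; apply: le_trans (hC r) _.
by rewrite ler_wpM2r // ltW // truncnS_gt.
Qed.

Lemma frequent_velocity_event c eps : P (frequent_growth c) <> 0%E -> 0 < eps ->
  exists m z, [/\ (0 < m)%N, (l1norm z + 2 <= m)%N & P (velocity_event m z (c - eps)) <> 0%E].
Proof.
move=> nz e0; have [n hn] := frequent_growth_cost_bounded nz.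
have [m [m0 hm]] := frequent_velocity c (ler0n _ n) e0.
exists m; apply: contrapT => h; apply: hn.
have h' : {ae P, forall w, forall z, (l1norm z + 2 <= m)%N -> ~ velocity_event m z (c - eps) w}.
  apply: ae_forall_countable => z; case: (boolP (l1norm z + 2 <= m)%N) => zm; last exact: aeW.
  have : P (velocity_event m z (c - eps)) = 0%E by apply: contrapT => hz; apply: h; exists z.
  by move=> /(ae_not (measurable_velocity_event _ _ _)); apply: filterS.
apply: prob0_of_ae.
  by apply: measurableI; [exact: measurable_frequent_growth | exact: measurable_cost_bounded].
apply: filterS2 h' positive_env_ae => w hw wp [wf wC].
have [z [zm hz]] := hm w wp wC wf; apply: (hw z zm) => j K.
have [k [Kk hk]] := hz K; exists k; split => //; apply: le_trans hk.
by rewrite ler_expR ler_wpM2r // lerBlDr lerDl invr_ge0.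
Qed.

Lemma velocity_event_ae m z h : (l1norm z + 2 <= m)%N -> P (velocity_event m z h) <> 0%E ->
  {ae P, forall w, velocity_event m z h w}.
Proof.
move=> zm nz; case: (@zero_one (velocity_event m z h)) => //.
  exact: measurable_velocity_event.
apply: filterS2 (ae_all_shifts positive_env_ae) (ae_all_shifts cost_bounded_ae) => w h1 h2 e hw.
have := h1 (vec_of e); have [C [C0]] := h2 (vec_of e); rewrite Tx_vec // => hC hp.
apply: (velocity_event_shift (e := dir_opp e) zm C0 hp hC).
by have [/(congr1 (fun f => f w)) /= -> _] := Tinv e.
Qed.

(** [superadditive_liminf] applied to the logarithm of the kernel at multiples of (m, z), with
    [Tx T z] as the transformation and the cost of one fixed path to z as [psi]. Half of [eps] is
    lost in choosing z and half in passing to the lower rate. *)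
Lemma directional_growth c eps : P (frequent_growth c) <> 0%E -> 0 < eps ->
  exists m z, (0 < m)%N /\ {ae P, forall w, exists K, forall k, (K <= k)%N ->
    expR ((c - eps) * (m * k)%:R) <= lazyk (m * k) (z *+ k) w}.
Proof.
move=> nz e0; have e2 : 0 < eps / 2 by rewrite divr_gt0.
have [m [z [m0 zm hz]]] := frequent_velocity_event nz e2.
exists m, z; split => //; have hB := velocity_event_ae zm hz.
have zm' : (l1norm z <= m)%N by rewrite (leq_trans _ zm) // leq_addr.
have [s [ss sz]] := exists_path z.
have mR : 0 < m%:R :> R by rewrite ltr0n.
pose ak k w := ln (lazyk (m * k) (z *+ k) w).
pose psi w := kappa * m%:R + path_cost (fun x => step_cost (Tx T x w)) 0 s.
have Lpsi : L1 P psi by apply: L1D; [exact: (L1_cst P (kappa * m%:R)) | exact: L1_path_cost].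
have H : {ae P, forall w, exists K, forall k, (K <= k)%N ->
    ((c - eps / 2) * m%:R - eps / 2 * m%:R) * k%:R <= ak k w}.
  apply: (@superadditive_liminf _ _ _ P (Tx T z) ak psi ((c - eps / 2) * m%:R)) => //.
  - by move=> k; exact: (measurableT_comp (@measurable_ln R) (measurable_lazyk _ _)).
  - move=> w; rewrite addr_ge0 ?mulr_ge0 // path_cost_ge0 // => x.
    by rewrite (le_trans ler01) // step_cost_ge1.
  - apply: filterS positive_env_ae => w wp k l; rewrite /ak -Tx_iter //.
    have wp' : positive_env (Tx T (z *+ k) w) by move=> x e; rewrite -TxD.
    rewrite -lnM ?posrE ?lazyk_pos // ler_ln ?posrE ?mulr_gt0 ?lazyk_pos // mulnDr mulrnDr.
    exact: lazykM.
  - by apply: aeW => w; rewrite /ak muln0 mulr0n /= eqxx ln1.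
  - apply: filterS positive_env_ae => w wp; rewrite /ak muln1 mulr1n.
    rewrite -[leLHS]expRK ler_ln ?posrE ?expR_gt0 //; last first.
      by have := lazyk_pos 1 wp zm'; rewrite muln1 mulr1n.
    by have := lazyk_lower_bound 0 wp (_ : (size s <= m)%N) sz; rewrite Tx0; apply; rewrite ss.
  - apply: filterS2 hB positive_env_ae => w hw wp e K e0'.
    pose j := Num.trunc (m%:R / e); have [k [Kk hk]] := hw j K.
    exists k; split => //; rewrite /ak -[leLHS]expRK ler_ln ?posrE ?expR_gt0 ?lazyk_pos //.
    apply: le_trans hk; rewrite ler_expR natrM mulrA ler_wpM2r // [leRHS]mulrBl lerD2l lerN2.
    by rewrite ler_pdivrMl // -ler_pdivrMr // ltW // truncnS_gt.
  - by rewrite mulr_gt0.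
apply: filterS2 H positive_env_ae => w [K hK] wp; exists K => k Kk.
rewrite -[leRHS]lnK ?posrE ?lazyk_pos // ler_expR; apply: le_trans (hK k Kk).
by rewrite natrM mulrA ler_wpM2r // -mulrBl ler_wpM2r //; lra.
Qed.

End Velocity.

(** * Comparison of the growth rate with [Lambda] *)

Lemma path_sum_shift (F : Omega -> dir d -> R) w x s :
  path_sum T F w x s = path_sum T F (Tx T x w) 0 s.
Proof.
elim: s w x => //= e s IH w x; rewrite IH [in RHS]IH add0r Tx0.
by rewrite TxC // -TxD // [vec_of e + x]addrC -TxD.
Qed.

Lemma path_sum_cat (F : Omega -> dir d -> R) w x s t :
  path_sum T F w x (s ++ t) = path_sum T F w x s + path_sum T F w (x + \sum_(e <- s) vec_of e) t.
Proof.
elim: s x => [|e s IH] x /=; first by rewrite big_nil add0r addr0.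
by rewrite IH big_cons !addrA.
Qed.

(** Repeating one path turns the potential at z k into a Birkhoff sum for a single
    transformation. *)
Lemma path_sum_repeat (F : Omega -> dir d -> R) s k w :
  path_sum T F w 0 (flatten (nseq k s)) =
  birkhoff_sum (Tx T (\sum_(e <- s) vec_of e)) (fun w => path_sum T F w 0 s) k w.
Proof.
elim: k w => [|k IH] w; first by rewrite /birkhoff_sum big_ord0.
by rewrite /= path_sum_cat add0r birkhoff_sumS -IH -path_sum_shift.
Qed.

Lemma sum_vec_repeat (s : seq (dir d)) k :
  \sum_(e <- flatten (nseq k s)) vec_of e = (\sum_(e <- s) vec_of e) *+ k.
Proof.
by elim: k => [|k IH] /=; rewrite ?big_nil // big_cat IH /= mulrS.
Qed.

Lemma L1_path_sum (F : Omega -> dir d -> R) x s : (forall e, L1 P (fun w => F w e)) ->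
  L1 P (fun w => path_sum T F w x s).
Proof.
move=> LF; elim: s x => [|e s IH] x /=; first exact: (L1_cst P 0).
by apply: L1D => //; exact: (L1_mpres (mpTx x) (LF e)).
Qed.

Lemma Ex_path_sum (F : Omega -> dir d -> R) x s : (forall e, L1 P (fun w => F w e)) ->
  (forall e, Ex P (fun w => F w e) = 0) -> Ex P (fun w => path_sum T F w x s) = 0.
Proof.
move=> LF E0; elim: s x => [|e s IH] x /=; first exact: (Ex_cst P 0).
rewrite (ExD (L1_mpres (mpTx x) (LF e)) (L1_path_sum _ s LF)) IH addr0.
by rewrite -(E0 e); exact: (Ex_mpres (mpTx x) (LF e)).
Qed.

Lemma growth_le F (M c : R) : classK P T F ->
  (ess_sup P (fun w => (ln (\sum_(e : dir d) p w e * expR (dotZ lam (vec_of e) + F w e)))%:E)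
     <= M%:E)%E -> M < c -> P (frequent_growth c) = 0%E.
Proof.
move=> [mF [[b [b0 hb]] [EF closed]]] /ess_supP hM Mc; apply: contrapT => nz.
(* [- M <= kappa] makes waiting no better than the bound by [M]. *)
pose kappa := Num.max L (- M); have kL : L <= kappa by rewrite le_max lexx.
have kM : - kappa <= M by rewrite lerNl le_max lexx orbT.
have e0 : 0 < (c - M) / 2 by rewrite divr_gt0 // subr_gt0.
have [m [z [m0 hz]]] := directional_growth kL nz e0.
have [s [_ sz]] := exists_path z.
have q1 : 1 <= d%:R + b by rewrite (le_trans dR1) // lerDl ltW.
have LF e : L1 P (fun w => F w e) := Lq_L1 q1 (LqP (mF e) (hb e)).
have EF0 e : Ex P (fun w => F w e) = 0 by rewrite /Ex /Rintegral EF.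
(* This drift is [m] times the gap between the growth rate (M + c) / 2 and the upper bound [M]. *)
have eta0 : 0 < (c - M) / 2 * m%:R by rewrite mulr_gt0 // ltr0n.
apply: (no_linear_drift (mpTx z) (L1_path_sum 0 s LF) (Ex_path_sum 0 s LF EF0) eta0).
apply: filterS3 hz closed (ae_all_shifts hM) => w [K hK] hc hS; exists K => k Kk.
have hbound x : \sum_e weight p lam (Tx T x w) e * expR (F (Tx T x w) e) <= expR M.
  under eq_bigr do rewrite /weight -mulrA -expRD.
  have := hS x; rewrite lee_fin; set S := \sum_(e : dir d) _ => lnS.
  (* [ln] takes the value 0 at nonpositive arguments, so this case is settled without it. *)
  have [S0|S0] := leP S 0; first exact: le_trans S0 (expR_ge0 _).
  by rewrite -[leLHS]lnK ?posrE // ler_expR.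
have h := lazyk_le_exp Tcomm Tinv p01 kM hc hbound (m * k) 0 (sum_vec_repeat s k).
rewrite sz Tx0 path_sum_repeat sz in h.
have := le_trans (hK k Kk) h; rewrite ler_expR natrM; lra.
Qed.

Lemma growth_above_Lambda c : (Lambda P T p lam < c%:E)%E -> P (frequent_growth c) = 0%E.
Proof.
move=> /ereal_inf_lt [_ [F KF <-]]; case E : (ess_sup _ _) => [r| |] // rc.
  by apply: (@growth_le F r) => //; rewrite E.
(* An essential supremum equal to minus infinity lies below any real bound, for instance [c - 1]. *)
by apply: (@growth_le F (c - 1)) => //; rewrite ?E ?leNye // ltrBlDr ltrDl.
Qed.

(** The generating function is always at least exp(- L n), so growth at rate [- L] is certain and
    cannot exceed [Lambda]. *)
Lemma Lambda_ge : ((- L)%:E <= Lambda P T p lam)%E.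
Proof.
rewrite leNgt; apply/negP => /growth_above_Lambda.
rewrite (_ : frequent_growth _ = setT) ?probability_setT; last first.
  by apply/seteqP; split => // w _ K; exists K; split => //; exact: mgf_ge.
by move=> /eqP; rewrite onee_eq0.
Qed.

Lemma Lambda_le_norm : (Lambda P T p lam <= L%:E)%E.
Proof.
apply: ereal_inf_le; exists (ess_sup P (fun w =>
    (ln (\sum_(e : dir d) p w e * expR (dotZ lam (vec_of e) + 0)))%:E)).
  exists (fun _ _ => 0) => //; split; first by move=> e; exact: measurable_cst.
  split.
    exists a; split => // e; under eq_integral do rewrite normr0 powR0 ?gt_eqF ?(lt_le_trans _ exponent_ge1) //.
    by rewrite integral0 ltry.
  split; first by move=> e; rewrite integral0.
  by apply: aeW => w x0 s _; elim: s x0 => //= e s IH x0; rewrite IH addr0.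
apply/ess_supP; apply: aeW => w; rewrite lee_fin; set S := \sum_(e : dir d) _.
have L0 : 0 <= L by rewrite sumr_ge0.
have [S0|S0] := leP S 0; first by rewrite ln0.
rewrite -[leRHS]expRK ler_ln ?posrE ?expR_gt0 //.
rewrite -[leRHS]mul1r -(p1 w) mulr_suml; apply: ler_sum => e _.
rewrite ler_wpM2l //; first by case/andP: (p01 w e).
by rewrite ler_expR addr0; have := dotZ_vec_bound lam e; rewrite ler_norml => /andP[].
Qed.

Lemma Lambda_fin : Lambda P T p lam = (fine (Lambda P T p lam))%:E.
Proof.
by rewrite fineK // fin_real // (lt_le_trans (ltNyr _) Lambda_ge) (le_lt_trans Lambda_le_norm (ltry _)).
Qed.

(** Otherwise the terms of the series are eventually below a geometric sequence of ratio exp(c1 -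
    c2). *)
Lemma frequent_growth_of_green c1 c2 w : c1 < c2 -> ~ green_finite c2 w -> frequent_growth c1 w.
Proof.
move=> c12 ng; apply: contrapT => nf; apply: ng.
have [K hK] : exists K, forall n, (K <= n)%N -> mgf n w < expR (c1 * n%:R).
  apply: contrapT => h; apply: nf => K; apply: contrapT => h'; apply: h; exists K => n Kn.
  by rewrite ltNge; apply/negP => hn; apply: h'; exists n.
apply: (@bounded_partial_sums _ (fun n => expR (- c2 * n%:R) * mgf n w) K (expR (c1 - c2))).
- by move=> n; rewrite mulr_ge0 ?expR_ge0 // mgf_ge0.
- exact: expR_ge0.
- by rewrite expR_lt1 subr_lt0.
- move=> n Kn; apply: (@le_trans _ _ (expR (- c2 * n%:R) * expR (c1 * n%:R))).
    by rewrite ler_wpM2l ?expR_ge0 // ltW // hK.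
  by rewrite -expRD -mulrDl -expRM_natr addrC.
Qed.

Lemma eventual_upper c : fine (Lambda P T p lam) < c ->
  {ae P, forall w, exists N, forall n, (N <= n)%N -> mgf n w < expR (c * n%:R)}.
Proof.
move=> hc; have h : P (frequent_growth c) = 0%E.
  by apply: growth_above_Lambda; rewrite Lambda_fin lte_fin.
exists (frequent_growth c); split => //; first exact: measurable_frequent_growth.
move=> w /= hw K; apply: contrapT => h'; apply: hw; exists K => n Kn.
by rewrite ltNge; apply/negP => hn; apply: h'; exists n.
Qed.

(** The gap is cut into four: at c + 3t the Green function cannot be almost surely finite, so it is
    almost surely infinite; growth at c + 2t is then frequent, growth at c + t steady along
    multiples of [m], and the last [t] pays for the remaining times. *)
Lemma eventual_lower c : c < fine (Lambda P T p lam) ->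
  {ae P, forall w, exists N, forall n, (N <= n)%N -> expR (c * n%:R) <= mgf n w}.
Proof.
set l := fine _ => cl; pose t := (l - c) / 4; have t0 : 0 < t by rewrite divr_gt0 // subr_gt0.
have nz : P (frequent_growth (c + 2 * t)) <> 0%E.
  move=> h0; case: (green_finite_zero_one (c + 3 * t)) => [g0|/Lambda_le]; last first.
    by rewrite Lambda_fin lee_fin -/l /t; lra.
  have : P.-negligible (green_finite (c + 3 * t) `|` frequent_growth (c + 2 * t)).
    apply: negligibleU; apply/negligibleP => //; first exact: measurable_green_finite.
    exact: measurable_frequent_growth.
  rewrite (_ : _ `|` _ = setT); last first.
    apply/seteqP; split => // w _; case: (pselect (green_finite (c + 3 * t) w)) => hw; [by left | right].
    by apply: frequent_growth_of_green hw; lra.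
  move=> hN; have : P setT = 0%E by apply/negligibleP.
  by rewrite probability_setT => /eqP; rewrite onee_eq0.
have [m [z [m0 hz]]] := directional_growth (lexx L) nz t0.
apply: filterS hz => w [K hK].
(* From here on [t] m k exceeds the cost of at most [m] additional steps after time m k. *)
pose K' := (Num.trunc ((L + `|c|) / t)).+1.
exists (m * maxn K K')%N => n hn.
pose k := (n %/ m)%N; pose r := (n %% m)%N.
have nE : n = (m * k + r)%N by rewrite mulnC -divn_eq.
have rm : (r < m)%N by rewrite ltn_mod.
have kK : (maxn K K' <= k)%N by rewrite /k leq_divRL // mulnC.
have hk := hK k (leq_trans (leq_maxl _ _) kK).
have kR : L + `|c| <= t * k%:R.
  rewrite -ler_pdivrMl // mulrC; apply: ltW; apply: lt_le_trans (truncnS_gt _) _.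
  by rewrite ler_nat (leq_trans (leq_maxr _ _) kK).
rewrite nE; apply: le_trans (mgf_add_ge lam Tcomm Tinv p01 p1 r (m * k) w).
apply: le_trans (_ : expR (- L * r%:R) * expR ((c + 2 * t - t) * (m * k)%:R) <= _); last first.
  rewrite ler_wpM2l ?expR_ge0 //; apply: le_trans hk _; exact: lazyk_le_mgf.
rewrite -expRD ler_expR natrD natrM.
have h1 : (L + `|c|) * r%:R <= (L + `|c|) * m%:R.
  by rewrite ler_wpM2l ?ler_nat ?(ltnW rm) // addr_ge0 // sumr_ge0.
have h2 : m%:R * (L + `|c|) <= m%:R * (t * k%:R) by rewrite ler_wpM2l.
have h3 : c * r%:R <= `|c| * r%:R by rewrite ler_wpM2r // ler_norm.
move: h1 h2 h3; move: (L) => L'; lra.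
Qed.

Lemma growth_rate : {ae P, forall w,
  ((n%:R^-1 * ln (mgf n w))%:E) @[n --> \oo] --> Lambda P T p lam}.
Proof.
rewrite Lambda_fin; set l := fine _.
have up j : {ae P, forall w, exists N, forall n, (N <= n)%N -> mgf n w < expR ((l + j.+1%:R^-1) * n%:R)}.
  by apply: eventual_upper; rewrite ltrDl invr_gt0.
have lo j : {ae P, forall w, exists N, forall n, (N <= n)%N -> expR ((l - j.+1%:R^-1) * n%:R) <= mgf n w}.
  by apply: eventual_lower; rewrite ltrBlDr ltrDl invr_gt0.
apply: filterS2 (ae_foralln up) (ae_foralln lo) => w hu hl.
apply: cvg_EFin; first exact: nearW.
apply/cvgrPdist_le => e e0; pose j := Num.trunc e^-1.
have je : j.+1%:R^-1 <= e by rewrite invf_ple ?posrE // ltW // truncnS_gt.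
have [N1 h1] := hu j; have [N2 h2] := hl j.
exists (maxn N1 N2).+1 => // n /= hn.
have n0 : 0 < n%:R :> R by rewrite ltr0n (leq_trans _ hn).
have hN : (maxn N1 N2 <= n)%N by exact: ltnW.
have g0 : 0 < mgf n w by exact: mgf_gt0.
have {}h1 := ltW (h1 n (leq_trans (leq_maxl _ _) hN)).
have {}h2 := h2 n (leq_trans (leq_maxr _ _) hN).
rewrite -[X in X <= _]lnK ?posrE // ler_expR in h1.
rewrite -[X in _ <= X]lnK ?posrE // ler_expR in h2.
have {}h1 : n%:R^-1 * ln (mgf n w) <= l + j.+1%:R^-1 by rewrite mulrC ler_pdivrMr.
have {}h2 : l - j.+1%:R^-1 <= n%:R^-1 * ln (mgf n w) by rewrite mulrC ler_pdivlMr.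
move: h1 h2 je; move: (n%:R^-1 * ln (mgf n w)) (j.+1%:R^-1) => y i h1 h2 je.
by rewrite ler_norml /=; apply/andP; split; lra.
Qed.

End Environment.

Theorem theorem1p1 (d : nat) (dsp : measure_display) (Omega : measurableType dsp)
    (R : realType) (P : probability Omega R)
    (T : dir d -> Omega -> Omega) (p : Omega -> dir d -> R) :
  (0 < d)%N ->
  (* F is countably generated *)
  (exists G : nat -> set Omega, (@measurable _ Omega) = <<s range G>>) ->
  (* measure-preserving *)
  (forall e, measurable_fun setT (T e)) ->
  (forall e A, measurable A -> P (T e @^-1` A) = P A) ->
  (* commuting *)
  (forall e e', T e \o T e' = T e' \o T e) ->
  (* T_{-e} = T_e^{-1} *)
  (forall e, T (dir_opp e) \o T e = id /\ T e \o T (dir_opp e) = id) ->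
  (* ergodicity *)
  (forall A, measurable A -> (forall e, T e @^-1` A = A) ->
     P A = 0%E \/ P A = 1%E) ->
  (* transition probabilities *)
  (forall e, measurable_fun setT (fun w => p w e)) ->
  (forall w e, 0 <= p w e <= 1) ->
  (forall w, \sum_(e : dir d) p w e = 1) ->
  (* moment condition on log p (|log 0| = +oo) *)
  (exists a : R, 0 < a /\ forall e,
     (\int[P]_w (if (p w e == 0)%R then +oo
                 else ((`|ln (p w e)| `^ (d%:R + a))%R%:E)) < +oo)%E) ->
  forall lam : 'rV[R]_d,
    {ae P, forall w,
       ((n%:R^-1 * ln (quenched_mgf T p w lam n))%:E) @[n --> \oo] -->
       Lambda P T p lam}.
Proof.
move=> d0 _ mT PT Tcomm Tinv ergodic mp p01 p1 [a [a0 moment]] lam.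
exact: (growth_rate lam d0 mT PT Tcomm Tinv ergodic mp p01 p1 a0 moment).
Qed.
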